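(* Let $u\in\mathcal U$ be an admissible control, let $X^u$ be the solution of the controlled SDE, let $u^*\in\mathcal U$ be the optimal control, and let $\delta=u^*-u$. Then the relative error is $$r(u)=\left(\mathbb E\left[\exp\left(-\int_0^T|\delta(X_s^u,s)|^2\,\mathrm ds+2\int_0^T\delta(X_s^u,s)\cdot\mathrm dW_s\right)\right]-1\right)^{\frac12},$$ or equivalently $$r(u)=\left(\mathbb E\left[\exp\left(\int_0^T|\delta(X_s^{u+2\delta},s)|^2\,\mathrm ds\right)\right]-1\right)^{\frac12}.$$
   Context: Setting. Let $0<T<\infty$, $b:\mathbb R^d\times[0,T]\to\mathbb R^d$, $\sigma:\mathbb R^d\times[0,T]\to\mathbb R^{d\times d}$ with $\sigma(x,s)$ invertible, $x_{\mathrm{init}}\in\mathbb R^d$ deterministic, $W$ a standard $d$-dimensional Brownian motion, and let $X$ solve $\mathrm dX_s=b(X_s,s)\,\mathrm ds+\sigma(X_s,s)\,\mathrm dW_s$, $X_0=x_{\mathrm{init}}$, on $[0,T]$. For given $f:\mathbb R^d\times[0,T]\to\mathbb R$ and $g:\mathbb R^d\to\mathbb R$ set $\mathcal W(X)=\int_0^T f(X_s,s)\,\mathrm ds+g(X_T)$ and $\mathcal Z=\mathbb E[e^{-\mathcal W(X)}]$, assumed finite. For a control $u:\mathbb R^d\times[0,T]\to\mathbb R^d$ let $X^u$ solve $\mathrm dX^u_s=\left(b(X^u_s,s)+\sigma(X^u_s,s)u(X^u_s,s)\right)\mathrm ds+\sigma(X^u_s,s)\,\mathrm dW_s$, $X^u_0=x_{\mathrm{init}}$.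 Let $\mathbb P$ and $\mathbb P^u$ be the laws of $X$ and $X^u$ on the path space $\mathcal C$ of continuous functions $[0,T]\to\mathbb R^d$ starting at $x_{\mathrm{init}}$ (Borel $\sigma$-algebra of the supremum norm). All coefficients are measurable and the uncontrolled SDE is well posed. $\mathcal U$ denotes the set of admissible (measurable) controls, i.e. those for which the controlled SDE has a unique strong solution, and $\mathbb P$ and $\mathbb P^u$ are equivalent with Girsanov density $$\frac{\mathrm d\mathbb P^u}{\mathrm d\mathbb P}(X)=\exp\left(\int_0^T(u^\top\sigma^{-1})(X_s,s)\cdot\mathrm dX_s-\int_0^T(\sigma^{-1}b\cdot u)(X_s,s)\,\mathrm ds-\frac12\int_0^T|u(X_s,s)|^2\,\mathrm ds\right).$$ The optimal control $u^*\in\mathcal U$ is assumed to exist and is characterized by $\mathbb P^{u^*}=\mathbb Q$, where $\frac{\mathrm d\mathbb Q}{\mathrm d\mathbb P}=\frac{e^{-\mathcal W}}{\mathcal Z}$. It is also assumed that the control $u+2\delta=2u^*-u$ is admissible; $X^{u+2\delta}$ is the corresponding controlled process. The relative error is $r(u)=\frac1{\mathcal Z}\sqrt{\operatorname{Var}\left(e^{-\mathcal W(X^u)}\frac{\mathrm d\mathbb P}{\mathrm d\mathbb P^u}(X^u)\right)}\in[0,\infty]$. *)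

(* Defs.v *)
From HB Require Import structures.
From mathcomp Require Import all_boot all_order all_algebra.
From mathcomp Require Import all_classical all_reals all_analysis.
Set Implicit Arguments.
Unset Strict Implicit.
Unset Printing Implicit Defensive.
Import Order.TTheory GRing.Theory Num.Theory.
Import numFieldNormedType.Exports.

Local Open Scope classical_set_scope.
Local Open Scope ring_scope.

Section euclidean.
Context {R : realType} {d : nat}.

Definition dot (v w : 'cV[R]_d) : R := \sum_(i < d) v i 0 * w i 0.
Definition sqnorm (v : 'cV[R]_d) : R := dot v v.
Definition enorm (v : 'cV[R]_d) : R := Num.sqrt (sqnorm v).

(* R^d carries the product sigma-algebra (which is its Borel sigma-algebra). *)
Definition coordinate_sets : set (set 'cV[R]_d) :=
  [set A | exists i (B : set R),
     measurable B /\ A = (fun v : 'cV[R]_d => v i 0) @^-1` B].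

(* Coefficients are total functions of (x, s); only the times s in [0, T] are
   ever used. *)
Definition measurable_coeff (T : R) (h : 'cV[R]_d -> R -> R) : Prop :=
  measurable_fun (setT `*` `[0, T])
    (fun p : g_sigma_algebraType coordinate_sets * R => h p.1 p.2).

Definition measurable_vcoeff (T : R) (v : 'cV[R]_d -> R -> 'cV[R]_d) : Prop :=
  forall i, measurable_coeff T (fun x s => v x s i 0).

Definition measurable_mcoeff (T : R) (A : 'cV[R]_d -> R -> 'M[R]_d) : Prop :=
  forall i j, measurable_coeff T (fun x s => A x s i j).

End euclidean.

(* Continuous functions [0, T] -> R^d starting at xinit, each encoded by its
   unique extension to R that is constant on either side of [0, T]. *)
Section path_space.
Context {R : realType} {d : nat} (T : R) (xinit : 'cV[R]_d).

Record path := Path {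
  path_fun :> R -> 'cV[R]_d ;
  path_continuous : continuous path_fun ;
  path_init : path_fun 0 = xinit ;
  path_clamp : forall s, path_fun s = path_fun (Num.min T (Num.max 0 s)) }.

Definition constant_path : path :=
  @Path (fun=> xinit) (fun x => @cst_continuous _ _ xinit x)
    erefl (fun=> erefl).

HB.instance Definition _ := gen_eqMixin path.
HB.instance Definition _ := gen_choiceMixin path.
HB.instance Definition _ := isPointed.Build path constant_path.

Definition supdist (x y : path) : R :=
  sup [set enorm (x s - y s) | s in `[0, T]].

Definition supnorm_open : set (set path) :=
  [set U | forall x, U x ->
     exists2 e : R, 0 < e & forall y, supdist x y < e -> U y].

Definition path_space := g_sigma_algebraType supnorm_open.

Definition eval_path (x : path_space) (s : R) : 'cV[R]_d := path_fun x s.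

End path_space.

Section stochastic_calculus.
Context {R : realType} {d : nat} {dO : measure_display} {Omega : measurableType dO}.
Variables (P : probability Omega R) (W : R -> Omega -> 'cV[R]_d).

(* sigma(W_r, r <= s) *)
Definition natural_filtration (s : R) : set (set Omega) :=
  <<s [set A | exists r i (B : set R),
     [/\ 0 <= r <= s, measurable B
       & A = (fun w => W r w i 0) @^-1` B] ]>>.

(* augmentation by the P-null events *)
Definition brownian_filtration (s : R) : set (set Omega) :=
  <<s natural_filtration s `|` [set N | measurable N /\ P N = 0%E] >>.

(* normal_prob takes the standard deviation as its second parameter. *)
Definition standard_brownian_motion (T : R) : Prop :=
  [/\ forall t i, 0 <= t <= T -> measurable_fun setT (fun w => W t w i 0),
      {ae P, forall w, W 0 w = 0},
      {ae P, forall w, {within `[0, T], continuous (fun t => W t w)}}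
    & forall s t, 0 <= s -> s < t -> t <= T ->
      forall (A : set Omega) (B : 'I_d -> set R),
        natural_filtration s A -> (forall i, measurable (B i)) ->
        P (A `&` [set w | forall i, B i (W t w i 0 - W s w i 0)]) =
        (P A * \prod_(i < d) normal_prob 0 (Num.sqrt (t - s)) (B i))%E].

Definition adapted_at (t : R) (v : Omega -> 'cV[R]_d) : Prop :=
  forall i (B : set R), measurable B ->
    brownian_filtration t ((fun w => v w i 0) @^-1` B).

Definition cvg_to0_in_prob (Y : nat -> Omega -> \bar R) : Prop :=
  forall e : R, 0 < e ->
    P [set w | (e%:E <= `|Y n w|)%E] @[n --> \oo] --> (0 : \bar R).

Record simple_process (t : R) := SimpleProcess {
  sp_size : nat ;
  sp_time : nat -> R ;
  sp_coef : nat -> Omega -> 'cV[R]_d ;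
  sp_time_ge0 : 0 <= sp_time 0 ;
  sp_time_ndecr : forall k, sp_time k <= sp_time k.+1 ;
  sp_time_le : forall k, sp_time k <= t ;
  sp_coef_adapted : forall k, adapted_at (sp_time k) (sp_coef k) ;
  sp_coef_bounded : exists M : R, forall k w, enorm (sp_coef k w) <= M }.

Definition sp_process (t : R) (h : simple_process t) (s : R) (w : Omega) :
    'cV[R]_d :=
  \sum_(k < sp_size h)
    (if sp_time h k < s <= sp_time h k.+1 then sp_coef h k w else 0).

Definition sp_integral (t : R) (h : simple_process t) (w : Omega) : R :=
  \sum_(k < sp_size h)
    dot (sp_coef h k w) (W (sp_time h k.+1) w - W (sp_time h k) w).

(* I = int_0^t H_s . dW_s as an Ito integral: a limit in probability of
   integrals of adapted simple processes h n, where
   int_0^t |h n - H|^2 ds -> 0 in probability. The jointly measurable H that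
   admit such an I are, up to dt x P-null modifications, the progressively
   measurable ones with int_0^t |H_s|^2 ds < oo a.s.; I is then unique up to
   P-null sets. *)
Definition is_ito (t : R) (H : R -> Omega -> 'cV[R]_d) (I : Omega -> R) : Prop :=
  [/\ forall i, measurable_fun (setT `*` `[0, t])
        (fun p : Omega * R => H p.2 p.1 i 0),
      measurable_fun setT I
    & exists h : nat -> simple_process t,
        cvg_to0_in_prob (fun n w =>
          (\int[lebesgue_measure]_(s in `[0%R, t])
             (sqnorm (sp_process (h n) s w - H s w))%:E)%E) /\
        cvg_to0_in_prob (fun n w => (sp_integral (h n) w - I w)%:E)].

Definition ito_integrable (t : R) (H : R -> Omega -> 'cV[R]_d) : Prop :=
  exists I, is_ito t H I.

Definition ito (t : R) (H : R -> Omega -> 'cV[R]_d) : Omega -> R :=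
  xget (fun=> 0) [set I | is_ito t H I].

(* int_0^t H_s . dY_s for an Ito process dY_s = beta_s ds + S_s dW_s *)
Definition ito_process_integrable (t : R) (H beta : R -> Omega -> 'cV[R]_d)
    (S : R -> Omega -> 'M[R]_d) : Prop :=
  {ae P, forall w, lebesgue_measure.-integrable `[0, t]
     (fun s : R => (dot (H s w) (beta s w))%:E)} /\
  ito_integrable t (fun s w => (S s w)^T *m H s w).

Definition ito_process_integral (t : R) (H beta : R -> Omega -> 'cV[R]_d)
    (S : R -> Omega -> 'M[R]_d) (w : Omega) : R :=
  \int[lebesgue_measure]_(s in `[0, t]) dot (H s w) (beta s w)
  + ito t (fun s w => (S s w)^T *m H s w) w.

Section sde.
Variables (T : R) (xinit : 'cV[R]_d).
Local Notation C := (path_space T xinit).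

(* Strong solution of dX = b(X, s) ds + sigma(X, s) dW, X_0 = xinit, on [0, T],
   i.e. one adapted to the augmented filtration of W. As X is continuous,
   requiring the integral equation a.s. at each t is the same as requiring it
   a.s. for all t simultaneously (for the continuous version of the Ito
   integral). *)
Definition strong_solution (b : 'cV[R]_d -> R -> 'cV[R]_d)
    (sigma : 'cV[R]_d -> R -> 'M[R]_d) (X : {RV P >-> C}) : Prop :=
  [/\ forall t, 0 <= t <= T -> adapted_at t (fun w => eval_path (X w) t),
      {ae P, forall w, forall i, lebesgue_measure.-integrable `[0, T]
         (fun s : R => (b (eval_path (X w) s) s i 0)%:E)},
      forall i t, 0 <= t <= T ->
        ito_integrable t (fun s w => (row i (sigma (eval_path (X w) s) s))^T)
    & forall i t, 0 <= t <= T ->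
        {ae P, forall w, eval_path (X w) t i 0 =
           xinit i 0
           + \int[lebesgue_measure]_(s in `[0, t])
               b (eval_path (X w) s) s i 0
           + ito t (fun s w => (row i (sigma (eval_path (X w) s) s))^T) w}].

Definition unique_strong_solution (b : 'cV[R]_d -> R -> 'cV[R]_d)
    (sigma : 'cV[R]_d -> R -> 'M[R]_d) : Prop :=
  (exists X : {RV P >-> C}, strong_solution b sigma X) /\
  forall X Y : {RV P >-> C}, strong_solution b sigma X ->
    strong_solution b sigma Y ->
    {ae P, forall w, forall s, 0 <= s <= T ->
       eval_path (X w) s = eval_path (Y w) s}.

Definition controlled_drift (b : 'cV[R]_d -> R -> 'cV[R]_d)
    (sigma : 'cV[R]_d -> R -> 'M[R]_d) (u : 'cV[R]_d -> R -> 'cV[R]_d)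
    (x : 'cV[R]_d) (s : R) : 'cV[R]_d := b x s + sigma x s *m u x s.

(* dP/dP^u etc.: Radon-Nikodym derivative of the law of Y w.r.t. the law of X,
   as a function on path space *)
Definition law_density (Y X : {RV P >-> C}) (x : C) : R :=
  fine (Radon_Nikodym (charge_of_finite_measure (distribution P Y))
                      (distribution P X) x).

(* Here X is the uncontrolled process, so that dX = b ds + sigma dW, and the
   integrand of dX is (u^T sigma^-1)^T. *)
Definition girsanov_density (b : 'cV[R]_d -> R -> 'cV[R]_d)
    (sigma : 'cV[R]_d -> R -> 'M[R]_d) (u : 'cV[R]_d -> R -> 'cV[R]_d)
    (X Xu : {RV P >-> C}) : Prop :=
  let at_X (A : Type) (h : 'cV[R]_d -> R -> A) (s : R) (w : Omega) : A :=
    h (eval_path (X w) s) s in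
  let H := at_X _ (fun x s => ((u x s)^T *m invmx (sigma x s))^T) in
  ito_process_integrable T H (at_X _ b) (at_X _ sigma) /\
  {ae P, forall w, law_density Xu X (X w) =
     expR (ito_process_integral T H (at_X _ b) (at_X _ sigma) w
       - \int[lebesgue_measure]_(s in `[0, T])
           at_X _ (fun x s => dot (invmx (sigma x s) *m b x s) (u x s)) s w
       - 2^-1 * \int[lebesgue_measure]_(s in `[0, T])
           at_X _ (fun x s => sqnorm (u x s)) s w)}.

Definition admissible (b : 'cV[R]_d -> R -> 'cV[R]_d)
    (sigma : 'cV[R]_d -> R -> 'M[R]_d) (X : {RV P >-> C})
    (u : 'cV[R]_d -> R -> 'cV[R]_d) : Prop :=
  [/\ measurable_vcoeff T u,
      unique_strong_solution (controlled_drift b sigma u) sigma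
    & forall Xu : {RV P >-> C},
        strong_solution (controlled_drift b sigma u) sigma Xu ->
        [/\ distribution P Xu `<< distribution P X,
            distribution P X `<< distribution P Xu
          & girsanov_density b sigma u X Xu]].

Definition work (f : 'cV[R]_d -> R -> R) (g : 'cV[R]_d -> R) (x : C) : R :=
  \int[lebesgue_measure]_(s in `[0, T]) f (eval_path x s) s
  + g (eval_path x T).

(* E[exp(-W(X))] as a real number; it is required to be finite separately *)
Definition normalizing_constant (f : 'cV[R]_d -> R -> R) (g : 'cV[R]_d -> R)
    (X : {RV P >-> C}) : R :=
  fine ('E_P[(fun w => expR (- work f g (X w)))])%E.

Definition optimal_measure (f : 'cV[R]_d -> R -> R) (g : 'cV[R]_d -> R)
    (X : {RV P >-> C}) (A : set C) : \bar R :=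
  (\int[distribution P X]_(x in A)
     (expR (- work f g x) / normalizing_constant f g X)%:E)%E.

Definition relative_error (f : 'cV[R]_d -> R -> R) (g : 'cV[R]_d -> R)
    (X Xu : {RV P >-> C}) : \bar R :=
  (((normalizing_constant f g X)^-1)%:E *
   sqrte (variance P
     (fun w => expR (- work f g (Xu w)) * law_density X Xu (Xu w))%R))%E.

End sde.
End stochastic_calculus.

(* Main.v *)
Require Import Defs.
From HB Require Import structures.
From mathcomp Require Import all_boot all_order all_algebra.
From mathcomp Require Import all_classical all_reals all_analysis.
From mathcomp Require Import measurable_realfun perm ring lra.
Set Implicit Arguments.
Unset Strict Implicit.
Unset Printing Implicit Defensive.
Import Order.TTheory GRing.Theory Num.Theory.
Import numFieldNormedType.Exports.
Local Open Scope classical_set_scope.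
Local Open Scope ring_scope.

(* Write [L_v] for the density of the law of [X^v] with respect to that of [X].
   Optimality of [ustar] means [e^(-W) / Z = L_ustar], so the weight of the
   estimator is [Z] times [L_ustar / L_u] along [X^u]; this ratio has mean [1],
   whence [r(u)^2 = E[(L_ustar / L_u)^2 (X^u)] - 1].  By Girsanov, [ln L_v] is
   [int v.dW - 1/2 int |v|^2] along [X].

   For the first formula these Ito integrals along [X] must be recognized along
   [X^u], where they pick up a drift: approximate [sigma^-T delta] by simple
   functionals of the path, whose integral against the path is itself a path
   functional, and pass to the limit under both laws, which are equivalent.

   For the second formula move the expectation to [X].  With [u2 = 2 ustar - u]
   the Ito integrals combine by linearity to
   [L_ustar^2 / L_u = L_u2 * exp (int |delta|^2)].

   The Ito integrals are handled through convergence in probability only; the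
   isometry is replaced by a bound on elementary integrals whose coefficients
   are stopped when their energy exceeds a given budget. *)

(** * Closeness in probability *)

(** No moment of a control is assumed; Ito integrability along [X] only gives almost surely finite
    energies, hence the use of convergence in probability. Moreover [ito] is a choice that returns 0
    when no integral exists, so the integral in the first formula must be shown to exist along [Xu]
    before it can be computed.

    The exponents come from expanding squares around $u$. With $u^* = u + \delta$ one has $|u^*|^2 -
    |u|^2 = 2\,\delta\cdot u + |\delta|^2$; the cross term is exactly the drift $\int \delta\cdot
    u\,ds$ that the integral of $\delta$ acquires along $X^u$, which leaves $2\int\delta\cdot dW -
    \int|\delta|^2\,ds$ in the squared ratio. With $u_2 = u + 2\delta$ one has $2|u^*|^2 - |u|^2 =
    |u_2|^2 - 2|\delta|^2$, the origin of $\exp\int|\delta|^2\,ds$.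

    [X] and [Xu] share the driving [W] but not their paths: an identity passes from one to the other
    only when both of its sides are path functionals. *)

Section smallness.
Context d (T : measurableType d) (R : realType).
Implicit Types (P : {measure set T -> \bar R}) (e : R) (Y Z : T -> \bar R).

(* Closeness in probability; [Y] need not be measurable. *)
Definition small P e Y := exists A,
  [/\ measurable A, (P A <= e%:E)%E & forall w, ~ A w -> (Y w <= e%:E)%E].

Lemma small_trans_ae P e e' Y Z : e <= e' ->
  {ae P, forall w, (Y w <= Z w)%E} -> small P e Z -> small P e' Y.
Proof.
move=> ee' [N [mN N0 YZ]] [A [mA PA ZA]]; exists (A `|` N); split.
- exact: measurableU.
- by rewrite measureU0// (le_trans PA) ?lee_fin.
- move=> w /not_orP[nA nN]; apply: (@le_trans _ _ (Z w)).
    by apply: contrapT => nYZ; apply: nN; exact: YZ.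
  by rewrite (le_trans (ZA _ nA))// lee_fin.
Qed.

Lemma small_trans P e e' Y Z : e <= e' ->
  (forall w, (Y w <= Z w)%E) -> small P e Z -> small P e' Y.
Proof. by move=> ee' YZ; apply: small_trans_ae => //; exact: aeW. Qed.

Lemma smallD P e e' Y Z : small P e Y -> small P e' Z ->
  small P (e + e') (fun w => Y w + Z w)%E.
Proof.
move=> [A [mA PA YA]] [B [mB PB ZB]]; exists (A `|` B); split.
- exact: measurableU.
- by rewrite (le_trans (measureU2 _ mA mB))// EFinD leeD.
- by move=> w /not_orP[nA nB]; rewrite EFinD leeD ?YA ?ZB.
Qed.

Lemma smallZ P e k Y : 0 <= e -> 1 <= k -> small P e Y ->
  small P (k * e) (fun w => k%:E * Y w)%E.
Proof.
move=> e0 k1 [A [mA PA YA]]; exists A; split => //.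
  by rewrite (le_trans PA)// lee_fin ler_peMl.
by move=> w nA; rewrite EFinM lee_wpmul2l ?YA// lee_fin (le_trans ler01).
Qed.

(** The null set is the lower limit of the exceptional sets, not the upper one. Each tail
    intersection lies in sets of arbitrarily small measure, so no summability enters, and a point
    outside leaves infinitely many [A n], which forces [Y w] below every positive bound. *)
Lemma small_null P Y : (forall e, 0 < e -> small P e Y) ->
  {ae P, forall w, (Y w <= 0)%E}.
Proof.
move=> sY.
have /choice[A HA] : forall n, exists A, [/\ measurable A,
    (P A <= (n.+1%:R^-1 : R)%:E)%E &
    forall w, ~ A w -> (Y w <= (n.+1%:R^-1 : R)%:E)%E].
  by move=> n; exact: sY.
have mA n : measurable (A n) by have [] := HA n.
have mB m : measurable (\bigcap_n A (n + m)%N) by exact: bigcapT_measurable.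
have B0 m : P (\bigcap_n A (n + m)%N) = 0%E.
  apply/eqP; rewrite eq_le measure_ge0 andbT; apply/lee_addgt0Pr => e e0.
  rewrite add0e; have [n _ /(_ n (leqnn n)) ne] := near_infty_natSinv_lt (PosNum e0).
  apply: (@le_trans _ _ (P (A (n + m)%N))).
    by apply: le_measure; rewrite ?inE// => w; exact.
  have [_ + _] := HA (n + m)%N => /le_trans; apply; rewrite lee_fin.
  apply: le_trans (ltW ne); rewrite lef_pV2 ?posrE ?ltr0n//.
  by rewrite ler_nat ltnS leq_addr.
exists (\bigcup_m \bigcap_n A (n + m)%N); split.
- exact: bigcupT_measurable.
- apply/eqP; rewrite eq_le measure_ge0 andbT.
  rewrite (le_trans (measure_sigma_subadditive _ _ _ (@subset_refl _ _)))//.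
    exact: bigcupT_measurable.
  by rewrite eseries0.
- move=> w /= /negP; rewrite -ltNge => Y0.
  have [m mY] : exists m : nat, forall n : nat, ((((n + m).+1%:R : R)^-1)%:E < Y w)%E.
    case: (Y w) Y0 => [r| |//]; last by move=> _; exists 0%N => n; rewrite ltry.
    rewrite lte_fin => r0.
    have [m _ /(_ m (leqnn m)) mr] := near_infty_natSinv_lt (PosNum r0).
    exists m => n; rewrite lte_fin; apply: le_lt_trans mr.
    by rewrite lef_pV2 ?posrE ?ltr0n// ler_nat ltnS leq_addl.
  exists m => // n _; apply: contrapT => nA.
  have [_ _ /(_ _ nA)] := HA (n + m)%N.
  by rewrite leNgt mY.
Qed.

Lemma small_prob P e Y : measurable_fun setT Y ->
  (P [set w | (e%:E <= Y w)%E] <= e%:E)%E -> small P e Y.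
Proof.
move=> mY PY; exists [set w | (e%:E <= Y w)%E]; split => //.
  by rewrite -[X in measurable X]setTI; apply: emeasurable_fun_c_infty.
by move=> w /= /negP; rewrite -ltNge => /ltW.
Qed.

Lemma prob_small P e Y : measurable_fun setT Y -> small P e Y ->
  (P [set w | (e%:E < Y w)%E] <= e%:E)%E.
Proof.
move=> mY [A [mA PA YA]]; rewrite (le_trans _ PA)// le_measure ?inE//.
  by rewrite -[X in measurable X]setTI; apply: emeasurable_fun_o_infty.
by move=> w /=; apply: contraPP => /YA; rewrite leNgt => /negP.
Qed.

End smallness.

Section small_cvg.
Context d (T : measurableType d) (R : realType) (P : probability T R).
Implicit Types (e : R) (Y : nat -> T -> \bar R).

Lemma cvg_prob_small Y : (forall n, measurable_fun setT (Y n)) ->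
  cvg_to0_in_prob P Y ->
  forall e, 0 < e -> exists n, forall m, (n <= m)%N -> small P e (fun w => `|Y m w|%E).
Proof.
move=> mY Y0 e e0; have := Y0 e e0.
move=> /fine_cvgP[[n1 _ fn]] /cvgrPdist_lt /(_ e e0)[n2 _ Hn].
exists (maxn n1 n2) => m; rewrite geq_max => /andP[n1m n2m].
apply: small_prob; first exact: measurableT_comp.
have := Hn m n2m; rewrite sub0r normrN => /ltW /(le_trans (ler_norm _)).
by rewrite -lee_fin fineK// fn.
Qed.

Lemma small_cvg_prob Y : (forall n, measurable_fun setT (Y n)) ->
  (forall n, small P n.+1%:R^-1 (fun w => `|Y n w|%E)) -> cvg_to0_in_prob P Y.
Proof.
move=> mY Ysm e e0; rewrite -[0%E]/(0%:E).
have mYe n : measurable [set w | (e%:E <= `|Y n w|)%E].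
  rewrite -[X in measurable X]setTI; apply: emeasurable_fun_c_infty => //.
  exact: measurableT_comp.
have fP n : P [set w | (e%:E <= `|Y n w|)%E] \is a fin_num by exact: fin_num_measure.
apply/fine_cvgP; split; first exact: nearW.
apply/cvgrPdist_lt => r r0.
have me : 0 < Num.min e r by rewrite lt_min e0.
have [n _ Hn] := near_infty_natSinv_lt (PosNum me).
exists n => // m /Hn /= mn.
rewrite sub0r normrN ger0_norm ?fine_ge0//.
rewrite -lte_fin fineK//; apply: le_lt_trans (_ : ((m.+1%:R^-1 : R)%:E < _)%E); last first.
  by rewrite lte_fin (lt_le_trans mn)// ge_min lexx orbT.
apply: le_trans (prob_small _ (Ysm m)); last by exact: measurableT_comp.
apply: le_measure; rewrite ?inE//.
  rewrite -[X in measurable X]setTI; apply: emeasurable_fun_o_infty => //.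
  exact: measurableT_comp.
move=> w /=; apply: lt_le_trans.
by rewrite lte_fin (lt_le_trans mn)// ge_min lexx.
Qed.

Lemma ge0_markov (Y : T -> \bar R) (a b : R) : 0 < a ->
  measurable_fun setT Y -> (forall w, (0 <= Y w)%E) ->
  (\int[P]_w Y w <= (a * b)%:E)%E ->
  (P [set w | (a%:E <= Y w)%E] <= b%:E)%E.
Proof.
move=> a0 mY Y0 ab.
have := @le_integral_comp_abse _ T R P setT measurableT Y a id
  (@measurable_id _ _ setT) _ _ mY a0.
move=> /(_ (fun _ => id) (fun _ _ _ _ => id)).
under eq_set do rewrite gee0_abs//.
under eq_integral do rewrite gee0_abs//.
rewrite setTI => /le_trans /(_ ab).
by rewrite EFinM lee_pmul2l ?fin_numElt ?ltNyr ?ltry// lte_fin.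
Qed.

Lemma ge0_integral_small e (Y : T -> \bar R) : 0 < e ->
  measurable_fun setT Y -> (forall w, (0 <= Y w)%E) ->
  (\int[P]_w Y w <= (e * e)%:E)%E -> small P e Y.
Proof. by move=> e0 mY Y0 Ye; apply: small_prob => //; exact: ge0_markov. Qed.

(** Truncation at 1 opens the way to dominated convergence without integrability of [Y n]. Since the
    level [r] is at most 1/2, a bound by [r] on the truncation is a bound on [Y n] itself. *)
Lemma ae_cvg_small Y : (forall n, measurable_fun setT (Y n)) ->
  (forall n w, (0 <= Y n w)%E) ->
  {ae P, forall w, Y n w @[n --> \oo] --> 0%E} ->
  forall e, 0 < e -> exists n, small P e (Y n).
Proof.
move=> mY Y0 cY e e0.
set r := Num.min e (1/2).
have r0 : 0 < r by rewrite lt_min e0; lra.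
pose f n w : \bar R := Order.min (Y n w) 1%E.
have mf n : measurable_fun setT (f n) by exact: measurable_mine.
have f0 n w : (0 <= f n w)%E by rewrite le_min Y0 lee01.
have [||_ _ /=] := @dominated_convergence _ T R P setT measurableT f (cst 0%E)
  (EFin \o cst 1) mf (measurable_cst _) _ (finite_measure_integrable_cst _ _ measurableT).
- apply: filterS cY => w Yw _.
  apply: (@squeeze_cvge _ _ _ _ (cst 0%E) _ (Y ^~ w)) => //; last exact: cvg_cst.
  by apply: nearW => n /=; rewrite f0/= ge_min lexx.
- by apply: aeW => w n _ /=; rewrite gee0_abs// ge_min lexx orbT.
rewrite integral0 => /fine_cvgP[[n1 _ fn]] /cvgrPdist_lt.
move=> /(_ (r * r) (mulr_gt0 r0 r0))[n2 _ Hn].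
exists (maxn n1 n2).
have : small P r (f (maxn n1 n2)).
  apply: ge0_integral_small => //.
  have := Hn _ (leq_maxr n1 n2); rewrite sub0r normrN => /ltW /(le_trans (ler_norm _)).
  by rewrite -lee_fin fineK// fn//= leq_maxl.
move=> [A [mA PA fA]]; exists A; split => //.
  by rewrite (le_trans PA)// lee_fin ge_min lexx.
move=> w /fA; rewrite /f ge_min => /orP[/le_trans|].
  by apply; rewrite lee_fin ge_min lexx.
have r1 : r <= 1 / 2 by rewrite ge_min lexx orbT.
by rewrite lee_fin => h1; exfalso; lra.
Qed.

(** Absolute continuity of finite measures in its epsilon-delta form. This is how closeness in
    probability passes from the law of [X] to that of the controlled process. *)
Lemma null_dominates_small (mu nu : {finite_measure set T -> \bar R}) : nu `<< mu ->
  forall e, 0 < e -> exists2 e', 0 < e' & forall Z, small mu e' Z -> small nu e Z.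
Proof.
move=> numu e e0.
have numu' : charge_of_finite_measure nu `<< mu by [].
have [A [N HAN]] := Hahn_decomposition (charge_of_finite_measure nu).
have [r [r0 Hr]] := charge_variation_continuous HAN numu' e0.
exists (Num.min (r / 2) e); first by rewrite lt_min e0 divr_gt0.
move=> Z [B [mB PB YB]]; exists B; split => //.
  apply: (@le_trans _ _ (charge_variation HAN B)).
    by rewrite (le_trans _ (abse_charge_variation HAN mB))// lee_abs.
  apply/ltW/Hr => //; apply: le_lt_trans PB _.
  by rewrite lte_fin gt_min; apply/orP; left; lra.
by move=> w /YB /le_trans; apply; rewrite lee_fin ge_min lexx orbT.
Qed.

End small_cvg.

(** * Measurability of integrals over time *)

Section joint_measurability.
Context d (T : measurableType d) (R : realType) (D : set R) (mD : measurable D).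

Lemma measurable_section d' (U : measurableType d') (F : T * R -> U) x :
  measurable_fun (setT `*` D) F -> measurable_fun D (fun s => F (x, s)).
Proof.
move=> mF; apply: (measurable_comp (F := setT `*` D) _ _ mF).
- exact: measurableX.
- by move=> _ [s Ds <-].
- by apply: measurable_funTS; apply: measurable_fun_pair.
Qed.

Lemma measurable_integral_section (F : T * R -> \bar R) :
  measurable_fun (setT `*` D) F -> (forall p, (0 <= F p)%E) ->
  measurable_fun setT (fun x => \int[lebesgue_measure]_(s in D) F (x, s))%E.
Proof.
move=> mF F0.
under eq_fun do rewrite integral_mkcond.
rewrite (_ : (fun _ => _) = fubini_F (@lebesgue_measure R) (F \_ (setT `*` D))).
  apply: measurable_fun_fubini_tonelli_F.
    have mXD : measurable ([set: T] `*` D) by exact: measurableX.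
    exact/(measurable_restrictT _ mXD).
  by move=> p; rewrite erestrict_ge0.
apply/funext => x; apply: eq_integral => s _ /=.
rewrite /patch; congr (if _ then _ else _).
by apply/idP/idP; rewrite !inE /= => // -[].
Qed.

Lemma measurable_Rintegral_section (F : T * R -> R) :
  measurable_fun (setT `*` D) F ->
  measurable_fun setT (fun x => \int[lebesgue_measure]_(s in D) F (x, s)).
Proof.
move=> mF; apply: measurableT_comp; first exact: fine_measurable.
have mE : measurable_fun (setT `*` D) (EFin \o F) by exact/measurable_EFinP.
rewrite [X in measurable_fun _ X](_ : _ = fun x =>
    \int[lebesgue_measure]_(s in D) ((EFin \o F)^\+)%E (x, s) -
    \int[lebesgue_measure]_(s in D) ((EFin \o F)^\-)%E (x, s))%E; last first.
  apply/funext => x; rewrite integralE; congr (_ - _)%E;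
    by apply: eq_integral => s _; rewrite ?funeposE ?funenegE.
apply: emeasurable_funB; apply: measurable_integral_section => //.
- exact: measurable_funepos.
- exact: measurable_funeneg.
Qed.

End joint_measurability.

(** * Moments of Gaussian increments *)

Section normal_moments.
Context (R : realType).
Local Notation mu := (@lebesgue_measure R).

Lemma ge0_integral_normal_prob (m s : R) (f : R -> \bar R) :
  measurable_fun setT f -> (forall x, (0 <= f x)%E) ->
  (\int[normal_prob m s]_x f x = \int[mu]_x (f x * (normal_pdf m s x)%:E))%E.
Proof.
move=> mf f0; have dom := @normal_prob_dominates R m s.
rewrite -(Radon_Nikodym_SigmaFinite.change_of_variables dom f0)//.
have mpdf : measurable_fun setT (EFin \o normal_pdf m s).
  by apply/measurable_EFinP; exact: measurable_normal_pdf.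
have mRN : measurable_fun setT (Radon_Nikodym_SigmaFinite.f (normal_prob m s) mu).
  exact: measurable_int (Radon_Nikodym_SigmaFinite.f_integrable dom).
apply: ae_eq_integral => //.
- exact: emeasurable_funM.
- exact: emeasurable_funM.
- apply: ae_eqe_mul2l; apply: integral_ae_eq => //.
  + exact: Radon_Nikodym_SigmaFinite.f_integrable.
  + by move=> A _ mA; rewrite -Radon_Nikodym_SigmaFinite.f_integral.
Qed.

Lemma normal_pdfN (s x : R) : s != 0 -> normal_pdf 0 s (- x) = normal_pdf 0 s x.
Proof. by move=> s0; rewrite !normal_pdfE// /normal_fun !subr0 sqrrN. Qed.

Lemma integral_normal_probN (s : R) (f : R -> \bar R) : s != 0 ->
  measurable_fun setT f -> (forall x, (0 <= f x)%E) ->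
  (\int[normal_prob 0 s]_x f (- x)%R = \int[normal_prob 0 s]_x f x)%E.
Proof.
move=> s0 mf f0.
have mN : measurable_fun setT (-%R : R -> R) by exact: oppr_measurable.
rewrite !ge0_integral_normal_prob//; last exact: measurableT_comp.
pose h x := (f x * (normal_pdf 0 s x)%:E)%E.
have mh : measurable_fun setT h.
  apply: emeasurable_funM => //; apply/measurable_EFinP.
  exact: measurable_normal_pdf.
have h0 x : (0 <= h x)%E by rewrite mule_ge0// lee_fin normal_pdf_ge0.
transitivity (\int[mu]_x h (- x)%R)%E.
  by apply: eq_integral => x _; rewrite /h normal_pdfN.
transitivity (\int[pushforward mu (-%R : _ -> measurableTypeR R)]_x h x)%E.
  by rewrite ge0_integral_pushforward.
by apply: eq_measure_integral => A mA _; exact: lebesgue_measureN.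
Qed.

(* With [y = 3 x^2 / (8 s^2)], the bound [1 + y <= exp y] trades the factor
   [x^2] for a doubling of the standard deviation. *)
Lemma normal_pdf_sq_le (s x : R) : s != 0 ->
  x ^+ 2 * normal_pdf 0 s x <= 6 * s ^+ 2 * normal_pdf 0 (2 * s) x.
Proof.
move=> s0; have s20 : 2 * s != 0 by rewrite mulf_neq0.
have s2 : 0 < s ^+ 2 by rewrite exprn_even_gt0.
rewrite !normal_pdfE//.
have -> : normal_peak s = 2 * normal_peak (2 * s) :> R.
  rewrite /normal_peak (_ : (2 * s) ^+ 2 * pi *+ 2 = 2 ^+ 2 * (s ^+ 2 * pi *+ 2)); last by ring.
  by rewrite sqrtrM ?sqr_ge0// sqrtr_sqr ger0_norm// invfM mulrA divff// mul1r.
have p0 : 0 < normal_peak (2 * s) by exact: normal_peak_gt0.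
rewrite /normal_fun !subr0.
set y := 3 * x ^+ 2 / (8 * s ^+ 2).
have -> : - x ^+ 2 / ((2 * s) ^+ 2 *+ 2) = y + - x ^+ 2 / (s ^+ 2 *+ 2).
  by rewrite /y; field.
rewrite expRD; set E := expR (_ / _).
have E0 : 0 < E by exact: expR_gt0.
have -> : x ^+ 2 * (2 * normal_peak (2 * s) * E) =
  (6 * s ^+ 2 * normal_peak (2 * s) * E) * (x ^+ 2 / (3 * s ^+ 2)) by field.
have -> : 6 * s ^+ 2 * (normal_peak (2 * s) * (expR y * E)) =
  (6 * s ^+ 2 * normal_peak (2 * s) * E) * expR y by ring.
apply: ler_wpM2l; first by rewrite mulr_ge0 ?(ltW E0)// mulr_ge0 ?(ltW p0)// mulr_ge0 ?sqr_ge0.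
apply: le_trans (expR_ge1Dx y).
have -> : x ^+ 2 / (3 * s ^+ 2) = 8 / 9 * y by rewrite /y; field.
have y0 : 0 <= y by apply: divr_ge0; apply: mulr_ge0 => //; exact: sqr_ge0.
by lra.
Qed.

(** The exact value is $s^2$; the factor 6 comes from domination by the wider Gaussian and only
    rescales later thresholds. *)
Lemma normal_second_moment (s : R) : s != 0 ->
  (\int[normal_prob 0 s]_x (x ^+ 2)%:E <= (6 * s ^+ 2)%:E)%E.
Proof.
move=> s0.
have mpdf t : measurable_fun setT (fun x : R => (normal_pdf 0 t x)%:E).
  by apply/measurable_EFinP; exact: measurable_normal_pdf.
have msq : measurable_fun setT (fun x : R => (x ^+ 2)%:E).
  by apply/measurable_EFinP; exact: exprn_measurable.
have s2 : 0 <= 6 * s ^+ 2 by rewrite mulr_ge0 ?sqr_ge0.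
rewrite ge0_integral_normal_prob//; last by move=> x; rewrite lee_fin sqr_ge0.
apply: (@le_trans _ _ (\int[mu]_x ((6 * s ^+ 2)%:E * (normal_pdf 0 (2 * s) x)%:E))%E).
  apply: ge0_le_integral => //.
  - by move=> x _; rewrite mule_ge0// lee_fin ?sqr_ge0 ?normal_pdf_ge0.
  - by apply: emeasurable_funM; [exact: msq|exact: mpdf].
  - by apply: emeasurable_funM; [exact: measurable_cst|exact: mpdf].
  by move=> x _; rewrite -!EFinM lee_fin normal_pdf_sq_le.
rewrite ge0_integralZl_EFin//; last exact: mpdf.
  by rewrite integral_normal_pdf mule1.
by move=> x _; rewrite lee_fin normal_pdf_ge0.
Qed.

End normal_moments.

(** Independence says that the law of the pair agrees with the product law on rectangles, hence
    everywhere; Tonelli then integrates [V] out with [S] frozen. *)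
Lemma ge0_integral_indep d (T : measurableType d) (R : realType)
    (P : probability T R) d1 d2 (T1 : measurableType d1) (T2 : measurableType d2)
    (N : probability T2 R) (S : T -> T1) (V : T -> T2) (g : T1 * T2 -> \bar R) :
  measurable_fun setT S -> measurable_fun setT V ->
  (forall A B, measurable A -> measurable B ->
    P (S @^-1` A `&` V @^-1` B) = (P (S @^-1` A) * N B)%E) ->
  measurable_fun setT g -> (forall p, (0 <= g p)%E) ->
  (\int[P]_w g (S w, V w) = \int[P]_w \int[N]_v g (S w, v))%E.
Proof.
move=> mS mV indep mg g0.
pose Sm : {mfun T >-> T1} := HB.pack S (isMeasurableFun.Build _ _ _ _ S mS).
pose SV w := (S w, V w).
have mSV : measurable_fun setT SV by exact: measurable_fun_pair.
pose SVm : {mfun T >-> (T1 * T2)%type} :=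
  HB.pack SV (isMeasurableFun.Build _ _ _ _ SV mSV).
transitivity (\int[distribution P SVm]_p g p)%E.
  by rewrite ge0_integral_distribution.
transitivity (\int[distribution P Sm \x N]_p g p)%E.
  apply: eq_measure_integral => A mA _; apply/esym/product_measure_unique => //.
rewrite fubini_tonelli1// ge0_integral_distribution//.
  exact: measurable_fun_fubini_tonelli_F.
by move=> x; exact: integral_ge0.
Qed.

(* Sign symmetry of the normal law averages [(a + x v)^2] and [(a - x v)^2], so
   no integrability is needed to drop the cross term. *)
Lemma normal_sq_affine_le (R : realType) (sd a x : R) : sd != 0 ->
  (\int[normal_prob 0 sd]_v ((a + x * v) ^+ 2)%:E <=
    (a ^+ 2)%:E + (6 * sd ^+ 2 * x ^+ 2)%:E)%E.
Proof.
move=> sd0; set N := normal_prob 0 sd.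
  pose g1 v : \bar R := ((a + x * v) ^+ 2)%:E.
  have mg1 : measurable_fun setT g1.
    apply/measurable_EFinP; apply: measurable_funX; exact: measurable_funD.
  have g10 v : (0 <= g1 v)%E by rewrite lee_fin sqr_ge0.
  have symg : (\int[N]_v g1 v + \int[N]_v g1 v =
      \int[N]_v ((2 * a ^+ 2)%:E + (2 * x ^+ 2)%:E * (v ^+ 2)%:E))%E.
    rewrite -[X in (_ + X)%E]integral_normal_probN// -ge0_integralD//.
      by apply: eq_integral => v _; rewrite -!EFinM -!EFinD; congr EFin; ring.
    by apply: measurableT_comp => //; exact: oppr_measurable.
  have mv : measurable_fun setT (fun v : R => (v ^+ 2)%:E).
    by apply/measurable_EFinP; exact: exprn_measurable.
  have {symg} : (\int[N]_v g1 v + \int[N]_v g1 v <=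
      (2 * a ^+ 2)%:E + (2 * x ^+ 2)%:E * (6 * sd ^+ 2)%:E)%E.
    rewrite symg ge0_integralD//; last 3 first.
    - by move=> v _; rewrite lee_fin mulr_ge0// sqr_ge0.
    - by move=> v _; rewrite -EFinM lee_fin; exact: mulr_ge0 (mulr_ge0 (ler0n _ 2) (sqr_ge0 x)) (sqr_ge0 (v : R)).
    - exact: emeasurable_funM.
    have -> : (\int[N]_v (2 * a ^+ 2)%:E = (2 * a ^+ 2)%:E)%E.
      rewrite integral_cst//= -[RHS]mule1; congr (_ * _)%E.
      exact: (@probability_setT _ _ _ (normal_prob 0 sd)).
    rewrite leeD2l//.
    have x2 : 0 <= 2 * x ^+ 2 by exact: mulr_ge0 (ler0n _ 2) (sqr_ge0 x).
    rewrite ge0_integralZl_EFin//.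
      by apply: lee_wpmul2l => //; exact: normal_second_moment.
    by move=> v _; rewrite lee_fin; exact: sqr_ge0 (v : R).
  move=> H; change (\int[N]_v g1 v <= (a ^+ 2)%:E + (6 * sd ^+ 2 * x ^+ 2)%:E)%E.
  move: H; case: (\int[N]_v g1 v)%E => [r| |]; rewrite -!EFinM -!EFinD.
  - by rewrite !lee_fin; lra.
  - by rewrite addye// leye_eq.
  - by move=> _; rewrite leNye.
Qed.

(** With [S] and [X] frozen, the sum is an affine function of a centred Gaussian, to which
    [normal_sq_affine_le] applies. *)
Lemma integral_sq_add_indep d (T : measurableType d) (R : realType)
    (P : probability T R) (sd : R) (S X V : T -> R) : sd != 0 ->
  measurable_fun setT S -> measurable_fun setT X -> measurable_fun setT V ->
  (forall (A : set (R * R)) (B : set R), measurable A -> measurable B ->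
    P ([set w | A (S w, X w)] `&` V @^-1` B) =
    (P [set w | A (S w, X w)] * normal_prob 0 sd B)%E) ->
  (\int[P]_w ((S w + X w * V w) ^+ 2)%:E <=
   \int[P]_w (S w ^+ 2)%:E + \int[P]_w (6 * sd ^+ 2 * X w ^+ 2)%:E)%E.
Proof.
move=> sd0 mS mX mV indep.
pose g (p : (R * R) * R) : \bar R := ((p.1.1 + p.1.2 * p.2) ^+ 2)%:E.
have mg : measurable_fun setT g.
  apply/measurable_EFinP; apply: measurable_funX; apply: measurable_funD.
    by apply: measurableT_comp.
  by apply: measurable_funM => //; apply: measurableT_comp.
have g0 p : (0 <= g p)%E by rewrite lee_fin sqr_ge0.
have mSX : measurable_fun setT (fun w => (S w, X w)) by exact: measurable_fun_pair.
have -> := @ge0_integral_indep _ T R P _ _ (R * R)%type (measurableTypeR R) (normal_prob 0 sd)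
  _ _ g mSX mV indep mg g0.
rewrite -ge0_integralD//; last 4 first.
- by move=> w _; rewrite lee_fin sqr_ge0.
- by apply/measurable_EFinP; apply: measurable_funX.
- by move=> w _; rewrite lee_fin; exact: mulr_ge0 (mulr_ge0 (ler0n _ 6) (sqr_ge0 _)) (sqr_ge0 _).
- by apply/measurable_EFinP; apply: measurable_funM => //; exact: measurable_funX.
have mI : measurable_fun setT (fun w => \int[normal_prob 0 sd]_v g ((S w, X w), v))%E.
  exact: measurableT_comp (@measurable_fun_fubini_tonelli_F _ _ (R * R)%type
    (measurableTypeR R) R (normal_prob 0 sd) g mg g0) mSX.
apply: ge0_le_integral => //.
- by move=> w _; exact: integral_ge0.
- apply: emeasurable_funD; apply/measurable_EFinP.
    by apply: measurable_funX.
  by apply: measurable_funM => //; exact: measurable_funX.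
- by move=> w _; exact: normal_sq_affine_le.
Qed.

Lemma eq_measure_off_null d (T : measurableType d) (R : realType)
    (P : {measure set T -> \bar R}) (A B N : set T) :
  measurable A -> measurable B -> measurable N -> P N = 0%E ->
  (forall w, ~ N w -> A w <-> B w) -> P A = P B.
Proof.
move=> mA mB mN N0 AB; rewrite -(measureU0 mA mN N0) -(measureU0 mB mN N0).
congr (P _); apply/seteqP; split => w [H|]; try by right.
  by have [Nw|/AB[h _]] := pselect (N w); [right|left; exact: h].
by have [Nw|/AB[_ h]] := pselect (N w); [right|left; exact: h].
Qed.

Lemma measurable_dot d (T : measurableType d) (R : realType) n (D : set T)
    (v v' : T -> 'cV[R]_n) :
  (forall i, measurable_fun D (fun w => v w i 0)) ->
  (forall i, measurable_fun D (fun w => v' w i 0)) ->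
  measurable_fun D (fun w => dot (v w) (v' w)).
Proof.
move=> mv mv'; rewrite /dot.
apply: (@measurable_sum _ _ _ D _ _ (fun i w => v w i 0 * v' w i 0)) => i.
exact: measurable_funM.
Qed.

(** * Brownian increments and the augmented filtration *)

Section brownian.
Context {R : realType} {n : nat} {dO : measure_display} {Omega : measurableType dO}.
Variables (P : probability Omega R) (W : R -> Omega -> 'cV[R]_n) (T : R).
Hypothesis BM : standard_brownian_motion P W T.
Implicit Types s t : R.

Local Notation DW s t := (fun w => W t w - W s w).

Lemma natural_filtration_measurable s : s <= T ->
  natural_filtration W s `<=` measurable.
Proof.
move=> sT; apply: smallest_sub; first exact: sigma_algebra_measurable.
move=> _ [r [i [B [/andP[r0 rs] mB ->]]]].
have [mW _ _ _] := BM.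
rewrite -[X in measurable X]setTI; apply: mW => //.
by rewrite r0 (le_trans rs).
Qed.

Lemma brownian_filtration_measurable s : s <= T ->
  brownian_filtration P W s `<=` measurable.
Proof.
move=> sT; apply: smallest_sub; first exact: sigma_algebra_measurable.
by move=> A [|[]//]; exact: natural_filtration_measurable.
Qed.

Lemma brownian_filtration_le s t : s <= t ->
  brownian_filtration P W s `<=` brownian_filtration P W t.
Proof.
move=> st; apply: sub_sigma_algebra2 => A [|]; last by right.
move=> nA; left; apply: sub_sigma_algebra2 nA => _ [r [i [B [/andP[r0 rs] mB ->]]]].
by exists r, i, B; split => //; rewrite r0 (le_trans rs).
Qed.

(** [standard_brownian_motion] asserts independence of increments from the natural filtration only;
    trading an augmented event for a natural one off a null set extends it. The events that admit
    such a trade form a sigma-algebra containing the generators. *)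
Lemma brownian_filtration_natural s A : s <= T -> brownian_filtration P W s A ->
  exists A' N, [/\ natural_filtration W s A', measurable N, P N = 0%E &
    forall w, ~ N w -> A w <-> A' w].
Proof.
move=> sT; move: A; apply: smallest_sub.
  split.
  - exists set0, set0; split => //; exact: sigma_algebra0.
  - move=> A [A' [N [nA' mN N0 AA']]]; exists (setT `\` A'), N; split => //.
      exact: sigma_algebraCD.
    by move=> w /AA' [h1 h2]; split => -[_ h]; split => // Aw; apply: h; auto.
  - move=> F /choice[F' /choice[N HF]].
    exists (\bigcup_k F' k), (\bigcup_k N k); split.
    + by apply: sigma_algebra_bigcup => k; have [] := HF k.
    + by apply: bigcupT_measurable => k; have [] := HF k.
    + apply/eqP; rewrite eq_le measure_ge0 andbT.
      have mN k : measurable (N k) by have [] := HF k.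
      rewrite (le_trans (measure_sigma_subadditive P mN _ (@subset_refl _ _)))//.
        exact: bigcupT_measurable.
      by rewrite eseries0// => k _ _; have [] := HF k.
    + move=> w nN; split=> -[k _ Fk]; exists k => //.
        have [_ _ _ /(_ w)[|h _]] := HF k; last exact: h.
        by move=> Nk; apply: nN; exists k.
      have [_ _ _ /(_ w)[|_ h]] := HF k; last exact: h.
      by move=> Nk; apply: nN; exists k.
move=> A [nA|[mA A0]].
  by exists A, set0; split.
exists set0, A; split => //; exact: sigma_algebra0.
Qed.

Lemma measurable_increment s t i : 0 <= s -> s <= t -> t <= T ->
  measurable_fun setT (fun w => DW s t w i 0).
Proof.
move=> s0 st tT; have [mW _ _ _] := BM.
rewrite (_ : (fun w => _) = (fun w => W t w i 0 - W s w i 0)); last first.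
  by apply/funext => w; rewrite !mxE.
by apply: measurable_funB; apply: mW; [rewrite (le_trans s0)//|rewrite s0 (le_trans st)].
Qed.

Lemma brownian_increment_indep s t A (B : 'I_n -> set R) :
  0 <= s -> s < t -> t <= T ->
  brownian_filtration P W s A -> (forall i, measurable (B i)) ->
  P (A `&` [set w | forall i, B i (DW s t w i 0)]) =
  (P A * \prod_(i < n) normal_prob 0 (Num.sqrt (t - s)) (B i))%E.
Proof.
move=> s0 st tT bA mB; have sT := le_trans (ltW st) tT.
have [A' [N [nA' mN N0 AA']]] := brownian_filtration_natural sT bA.
have mA := brownian_filtration_measurable sT bA.
have mA' := natural_filtration_measurable sT nA'.
have mC : measurable [set w | forall i, B i (DW s t w i 0)].
  rewrite (_ : mkset _ = \bigcap_(i in [set: 'I_n])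
      ((fun w => DW s t w i 0) @^-1` B i)); last first.
    by apply/seteqP; split => w h i; [move=> _; exact: h|exact: h].
  apply: fin_bigcap_measurable => // i _.
  by rewrite -[X in measurable X]setTI; apply: measurable_increment => //; exact: ltW.
rewrite (eq_measure_off_null mA mA' mN N0 AA').
have [_ _ _ indep] := BM.
rewrite -(indep s t)//.
transitivity (P (A' `&` [set w | forall i, B i (DW s t w i 0)])).
  apply: (eq_measure_off_null _ _ mN N0); [exact: measurableI..|].
  by move=> w /AA'[h1 h2]; split => -[? ?]; split => //; [exact: h1|exact: h2].
by congr (P _); apply/seteqP; split => w [Aw h]; split => // i; move: (h i); rewrite !mxE.
Qed.

(** A pi-system: the past up to [s] together with all coordinates of the increment but the [i]-th,
    which [B i = setT] leaves free. The coordinates of an increment are added one at a time, and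
    each has to be independent of those already added. *)
Definition increment_system s t (i : 'I_n) : set (set Omega) :=
  [set E | exists A (B : 'I_n -> set R), [/\ brownian_filtration P W s A,
     forall l, measurable (B l), B i = setT
     & E = A `&` [set w | forall l, B l (DW s t w l 0)]]].

Section increment_system.
Variables (s t : R) (i : 'I_n).
Hypotheses (s0 : 0 <= s) (st : s < t) (tT : t <= T).

Lemma increment_system_measurable : increment_system s t i `<=` measurable.
Proof.
move=> _ [A [B [bA mB Bi ->]]]; apply: measurableI.
  by apply: brownian_filtration_measurable bA; rewrite (le_trans (ltW st)).
rewrite (_ : mkset _ = \bigcap_(i in [set: 'I_n])
    ((fun w => DW s t w i 0) @^-1` B i)); last first.
  by apply/seteqP; split => w h l; [move=> _; exact: h|exact: h].
apply: fin_bigcap_measurable => // l _.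
by rewrite -[X in measurable X]setTI; apply: measurable_increment => //; exact: ltW.
Qed.

Lemma increment_systemT : increment_system s t i setT.
Proof.
exists setT, (fun=> setT); split => //; last by apply/seteqP.
by rewrite -(setD0 setT); apply: sigma_algebraCD; exact: sigma_algebra0.
Qed.

Lemma setI_closed_increment_system : setI_closed (increment_system s t i).
Proof.
move=> _ _ [A [B [bA mB Bi ->]]] [A' [B' [bA' mB' Bi' ->]]].
exists (A `&` A'), (fun l => B l `&` B' l); split.
- exact: (@measurableI _ (g_sigma_algebraType
    (natural_filtration W s `|` [set N | measurable N /\ P N = 0%E]))).
- by move=> l; exact: measurableI.
- by rewrite Bi Bi' setIT.
- apply/seteqP; split => w.
    by move=> [[Aw h] [A'w h']]; split; [by split|by move=> l; split; [exact: h|exact: h']].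
  by move=> [[Aw A'w] h]; split; (split; first by []) => l; have [] := h l.
Qed.

(** As functions of [E] both sides are finite measures. They agree on the pi-system because the
    constraint [B] fills exactly the free coordinate [i], and hence on the sigma-algebra it
    generates. *)
Lemma increment_system_indep E (B : set R) : measurable B ->
  <<s increment_system s t i >> E ->
  P (E `&` (fun w => DW s t w i 0) @^-1` B) =
  (P E * normal_prob 0 (Num.sqrt (t - s)) B)%E.
Proof.
move=> mB; set N := normal_prob 0 (Num.sqrt (t - s)).
have mV := measurable_increment i s0 (ltW st) tT.
have mC : measurable ((fun w => DW s t w i 0) @^-1` B).
  by rewrite -[X in measurable X]setTI; exact: mV.
have NB : N B \is a fin_num.
  exact: (@fin_num_measure _ _ _ (normal_prob 0 (Num.sqrt (t - s)))).
have NB0 : 0 <= fine (N B).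
  by apply: fine_ge0; exact: (@measure_ge0 _ _ _ (normal_prob 0 (Num.sqrt (t - s)))).
have NT : N setT = 1%E.
  exact: (@probability_setT _ _ _ (normal_prob 0 (Num.sqrt (t - s)))).
move=> HE.
have := @g_sigma_algebra_measure_unique _ R Omega (increment_system s t i)
  increment_system_measurable (fun=> setT) (fun=> increment_systemT) _
  (mrestr P mC) (mscale (NngNum NB0) P) setI_closed_increment_system _ _ E HE.
rewrite /mrestr/= /mscale/= fineK// muleC; apply.
- by rewrite bigcup_const//; exists 0%N.
- move=> _ [A [B' [bA mB' B'i ->]]].
  rewrite /mrestr -setIA.
  rewrite (_ : _ `&` _ @^-1` B = [set w | forall l,
      (if l == i then B else B' l) (DW s t w l 0)]); last first.
    apply/seteqP; split => w /=.
      by move=> [h Bw] l; case: eqP => [->//|_]; exact: h.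
    move=> h; split; last by have := h i; rewrite eqxx.
    by move=> l; have := h l; case: eqP => // -> _; rewrite B'i.
  have mBB l : measurable (if l == i then B else B' l) by case: ifP.
  rewrite (brownian_increment_indep s0 st tT bA mBB).
  rewrite (brownian_increment_indep s0 st tT bA mB') muleCA; congr (_ * _)%E.
  rewrite (bigD1 i)//= eqxx [in RHS](bigD1 i)//= B'i -/N NT mul1e; congr (_ * _)%E.
  by apply: eq_bigr => l /negbTE ->.
- by move=> _; rewrite /mrestr setTI ltey_eq fin_num_measure.
Qed.

End increment_system.

(** Its measurable sets are by definition those of [brownian_filtration P W s], so adaptedness
    becomes ordinary measurability and the closure properties of measurable functions apply to
    it. *)
Definition past_type s := g_sigma_algebraType
  (natural_filtration W s `|` [set N | measurable N /\ P N = 0%E]).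

Definition past_fun s (f : Omega -> R) :=
  measurable_fun (setT : set (past_type s)) (f : past_type s -> R).

Lemma adapted_atP s (v : Omega -> 'cV[R]_n) :
  adapted_at P W s v <-> forall i, past_fun s (fun w => v w i 0).
Proof.
split=> [av i _ B mB|mv i B mB]; first by rewrite setTI; exact: av.
by rewrite -[X in brownian_filtration _ _ _ X]setTI; exact: mv.
Qed.

Lemma past_fun_measurable s f : s <= T -> past_fun s f -> measurable_fun setT f.
Proof.
by move=> sT mf _ B mB; apply: (brownian_filtration_measurable sT); exact: mf.
Qed.

Lemma past_fun_le s t f : s <= t -> past_fun s f -> past_fun t f.
Proof.
by move=> st mf _ B mB; apply: (brownian_filtration_le st); exact: mf.
Qed.

Lemma past_fun_W s t i : 0 <= s -> s <= t -> past_fun t (fun w => W s w i 0).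
Proof.
move=> s0 st _ B mB; rewrite setTI; apply: sub_sigma_algebra; left.
by apply: sub_sigma_algebra; exists s, i, B; split => //; rewrite s0.
Qed.

(** One step of the isometry, as an inequality. The coordinates of the increment enter in turn: each
    is independent of the sum accumulated so far and of its own coefficient. The factor 6 is that of
    [normal_second_moment]. *)
Lemma integral_sq_increment s t (S : Omega -> R) (xi : Omega -> 'cV[R]_n) :
  0 <= s -> s <= t -> t <= T -> past_fun s S ->
  (forall i, past_fun s (fun w => xi w i 0)) ->
  (\int[P]_w ((S w + dot (xi w) (DW s t w)) ^+ 2)%:E <=
   \int[P]_w (S w ^+ 2)%:E + \int[P]_w (6 * (t - s) * sqnorm (xi w))%:E)%E.
Proof.
move=> s0 st tT mS mxi.
have sT := le_trans st tT.
have mS' := past_fun_measurable sT mS.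
have mxi' i := past_fun_measurable sT (mxi i).
have [<-|/eqP st'] := pselect (s = t).
  rewrite subrr mulr0; under [X in (_ + X)%E]eq_integral do rewrite mul0r.
  rewrite integral0 adde0 le_eqVlt; apply/orP; left; apply/eqP.
  apply: eq_integral => w _; rewrite /dot big1 ?addr0// => i _.
  by rewrite subrr mxE mulr0.
have {}st' : s < t by rewrite lt_neqAle st'.
set sd := Num.sqrt (t - s).
have sd0 : sd != 0 by rewrite gt_eqF// sqrtr_gt0 subr_gt0.
have sd2 : sd ^+ 2 = t - s by rewrite sqr_sqrtr// subr_ge0.
pose V i w := DW s t w i 0.
have mV i : measurable_fun setT (V i) by exact: measurable_increment.
have mpart (r : seq 'I_n) : measurable_fun setT (fun w => S w + \sum_(l <- r) xi w l 0 * V l w).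
  apply: measurable_funD => //.
  apply: (@measurable_sum _ _ _ setT _ _ (fun l w => xi w l 0 * V l w)) => l.
  exact: measurable_funM.
have ind (r : seq 'I_n) : uniq r ->
    (\int[P]_w ((S w + \sum_(l <- r) xi w l 0 * V l w) ^+ 2)%:E <=
     \int[P]_w (S w ^+ 2)%:E +
     \int[P]_w (\sum_(l <- r) 6 * sd ^+ 2 * (xi w l 0) ^+ 2)%:E)%E.
  elim: r => [_|i r IH /= /andP[ir ur]].
    under eq_integral do rewrite big_nil addr0.
    by under [X in (_ + X)%E]eq_integral do rewrite big_nil; rewrite integral0 adde0.
  under eq_integral do rewrite big_cons addrCA addrC.
  have mGi : measurable_fun (setT : set (g_sigma_algebraType (increment_system s t i)))
      (fun w => (S w + \sum_(l <- r) xi w l 0 * V l w, xi w i 0)).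
    have past_incr f : past_fun s f ->
        measurable_fun (setT : set (g_sigma_algebraType (increment_system s t i))) f.
      move=> mf _ B mB; rewrite setTI; apply: sub_sigma_algebra.
      exists (f @^-1` B), (fun=> setT); split => //.
        by rewrite -[X in brownian_filtration _ _ _ X]setTI; exact: mf.
      by apply/seteqP; split => w //= [].
    have V_incr l : l != i ->
        measurable_fun (setT : set (g_sigma_algebraType (increment_system s t i))) (V l).
      move=> li _ B mB; rewrite setTI; apply: sub_sigma_algebra.
      exists setT, (fun k => if k == l then B else setT); split => //.
      - by rewrite -(setD0 setT); apply: sigma_algebraCD; exact: sigma_algebra0.
      - by move=> k; case: ifP.
      - by rewrite eq_sym (negbTE li).
      - apply/seteqP; split => w /=.
          by move=> Bw; split => // k; case: eqP => [->|].
        by move=> [_ /(_ l)]; rewrite eqxx.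
    apply: measurable_fun_pair; last exact: past_incr.
    apply: measurable_funD; first exact: past_incr.
    (* Since [i] does not occur in [r], the [i]-th increment may be replaced by 0; every remaining
       term is then measurable for the system that leaves [i] free. *)
    rewrite (_ : (fun w => _) = (fun w => \sum_(l <- r) xi w l 0 *
        (if l == i then 0 else V l w))); last first.
      apply/funext => w; rewrite big_seq [RHS]big_seq; apply: eq_bigr => l lr.
      by case: eqP => // li; move: ir; rewrite -li lr.
    apply: (@measurable_sum _ (g_sigma_algebraType (increment_system s t i)) _ setT _ _
      (fun l w => xi w l 0 * (if l == i then 0 else V l w))) => l.
    apply: measurable_funM; first exact: past_incr.
    by have [li|li] := eqVneq l i; [exact: measurable_cst|exact: V_incr].
  have := @integral_sq_add_indep _ Omega R P sd
    (fun w => S w + \sum_(l <- r) xi w l 0 * V l w) (fun w => xi w i 0) (V i) sd0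
    (mpart r) (mxi' i) (mV i).
  move=> /(_ _)/le_trans; apply.
    move=> A B mA mB; apply: increment_system_indep => //.
    by rewrite -[X in <<s _ >> X]setTI; exact: mGi.
  rewrite (_ : \int[P]_w (\sum_(l <- i :: r) _)%:E =
      \int[P]_w (6 * sd ^+ 2 * xi w i 0 ^+ 2)%:E +
      \int[P]_w (\sum_(l <- r) 6 * sd ^+ 2 * (xi w l 0) ^+ 2)%:E)%E.
    by rewrite [leRHS]addeCA [leLHS]addeC; apply: leeD2l; exact: IH.
  have ge06 l w : 0 <= 6 * sd ^+ 2 * (xi w l 0) ^+ 2.
    by exact: mulr_ge0 (mulr_ge0 (ler0n _ 6) (sqr_ge0 _)) (sqr_ge0 _).
  have m6 l : measurable_fun setT (fun w => 6 * sd ^+ 2 * (xi w l 0) ^+ 2).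
    by apply: measurable_funM => //; exact: measurable_funX.
  rewrite -ge0_integralD//.
  - by apply: eq_integral => w _; rewrite big_cons EFinD.
  - by move=> w _; rewrite lee_fin.
  - exact/measurable_EFinP.
  - by move=> w _; rewrite lee_fin sumr_ge0.
  - by apply/measurable_EFinP; exact: measurable_sum.
have := ind _ (index_enum_uniq 'I_n); rewrite /dot sd2.
move=> /le_trans; apply; rewrite leeD2l// le_eqVlt; apply/orP; left; apply/eqP.
by apply: eq_integral => w _; rewrite -mulr_sumr; congr (_ * _)%:E.
Qed.

End brownian.

(** Clamping all grid points to [[tau i, tau j]] kills the cells outside this interval and keeps
    those inside, so the whole sum telescopes. Repeated grid points are allowed. *)
Lemma sum_clamp_telescope (R : realDomainType) (V : zmodType) (phi : R -> V)
    (tau : nat -> R) (N i j : nat) : nondecreasing_seq tau ->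
  (i <= N)%N -> (j <= N)%N -> tau i <= tau j ->
  \sum_(k < N) (if (tau i <= tau k) && (tau k.+1 <= tau j)
    then phi (tau k.+1) - phi (tau k) else 0) = phi (tau j) - phi (tau i).
Proof.
move=> ndt iN jN ij.
pose cl x := Num.min (tau j) (Num.max (tau i) x).
transitivity (\sum_(k < N) (phi (cl (tau k.+1)) - phi (cl (tau k)))).
  apply: eq_bigr => k _; have kk : tau k <= tau k.+1 by exact: ndt.
  case: (leP (tau i) (tau k)) => [ik|ki] /=; last first.
    have ki' : (k < i)%N by rewrite ltnNge; apply: contraL ki => /ndt; rewrite -leNgt.
    have k1i : tau k.+1 <= tau i by exact: ndt.
    by rewrite /cl !max_l ?(ltW ki)// subrr.
  case: (leP (tau k.+1) (tau j)) => [kj|jk].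
    by rewrite /cl !max_r// ?(le_trans ik)// !min_r// (le_trans kk).
  have jk' : (j < k.+1)%N by rewrite ltnNge; apply: contraL jk => /ndt; rewrite -leNgt.
  have jk1 : tau j <= tau k by exact: ndt.
  by rewrite /cl !max_r ?(le_trans ik)// !min_l ?subrr// (le_trans jk1).
rewrite -(big_mkord xpredT (fun k => phi (cl (tau k.+1)) - phi (cl (tau k)))).
rewrite telescope_sumr//; congr (phi _ - phi _); rewrite /cl.
  by rewrite max_r ?min_l//; exact: ndt.
by rewrite max_l ?min_r//; exact: ndt.
Qed.

(** * Elementary integrands *)

Section vectors.
Context {R : realType} {n : nat}.
Implicit Types v w : 'cV[R]_n.

Lemma sqnorm_ge0 v : 0 <= sqnorm v.
Proof. by apply: sumr_ge0 => i _; rewrite -expr2 sqr_ge0. Qed.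

Lemma dotDl u v w : dot (u + v) w = dot u w + dot v w.
Proof. by rewrite /dot -big_split; apply: eq_bigr => i _; rewrite !mxE mulrDl. Qed.

Lemma dotC v w : dot v w = dot w v.
Proof. by apply: eq_bigr => i _; rewrite mulrC. Qed.

Lemma dotDr u v w : dot u (v + w) = dot u v + dot u w.
Proof. by rewrite dotC dotDl !(dotC u). Qed.

Lemma dotZl a v w : dot (a *: v) w = a * dot v w.
Proof. by rewrite /dot mulr_sumr; apply: eq_bigr => i _; rewrite !mxE mulrA. Qed.

Lemma dotZr a v w : dot v (a *: w) = a * dot v w.
Proof. by rewrite dotC dotZl dotC. Qed.

Lemma dotNl v w : dot (- v) w = - dot v w.
Proof. by rewrite -scaleN1r dotZl mulN1r. Qed.

Lemma dotNr v w : dot v (- w) = - dot v w.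
Proof. by rewrite dotC dotNl dotC. Qed.

Lemma dotBr u v w : dot u (v - w) = dot u v - dot u w.
Proof. by rewrite dotDr dotNr. Qed.

Lemma dot0l v : dot 0 v = 0.
Proof. by rewrite -(scale0r v) dotZl mul0r. Qed.

Lemma dot_trmx_mul (A : 'M[R]_n) v w : dot (A^T *m v) w = dot v (A *m w).
Proof.
have dotE (p q : 'cV[R]_n) : dot p q = (p^T *m q) 0 0.
  by rewrite mxE; apply: eq_bigr => j _; rewrite mxE.
by rewrite !dotE trmx_mul trmxK mulmxA.
Qed.

Lemma sqnorm0 : sqnorm (0 : 'cV[R]_n) = 0.
Proof. exact: dot0l. Qed.

Lemma sqnormZ a v : sqnorm (a *: v) = a ^+ 2 * sqnorm v.
Proof. by rewrite /sqnorm dotZl dotZr mulrA. Qed.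

Lemma sqnormD_le v w : sqnorm (v + w) <= 2 * sqnorm v + 2 * sqnorm w.
Proof.
have := sqnorm_ge0 (v - w).
rewrite /sqnorm !(dotDl, dotDr, dotNl, dotNr) (dotC w v); lra.
Qed.

Lemma enorm_le v M : enorm v <= M -> sqnorm v <= M ^+ 2.
Proof.
rewrite /enorm => vM; rewrite -(sqr_sqrtr (sqnorm_ge0 v)).
by apply: lerXn2r; rewrite ?nnegrE ?sqrtr_ge0// (le_trans (sqrtr_ge0 _) vM).
Qed.

Lemma sum_steps_sqnorm (tau : nat -> R) (c : nat -> 'cV[R]_n) (N : nat) (s : R) :
  nondecreasing_seq tau ->
  sqnorm (\sum_(k < N) (if tau k < s <= tau k.+1 then c k else 0)) =
  \sum_(k < N) (if tau k < s <= tau k.+1 then sqnorm (c k) else 0).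
Proof.
move=> ndt; elim: N => [|N IH]; first by rewrite !big_ord0 sqnorm0.
rewrite !big_ord_recr/=; case: ifPn => [/andP[Ns sN]|_]; last by rewrite !addr0.
rewrite big1 ?add0r; last first.
  move=> k _; case: ifPn => // /andP[_ sk].
  have : tau k.+1 <= tau N by apply: ndt; exact: ltn_ord.
  by move=> /(le_trans sk); rewrite leNgt Ns.
rewrite big1 ?add0r// => k _; case: ifPn => // /andP[_ sk].
have : tau k.+1 <= tau N by apply: ndt; exact: ltn_ord.
by move=> /(le_trans sk); rewrite leNgt Ns.
Qed.

End vectors.

Section elementary.
Context {R : realType} {n : nat} {dO : measure_display} {Omega : measurableType dO}.
Variables (P : probability Omega R) (W : R -> Omega -> 'cV[R]_n) (T : R).
Hypothesis BM : standard_brownian_motion P W T.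

Local Notation past := (past_fun P W).

Definition past_bounded (a : R) (c : Omega -> 'cV[R]_n) :=
  (forall i, past a (fun w => c w i 0)) /\ exists M, forall w, sqnorm (c w) <= M.

(** Integrand and integral are generated together, over intervals that may overlap. Sums are then
    immediate by induction, and an ordered grid is recovered by [elementary_refine] where energies
    have to be computed. *)
Inductive elementary : (R -> Omega -> 'cV[R]_n) -> (Omega -> R) -> Prop :=
| elementary0 : elementary (fun _ _ => 0) (fun=> 0)
| elementaryS a b c H I : 0 <= a -> a <= b -> b <= T -> past_bounded a c ->
    elementary H I ->
    elementary (fun s w => (if a < s <= b then c w else 0) + H s w)
      (fun w => dot (c w) (W b w - W a w) + I w).

Lemma elementary_eq H I H' I' : (forall s w, H s w = H' s w) -> I =1 I' ->
  elementary H I -> elementary H' I'.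
Proof.
move=> HH /funext ->; have -> // : H = H'.
by apply/funext => s; apply/funext => w; exact: HH.
Qed.

Lemma elementaryD H I H' I' : elementary H I -> elementary H' I' ->
  elementary (fun s w => H s w + H' s w) (fun w => I w + I' w).
Proof.
move=> eH eH'; elim: eH => [|a b c {}H {}I a0 ab bT ok eH IH].
  by apply: elementary_eq eH' => [s w|w]; rewrite add0r.
apply: elementary_eq (elementaryS a0 ab bT ok IH) => [s w|w]; exact: addrA.
Qed.

(* The part up to time [a] splits off; only the rest may be multiplied by [x]. *)
Lemma elementary_mul_after a (x : Omega -> R) M H I : 0 <= a -> a <= T ->
  past a x -> (forall w, `|x w| <= M) -> elementary H I ->
  exists I1 I2, [/\ elementary (fun s w => x w *: (if a < s then H s w else 0))
      (fun w => x w * I1 w),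
    elementary (fun s w => if a < s then 0 else H s w) I2 &
    I =1 (fun w => I1 w + I2 w)].
Proof.
move=> a0 aT mx xM; elim=> [|p q c {}H {}I p0 pq qT [mc [K cK]] eH].
  exists (fun=> 0), (fun=> 0); split; last by move=> w; rewrite addr0.
    by apply: elementary_eq elementary0 => [s w|w]; rewrite ?if_same ?scaler0 ?mulr0.
  by apply: elementary_eq elementary0 => [s w|w]//; rewrite if_same.
move=> [I1 [I2 [e1 e2 eI]]].
(* The step on []p, q]] is cut at [a]: raising its ends to at least [a] gives the part after [a],
   lowering them to at most [a] the part before. One of the two is empty when [a] lies outside. *)
exists (fun w => dot (c w) (W (Num.max a q) w - W (Num.max a p) w) + I1 w),
  (fun w => dot (c w) (W (Num.min a q) w - W (Num.min a p) w) + I2 w); split.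
- have okc : past_bounded (Num.max a p) (fun w => x w *: c w).
    split.
      move=> i; rewrite (_ : (fun w => _) = (fun w => x w * c w i 0)); last first.
        by apply/funext => w; rewrite mxE.
      apply: measurable_funM.
        by apply: past_fun_le mx; rewrite le_max lexx.
      by apply: past_fun_le (mc i); rewrite le_max lexx orbT.
    exists (M ^+ 2 * K) => w; rewrite sqnormZ; apply: ler_pM => //.
    + exact: sqr_ge0.
    + exact: sqnorm_ge0.
    + rewrite -real_normK ?num_real//; apply: lerXn2r => //; rewrite nnegrE//.
      exact: le_trans (xM w).
  have apT : Num.max a q <= T by rewrite ge_max aT.
  have apq : Num.max a p <= Num.max a q by rewrite ge_max !le_max lexx pq orbT.
  have ap0 : 0 <= Num.max a p by rewrite le_max a0.
  apply: elementary_eq (elementaryS ap0 apq apT okc e1) => [s w|w].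
    rewrite gt_max le_max.
    have [as_|sa] := ltP a s => /=; last first.
      by rewrite !scaler0 add0r.
    by case: ifP => _; rewrite ?add0r ?add0r ?scalerDr.
  by rewrite mulrDr dotZl.
(* If [a <= p], the part before [a] is empty, but its nominal starting time is [a], when [c] need
   not be known yet; the coefficient 0 keeps it adapted. *)
- have okc : past_bounded (Num.min a p) (fun w => if p < a then c w else 0).
    have [pa|ap] := ltP p a.
      by split => //; exists K.
    split; first by move=> i; exact: measurable_cst.
    by exists 0 => w; rewrite sqnorm0.
  have apT : Num.min a q <= T by rewrite ge_min aT.
  have apq : Num.min a p <= Num.min a q by rewrite le_min !ge_min lexx pq orbT.
  have ap0 : 0 <= Num.min a p by rewrite le_min a0.
  apply: elementary_eq (elementaryS ap0 apq apT okc e2) => [s w|w].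
    rewrite gt_min le_min.
    have [as_|sa] := ltP a s => /=.
      by rewrite add0r.
    congr (_ + _).
    have [pa|ap] := ltP p a => //.
    by rewrite if_same ltNge (le_trans sa ap).
  have [pa|ap] := ltP p a => //.
  by rewrite dot0l (min_l (le_trans ap pq)) subrr dotC dot0l.
- move=> w; rewrite eI addrACA; congr (_ + _).
  rewrite -dotDr; congr (dot _ _).
  have [aq|qa] := leP a q.
    have [ap|pa] := leP a p.
      by rewrite subrr addr0.
    by rewrite addrC addrA subrK addrC.
  have pa := le_lt_trans pq qa.
  by rewrite (max_l (ltW pa)) (min_r (ltW pa)) subrr add0r.
Qed.

Lemma elementaryZ x H I : 0 <= T -> elementary H I ->
  elementary (fun s w => x *: H s w) (fun w => x * I w).
Proof.
move=> T0; elim=> [|p q c {}H {}I p0 pq qT [mc [K cK]] eH IH].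
  by apply: elementary_eq elementary0 => [s w|w]; rewrite ?scaler0 ?mulr0.
have okc : past_bounded p (fun w => x *: c w).
  split.
    move=> i; rewrite (_ : (fun w => _) = (fun w => x * c w i 0)); last first.
      by apply/funext => w; rewrite mxE.
    by apply: measurable_funM; [exact: measurable_cst|exact: mc].
  by exists (x ^+ 2 * K) => w; rewrite sqnormZ; apply: ler_wpM2l => //; exact: sqr_ge0.
apply: elementary_eq (elementaryS p0 pq qT okc IH) => [s w|w].
  by rewrite scalerDr; case: ifP => _ //; rewrite scaler0.
by rewrite mulrDr dotZl.
Qed.

Definition steps (tau : nat -> R) (c : nat -> Omega -> 'cV[R]_n) (N : nat)
    (s : R) (w : Omega) : 'cV[R]_n :=
  \sum_(k < N) (if tau k < s <= tau k.+1 then c k w else 0).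

Definition steps_int (tau : nat -> R) (c : nat -> Omega -> 'cV[R]_n) (N : nat)
    (w : Omega) : R :=
  \sum_(k < N) dot (c k w) (W (tau k.+1) w - W (tau k) w).

(** On a grid through all the end points [S], overlapping steps add up to one coefficient per cell.
    The claim covers every such grid, so that the induction can insert two more points without
    rebuilding the earlier coefficients. *)
Lemma elementary_refine H I : elementary H I -> exists S : seq R,
  (forall x, x \in S -> 0 <= x <= T) /\
  forall (tau : nat -> R) N, nondecreasing_seq tau ->
    (forall k, 0 <= tau k <= T) ->
    (forall x, x \in S -> exists2 k, (k <= N)%N & tau k = x) ->
    exists c : nat -> Omega -> 'cV[R]_n, [/\ forall k i, past (tau k) (fun w => c k w i 0),
      exists M, forall k w, sqnorm (c k w) <= M,
      forall s w, H s w = steps tau c N s w & I =1 steps_int tau c N].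
Proof.
elim=> [|a b c {}H {}I a0 ab bT [mc [K cK]] eH [S [ST HS]]].
  exists [::]; split => // tau N ndt t0T _.
  exists (fun _ _ => 0); split.
  - by move=> k i; exact: measurable_cst.
  - by exists 0 => _ _; rewrite sqnorm0.
  - by move=> s w; rewrite /steps big1// => k _; rewrite if_same.
  - by move=> w; rewrite /steps_int big1// => k _; rewrite dot0l.
exists [:: a, b & S]; split.
  move=> x; rewrite !inE => /or3P[/eqP->|/eqP->|/ST//].
    by rewrite a0 (le_trans ab).
  by rewrite bT (le_trans a0).
move=> tau N ndt t0T tauS.
have [c' [mc' [K' cK'] Hc' Ic']] := HS tau N ndt t0T
  (fun x xS => tauS x ltac:(by rewrite !inE xS !orbT)).
have [i iN ti] := tauS a ltac:(by rewrite !inE eqxx).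
have [j jN tj] := tauS b ltac:(by rewrite !inE eqxx orbT).
have K0 : 0 <= K by rewrite (le_trans _ (cK point))// sqnorm_ge0.
exists (fun k w => (if (a <= tau k) && (tau k.+1 <= b) then c w else 0) + c' k w); split.
- move=> k l; have [/andP[ak _]|_] := boolP ((a <= tau k) && (tau k.+1 <= b)).
    rewrite (_ : (fun w => _) = (fun w => c w l 0 + c' k w l 0)); last first.
      by apply/funext => w; rewrite mxE.
    by apply: measurable_funD; [exact: past_fun_le (mc l)|exact: mc'].
  rewrite (_ : (fun w => _) = (fun w => c' k w l 0)); first exact: mc'.
  by apply/funext => w; rewrite add0r.
- exists (2 * K + 2 * K') => k w; apply: le_trans (sqnormD_le _ _) _.
  apply: lerD; rewrite ler_pM2l//.
  by case: ifP => _ //; rewrite sqnorm0.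
- move=> s w; rewrite Hc' /steps.
  (* The indicator of a cell is a difference of indicators of [s <= r], so the integrand telescopes
     in the same way as the integral does below. *)
  rewrite [RHS](eq_bigr (fun k : 'I_N =>
    (if (a <= tau k) && (tau k.+1 <= b) then
      (if s <= tau k.+1 then c w else 0) - (if s <= tau k then c w else 0) else 0) +
    (if tau k < s <= tau k.+1 then c' k w else 0))); last first.
    move=> k _; have kk : tau k <= tau k.+1 by exact: ndt.
    rewrite ltNge; case: (leP s (tau k)) => sk /=.
      rewrite (le_trans sk kk) subrr addr0; by case: ifP.
    by case: ifP => _; case: ifP => _; rewrite ?subr0 ?add0r.
  rewrite big_split/=; congr (_ + _).
  rewrite -ti -tj.
  rewrite (sum_clamp_telescope (fun r => if s <= r then c w else 0) ndt iN jN) ?ti ?tj//.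
  rewrite ltNge; case: (leP s a) => sa /=; last by rewrite subr0.
  by rewrite (le_trans sa ab) subrr.
- move=> w; rewrite Ic' /steps_int.
  rewrite [RHS](eq_bigr (fun k : 'I_N =>
    (if (a <= tau k) && (tau k.+1 <= b) then
      dot (c w) (W (tau k.+1) w) - dot (c w) (W (tau k) w) else 0) +
    dot (c' k w) (W (tau k.+1) w - W (tau k) w))); last first.
    move=> k _; rewrite dotDl; congr (_ + _).
    by case: ifP => _; rewrite ?dot0l ?dotBr.
  rewrite big_split/=; congr (_ + _).
  rewrite -ti -tj.
  rewrite (sum_clamp_telescope (fun r => dot (c w) (W r w)) ndt iN jN) ?ti ?tj//.
  by rewrite dotBr.
Qed.

Lemma elementary_steps H I : 0 <= T -> elementary H I -> exists (tau : nat -> R) (c : nat -> Omega -> 'cV[R]_n) N,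
  [/\ nondecreasing_seq tau, forall k, 0 <= tau k <= T,
     forall k i, past (tau k) (fun w => c k w i 0) &
     exists M, forall k w, sqnorm (c k w) <= M] /\
  (forall s w, H s w = steps tau c N s w) /\ I =1 steps_int tau c N.
Proof.
move=> T0 /elementary_refine[S [ST HS]].
(* The default [T] continues the sorted points to an infinite nondecreasing sequence in [[0, T]]. *)
pose S' := sort <=%R S; pose tau := nth T S'.
have S'T x : x \in S' -> 0 <= x <= T by rewrite mem_sort; exact: ST.
have tauT k : 0 <= tau k <= T.
  have [kS|Sk] := ltnP k (size S'); first by apply: S'T; exact: mem_nth.
  by rewrite /tau nth_default// T0 lexx.
have ndt : nondecreasing_seq tau.
  move=> i j ij; have [jS|Sj] := ltnP j (size S').
    apply: (sorted_leq_nth le_trans le_refl) => //; rewrite ?inE//.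
      exact: sort_le_sorted.
    exact: leq_ltn_trans jS.
  by rewrite {2}/tau nth_default//; case/andP: (tauT i).
have [|c [mc cM Hc Ic]] := HS tau (size S') ndt tauT.
  move=> x xS; have xS' : x \in S' by rewrite mem_sort.
  exists (index x S'); first by rewrite index_size.
  by rewrite /tau nth_index.
by exists tau, c, (size S').
Qed.

End elementary.

(** * Energy of a path *)

Section energy.
Context {R : realType} {n : nat}.
Variable T : R.
Implicit Types h : R -> 'cV[R]_n.
Local Notation mu := (@lebesgue_measure R).

Definition measurable_path h :=
  forall i, measurable_fun `[0, T] (fun s => h s i 0).

Definition energy h : \bar R := (\int[mu]_(s in `[0%R, T]) (sqnorm (h s))%:E)%E.

Lemma energy_ge0 h : (0 <= energy h)%E.
Proof. by apply: integral_ge0 => s _; rewrite lee_fin sqnorm_ge0. Qed.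

Lemma measurable_sqnorm h : measurable_path h ->
  measurable_fun `[0, T] (fun s => (sqnorm (h s))%:E).
Proof. by move=> mh; apply/measurable_EFinP; apply: measurable_dot. Qed.

Lemma measurable_pathD h h' : measurable_path h -> measurable_path h' ->
  measurable_path (fun s => h s + h' s).
Proof.
move=> mh mh' i; rewrite (_ : (fun s => _) = (fun s => h s i 0 + h' s i 0)).
  exact: measurable_funD.
by apply/funext => s; rewrite mxE.
Qed.

Lemma measurable_pathZ (a : R) h : measurable_path h ->
  measurable_path (fun s => a *: h s).
Proof.
move=> mh i; rewrite (_ : (fun s => _) = (fun s => a * h s i 0)).
  by apply: measurable_funM; [exact: measurable_cst|exact: mh].
by apply/funext => s; rewrite mxE.
Qed.

Lemma measurable_pathB h h' : measurable_path h -> measurable_path h' ->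
  measurable_path (fun s => h s - h' s).
Proof.
move=> mh mh'; under eq_fun do rewrite -scaleN1r.
by apply: measurable_pathD => //; exact: measurable_pathZ.
Qed.

Lemma measurable_path_itv (a b : R) (v : 'cV[R]_n) :
  measurable_path (fun s => if a < s <= b then v else 0).
Proof.
move=> i; rewrite (_ : (fun s => _) = (fun s => if (a < s) && (s <= b) then v i 0 else 0)).
  by apply: measurable_funTS; apply: measurable_fun_ifT => //;
    apply: measurable_and; [exact: measurable_fun_ltr|exact: measurable_fun_ler].
by apply/funext => s; case: ifP => // _; rewrite mxE.
Qed.

Lemma le_energy h h' : measurable_path h -> measurable_path h' ->
  (forall s, 0 <= s <= T -> sqnorm (h s) <= sqnorm (h' s)) ->
  (energy h <= energy h')%E.
Proof.
move=> mh mh' hh'; apply: ge0_le_integral => //.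
- by move=> s _; rewrite lee_fin sqnorm_ge0.
- exact: measurable_sqnorm.
- exact: measurable_sqnorm.
Qed.

Lemma eq_energy h h' : (forall s, 0 <= s <= T -> sqnorm (h s) = sqnorm (h' s)) ->
  energy h = energy h'.
Proof.
move=> hh'; apply: eq_integral => s; rewrite inE /= in_itv/= => sT.
by rewrite hh'.
Qed.

Lemma energyZ (a : R) h : measurable_path h ->
  energy (fun s => a *: h s) = ((a ^+ 2)%:E * energy h)%E.
Proof.
move=> mh; rewrite /energy -ge0_integralZl_EFin//.
- by apply: eq_integral => s _; rewrite sqnormZ EFinM.
- by move=> s _; rewrite lee_fin sqnorm_ge0.
- exact: measurable_sqnorm.
- exact: sqr_ge0.
Qed.

Lemma energyD_le h h' : measurable_path h -> measurable_path h' ->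
  (energy (fun s => h s + h' s)%R <= 2%:E * energy h + 2%:E * energy h')%E.
Proof.
move=> mh mh'; rewrite /energy -!ge0_integralZl_EFin//; try by
  [exact: measurable_sqnorm|move=> s _; rewrite lee_fin sqnorm_ge0].
rewrite -ge0_integralD//; try by
  [move=> s _; rewrite -EFinM lee_fin mulr_ge0// sqnorm_ge0
  |apply: measurable_funeM; exact: measurable_sqnorm].
apply: ge0_le_integral => //.
- by move=> s _; rewrite lee_fin sqnorm_ge0.
- by apply: measurable_sqnorm; exact: measurable_pathD.
- by apply: emeasurable_funD; apply: measurable_funeM; exact: measurable_sqnorm.
- by move=> s _; rewrite -!EFinM -EFinD lee_fin sqnormD_le.
Qed.

Lemma integral_itv_cst (p q a : R) : 0 <= p -> p <= q -> q <= T -> 0 <= a ->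
  (\int[mu]_(s in `[0%R, T]) (if (p < s <= q)%R then a else 0)%:E =
   ((q - p) * a)%:E)%E.
Proof.
move=> p0 pq qT a0.
transitivity (\int[mu]_(s in `[0%R, T]) (a%:E * (\1_`]p, q] s)%:E))%E.
  apply: eq_integral => s _; rewrite indicE mem_setE in_itv/=.
  by case: ifP => _; rewrite ?mule1 ?mule0.
rewrite ge0_integralZl_EFin//; last first.
  by apply/measurable_EFinP; apply: measurable_indic.
rewrite integral_indic// (_ : `]p, q] `&` `[0, T] = `]p, q]%classic); last first.
  apply/seteqP; split => s /=; rewrite !in_itv/=; first by case.
  by move=> /andP[ps sq]; rewrite ps sq (ltW (le_lt_trans p0 ps)) (le_trans sq qT).
rewrite /= lebesgue_measure_itv/= lte_fin.
case: ltP => [_|qp]; first by rewrite -EFinB -EFinM mulrC.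
by rewrite mule0 (_ : p = q) ?subrr ?mul0r//; apply/eqP; rewrite eq_le pq.
Qed.

Lemma energy_steps (tau : nat -> R) (c : nat -> 'cV[R]_n) (N : nat) :
  nondecreasing_seq tau -> (forall k, 0 <= tau k <= T) ->
  energy (fun s => \sum_(k < N) (if tau k < s <= tau k.+1 then c k else 0)) =
  (\sum_(k < N) (tau k.+1 - tau k) * sqnorm (c k))%:E.
Proof.
move=> ndt tT; rewrite /energy.
under eq_integral do rewrite sum_steps_sqnorm//.
under eq_integral do rewrite -sumEFin.
rewrite ge0_integral_sum//.
- rewrite -sumEFin; apply: eq_bigr => k _.
  have /andP[t0 _] := tT k; have /andP[_ t1] := tT k.+1.
  by rewrite -integral_itv_cst ?sqnorm_ge0//; exact: ndt.
- move=> k; apply/measurable_EFinP; apply: measurable_funTS.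
  by apply: measurable_fun_ifT => //;
    apply: measurable_and; [exact: measurable_fun_ltr|exact: measurable_fun_ler].
- by move=> k s _; case: ifP => _; rewrite lee_fin ?sqnorm_ge0.
Qed.

End energy.

(** * Elementary integrals controlled by their energy *)

Section ito.
Context {R : realType} {n : nat} {dO : measure_display} {Omega : measurableType dO}.
Variables (P : probability Omega R) (W : R -> Omega -> 'cV[R]_n) (T : R).
Hypothesis T0 : 0 <= T.
Hypothesis BM : standard_brownian_motion P W T.
Implicit Types (H : R -> Omega -> 'cV[R]_n) (I : Omega -> R).

Local Notation past := (past_fun P W).
Local Notation elem := (elementary P W T).
Local Notation nrg H w := (energy T (fun s => H s w)).
Local Notation dist I J := (fun w => `|I w - J w|%:E).

Lemma elementary_measurable_path H I w : elem H I -> measurable_path T (fun s => H s w).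
Proof.
elim=> [|a b c {}H {}I a0 ab bT okc eH IH]; first by move=> i; exact: measurable_cst.
by apply: measurable_pathD => //; exact: measurable_path_itv.
Qed.

Section steps.
Variables (tau : nat -> R) (c : nat -> Omega -> 'cV[R]_n).
Hypotheses (ndt : nondecreasing_seq tau) (tT : forall k, 0 <= tau k <= T).
Hypothesis mc : forall k i, past (tau k) (fun w => c k w i 0).

Lemma past_sqnorm k j : (k <= j)%N -> past (tau j) (fun w => sqnorm (c k w)).
Proof.
move=> kj.
have tkj : tau k <= tau j by exact: ndt.
have mcj i : past (tau j) (fun w => c k w i 0) by exact: past_fun_le tkj (@mc k i).
exact: (@measurable_dot _ (past_type P W (tau j))).
Qed.

Lemma past_steps_int N : past (tau N) (steps_int W tau c N).
Proof.
apply: (@measurable_sum _ (past_type P W (tau N)) _ setT _ _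
  (fun (k : 'I_N) w => dot (c k w) (W (tau k.+1) w - W (tau k) w))) => k.
apply: (@measurable_dot _ (past_type P W (tau N))) => i.
  by apply: past_fun_le (@mc k i); apply: ndt; exact: ltnW.
have /andP[t0 _] := tT k; have /andP[t1 _] := tT k.+1.
rewrite (_ : (fun w => _) = (fun w => W (tau k.+1) w i 0 - W (tau k) w i 0)).
  apply: measurable_funB; apply: past_fun_W => //; apply: ndt; first exact: ltn_ord.
  exact: ltnW.
by apply/funext => w; rewrite !mxE.
Qed.

(** The integral over the first [N] cells and the next coefficient are both known at [tau N], so
    [integral_sq_increment] adds one cell at a time. *)
Lemma integral_steps_int_sq N :
  (\int[P]_w (steps_int W tau c N w ^+ 2)%:E <=
   \int[P]_w (6 * \sum_(k < N) (tau k.+1 - tau k) * sqnorm (c k w))%:E)%E.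
Proof.
have tN k : tau k <= T by case/andP: (tT k).
have msq k : measurable_fun setT (fun w => sqnorm (c k w)).
  have pk : past (tau k) (fun w => sqnorm (c k w)) by exact: past_sqnorm.
  exact (past_fun_measurable BM (tN k) pk).
have dt k : 0 <= tau k.+1 - tau k by rewrite subr_ge0; exact: ndt.
elim: N => [|N IH].
  under eq_integral do rewrite /steps_int big_ord0 expr0n.
  by under [leRHS]eq_integral do rewrite big_ord0 mulr0.
under eq_integral do rewrite /steps_int big_ord_recr/=.
have /andP[tN0 _] := tT N.
have tNN : tau N <= tau N.+1 by exact: ndt.
have pS : past (tau N) (steps_int W tau c N) by exact: past_steps_int.
have mcN i : past (tau N) (fun w => c N w i 0) by exact: mc.
have := integral_sq_increment BM tN0 tNN (tN _) pS mcN; move/le_trans; apply.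
have -> : (\int[P]_w (6 * \sum_(k < N.+1) (tau k.+1 - tau k) * sqnorm (c k w))%:E =
    \int[P]_w (6 * \sum_(k < N) (tau k.+1 - tau k) * sqnorm (c k w))%:E +
    \int[P]_w (6 * (tau N.+1 - tau N) * sqnorm (c N w))%:E)%E; last exact: leeD2r.
rewrite -ge0_integralD//.
- by apply: eq_integral => w _; rewrite big_ord_recr/= mulrDr mulrA EFinD.
- move=> w _; rewrite lee_fin mulr_ge0// sumr_ge0// => k _.
  by rewrite mulr_ge0 ?sqnorm_ge0.
- apply/measurable_EFinP; apply: measurable_funM => //.
  apply: (@measurable_sum _ _ _ setT _ _
    (fun (k : 'I_N) w => (tau k.+1 - tau k) * sqnorm (c k w))) => k.
  exact: measurable_funM.
- by move=> w _; rewrite lee_fin mulr_ge0 ?sqnorm_ge0// mulr_ge0.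
- by apply/measurable_EFinP; exact: measurable_funM.
Qed.

Definition budget k w := \sum_(j < k) (tau j.+1 - tau j) * sqnorm (c j w).

(** The energy up to and including cell [k] is already known at the left end of that cell, because
    [c k] is. Testing [budget k.+1] therefore keeps the coefficients adapted, and the stopped energy
    never overshoots [m]. *)
Definition stopped (m : R) k w := if budget k.+1 w <= m then c k w else 0.

Lemma budget_le k w : budget k w <= budget k.+1 w.
Proof.
by rewrite /budget big_ord_recr/= lerDl mulr_ge0 ?sqnorm_ge0// subr_ge0; exact: ndt.
Qed.

Lemma stopped_budget m N w : 0 <= m ->
  \sum_(k < N) (tau k.+1 - tau k) * sqnorm (stopped m k w) <= m.
Proof.
move=> m0; elim: N => [|N IH]; first by rewrite big_ord0.
rewrite big_ord_recr/= /stopped; case: ifP => [bm|_].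
  apply: le_trans bm; rewrite [leRHS]/budget big_ord_recr/= lerD2r.
  apply: ler_sum => k _; apply: ler_wpM2l; first by rewrite subr_ge0; exact: ndt.
  by case: ifP => _ //; rewrite sqnorm0 sqnorm_ge0.
by rewrite sqnorm0 mulr0 addr0.
Qed.

Lemma stopped_id m N w : budget N w <= m ->
  steps_int W tau (stopped m) N w = steps_int W tau c N w.
Proof.
move=> bN; apply: eq_bigr => k _; rewrite /stopped ifT//; apply: le_trans bN.
have ndb : nondecreasing_seq (budget ^~ w).
  by apply/nondecreasing_seqP => j; exact: budget_le.
by apply: ndb; exact: ltn_ord.
Qed.

Lemma past_stopped m k i : past (tau k) (fun w => stopped m k w i 0).
Proof.
rewrite (_ : (fun w => _) = (fun w => if budget k.+1 w <= m then c k w i 0 else 0)).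
  apply: (@measurable_fun_ifT _ _ (past_type P W (tau k))).
  - apply: (@measurable_fun_ler _ (past_type P W (tau k))); last exact: measurable_cst.
    apply: (@measurable_sum _ (past_type P W (tau k)) _ setT _ _
      (fun (j : 'I_k.+1) w => (tau j.+1 - tau j) * sqnorm (c j w))) => j.
    apply: measurable_funM; first exact: measurable_cst.
    by apply: past_sqnorm; rewrite -ltnS.
  - exact: mc.
  - exact: measurable_cst.
by apply/funext => w; rewrite /stopped; case: ifP => // _; rewrite mxE.
Qed.

End steps.

(** An inequality of Lenglart type. Where the energy is at most [m], stopping changes nothing; the
    stopped integral has second moment at most [6 * m], and Markov's inequality bounds its tail. The
    threshold depends on [e] alone, which is what lets the bound pass to limits. *)
Lemma elementary_small e : 0 < e -> exists2 m, 0 < m &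
  forall H I, elem H I -> small P m (fun w => nrg H w) ->
    small P e (fun w => `|I w|%:E).
Proof.
(* [e / 2] pays for the event where the energy exceeds [m]; [e ^+ 3 / 12] makes [6 * m] at most
   [e ^+ 2 * (e / 2)], so that Markov's inequality at level [e ^+ 2] costs the other half. *)
move=> e0; pose m := Num.min (e / 2) (e ^+ 3 / 12).
have m0 : 0 < m by rewrite lt_min !divr_gt0// exprn_gt0.
exists m => // H I /(elementary_steps T0) [tau [c [N [[ndt tT mc cM] [HE IE]]]]].
move=> [A [mA PA nA]].
pose S := steps_int W tau (stopped tau c m) N.
have mS : measurable_fun setT S.
  apply: (@past_fun_measurable _ _ _ _ P W T BM (tau N)).
    by case/andP: (tT N).
  by apply: past_steps_int => // k i; exact: past_stopped.
have mS2 : measurable_fun setT (fun w => (S w ^+ 2)%:E).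
  by apply/measurable_EFinP; exact: measurable_funX.
pose B := [set w | ((e ^+ 2)%:E <= (S w ^+ 2)%:E)%E].
have mB : measurable B.
  by rewrite -[B]setTI; exact: emeasurable_fun_c_infty.
have PB : (P B <= (e / 2)%:E)%E.
  apply: ge0_markov => //; first exact: exprn_gt0.
    by move=> w; rewrite lee_fin sqr_ge0.
  have mst : forall k i, past (tau k) (fun w => stopped tau c m k w i 0).
    by move=> k i; exact: past_stopped.
  apply: le_trans (integral_steps_int_sq ndt tT mst N) _.
  apply: (@le_trans _ _ (\int[P]_w (6 * m)%:E)%E).
    apply: ge0_le_integral => //.
    - move=> w _; rewrite lee_fin mulr_ge0// sumr_ge0// => k _.
      by rewrite mulr_ge0 ?sqnorm_ge0// subr_ge0; exact: ndt.
    - apply/measurable_EFinP; apply: measurable_funM => //.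
      apply: (@measurable_sum _ _ _ setT _ _
        (fun (k : 'I_N) w => (tau k.+1 - tau k) * sqnorm (stopped tau c m k w))) => k.
      apply: measurable_funM => //; apply: measurable_dot => i;
        by apply: (@past_fun_measurable _ _ _ _ P W T BM (tau k)) => //; case/andP: (tT k).
    - by move=> w _; rewrite lee_fin ler_pM2l// stopped_budget// ltW.
  rewrite integral_cst//= probability_setT mule1 lee_fin.
  have : m <= e ^+ 3 / 12 by rewrite ge_min lexx orbT.
  by rewrite !exprS expr0; nra.
exists (A `|` B); split.
- exact: measurableU.
- rewrite (le_trans (measureU2 _ mA mB))//.
  have -> : e = e / 2 + e / 2 by field.
  rewrite EFinD leeD// (le_trans PA)// lee_fin.
  by rewrite /m ge_min lexx.
- move=> w /not_orP[nAw nBw].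
  have bw : budget tau c N w <= m.
    have := nA _ nAw; rewrite (_ : nrg H w = (budget tau c N w)%:E) ?lee_fin//.
    transitivity (energy T (fun s => steps tau c N s w)).
      by congr energy; apply/funext => s; rewrite HE.
    exact: (energy_steps (c ^~ w)).
  rewrite IE -(stopped_id ndt bw) lee_fin.
  move: nBw; rewrite /B/= lee_fin => /negP; rewrite -ltNge -/(S w) => Sw.
  by rewrite -(ger0_norm (ltW e0)) -sqrtr_sqr -(sqrtr_sqr e) ler_wsqrtr// ltW.
Qed.

End ito.

Lemma energy0 (R : realType) n (T : R) (h : R -> 'cV[R]_n) :
  (forall s, h s = 0) -> energy T h = 0%E.
Proof. by move=> h0; apply: integral0_eq => s _; rewrite h0 sqnorm0. Qed.

(** * Limits of elementary integrals *)

Section ito_limits.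
Context {R : realType} {n : nat} {dO : measure_display} {Omega : measurableType dO}.
Variables (P : probability Omega R) (W : R -> Omega -> 'cV[R]_n) (T : R).
Hypothesis T0 : 0 <= T.
Hypothesis BM : standard_brownian_motion P W T.
Implicit Types (H : R -> Omega -> 'cV[R]_n) (I : Omega -> R).

Local Notation past := (past_fun P W).
Local Notation elem := (elementary P W T).
Local Notation nrg H w := (energy T (fun s => H s w)).
Local Notation dist I J := (fun w => `|I w - J w|%:E).

(* Measurability is required of the paths of [H] only, and none of [I]. *)
Definition ito_limit H I := (forall w, measurable_path T (fun s => H s w)) /\
  forall e, 0 < e -> exists H' I', [/\ elem H' I',
    small P e (fun w => nrg (fun s w => H' s w - H s w) w) & small P e (dist I' I)].

Lemma ito_limit_elementary H I : elem H I -> ito_limit H I.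
Proof.
move=> eH; split; first by move=> w; exact: elementary_measurable_path eH.
move=> e e0; exists H, I; split => //; exists set0; split => //.
- by rewrite measure0 lee_fin ltW.
- by move=> w _; rewrite energy0 ?lee_fin ?ltW// => s; rewrite subrr.
- by rewrite measure0 lee_fin ltW.
- by move=> w _; rewrite subrr normr0 lee_fin ltW.
Qed.

Lemma ito_limit_ae H I J : {ae P, forall w, I w = J w} -> ito_limit H I -> ito_limit H J.
Proof.
move=> IJ [mH HI]; split => // e e0; have [H' [I' [eH' sH sI]]] := HI e e0.
exists H', I'; split => //; apply: small_trans_ae sI => //.
by apply: filterS IJ => w ->.
Qed.

Lemma eq_ito_limit H H' I : (forall s w, 0 <= s <= T -> H s w = H' s w) ->
  ito_limit H I -> ito_limit H' I.
Proof.
move=> HH [mH HI]; split.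
  move=> w i; apply: eq_measurable_fun (mH w i) => s.
  by rewrite inE /= in_itv/= => sT; rewrite HH.
move=> e e0; have [K [J [eK sK sJ]]] := HI e e0; exists K, J; split => //.
apply: small_trans sK => // w; rewrite le_eqVlt; apply/orP; left; apply/eqP.
by apply: eq_energy => s sT; rewrite HH.
Qed.

Lemma small_energyD e e' (h h' : R -> Omega -> 'cV[R]_n) : 0 <= e -> 0 <= e' ->
  (forall w, measurable_path T (fun s => h s w)) ->
  (forall w, measurable_path T (fun s => h' s w)) ->
  small P e (fun w => nrg h w) -> small P e' (fun w => nrg h' w) ->
  small P (2 * e + 2 * e') (fun w => nrg (fun s w => h s w + h' s w) w).
Proof.
move=> e0 e'0 mh mh' sh sh'.
have := smallD (smallZ e0 (ler1n _ 2) sh) (smallZ e'0 (ler1n _ 2) sh').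
by apply: small_trans => // w; exact: energyD_le.
Qed.

Lemma small_dist e e' I J K : small P e (dist I J) -> small P e' (dist J K) ->
  small P (e + e') (dist I K).
Proof.
move=> sI sJ; apply: small_trans (smallD sI sJ) => // w.
by rewrite -EFinD lee_fin ler_distD.
Qed.

Lemma ito_limit_closed H I : (forall w, measurable_path T (fun s => H s w)) ->
  (forall e, 0 < e -> exists H' I', [/\ ito_limit H' I',
    small P e (fun w => nrg (fun s w => H' s w - H s w) w) & small P e (dist I' I)]) ->
  ito_limit H I.
Proof.
move=> mH HI; split => // e e0.
have e4 : 0 < e / 4 by rewrite divr_gt0.
have [H1 [I1 [[mH1 H1I1] s1 d1]]] := HI _ e4.
have [H2 [I2 [eH2 s2 d2]]] := H1I1 _ e4.
have mH2 w : measurable_path T (fun s => H2 s w) by exact: elementary_measurable_path eH2.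
exists H2, I2; split => //; last first.
  by apply: small_trans (small_dist d2 d1) => //; lra.
have := small_energyD (ltW e4) (ltW e4)
  (fun w => measurable_pathB (mH2 w) (mH1 w)) (fun w => measurable_pathB (mH1 w) (mH w)) s2 s1.
apply: small_trans; first lra.
move=> w; rewrite le_eqVlt; apply/orP; left; apply/eqP.
by congr energy; apply/funext => s; rewrite addrA subrK.
Qed.

(** An approximant of [H] has small energy as soon as [H] has, and its integral is close to [I]. The
    quarter in the threshold pays for the factor 2 of [energyD_le]. *)
Lemma ito_limit_small e : 0 < e -> exists2 m, 0 < m &
  forall H I, ito_limit H I -> small P m (fun w => nrg H w) ->
    small P e (fun w => `|I w|%:E).
Proof.
move=> e0; have e2 : 0 < e / 2 by rewrite divr_gt0.
have [m m0 Hm] := elementary_small T0 BM e2.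
exists (m / 4); first by rewrite divr_gt0.
move=> H I [mH HI] sH.
pose r := Num.min (m / 4) (e / 2).
have r0 : 0 < r by rewrite lt_min e2 divr_gt0.
have [H' [I' [eH' s' d']]] := HI r r0.
have mH' w : measurable_path T (fun s => H' s w) by exact: elementary_measurable_path eH'.
have m4 : 0 <= m / 4 by rewrite divr_ge0// ltW.
have r4 : r <= m / 4 by rewrite ge_min lexx.
have re : r <= e / 2 by rewrite ge_min lexx orbT.
have sH' : small P m (fun w => nrg H' w).
  have := small_energyD (ltW r0) m4 (fun w => measurable_pathB (mH' w) (mH w)) mH s' sH.
  apply: small_trans; first lra.
  move=> w; rewrite le_eqVlt; apply/orP; left; apply/eqP.
  by congr energy; apply/funext => s; rewrite subrK.
apply: small_trans (smallD (Hm _ _ eH' sH') d'); first lra.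
move=> w; rewrite -EFinD lee_fin.
by have := ler_distD (I' w) 0 (I w); rewrite !sub0r !normrN.
Qed.

Lemma ito_limitD H I H' I' : ito_limit H I -> ito_limit H' I' ->
  ito_limit (fun s w => H s w + H' s w) (fun w => I w + I' w).
Proof.
move=> [mH HI] [mH' HI']; split; first by move=> w; exact: measurable_pathD.
move=> e e0; have e4 : 0 < e / 4 by rewrite divr_gt0.
have [K [J [eK sK dJ]]] := HI _ e4; have [K' [J' [eK' sK' dJ']]] := HI' _ e4.
have mK w : measurable_path T (fun s => K s w) by exact: elementary_measurable_path eK.
have mK' w : measurable_path T (fun s => K' s w) by exact: elementary_measurable_path eK'.
exists (fun s w => K s w + K' s w), (fun w => J w + J' w); split.
- exact: elementaryD.
- have := small_energyD (ltW e4) (ltW e4) (fun w => measurable_pathB (mK w) (mH w))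
    (fun w => measurable_pathB (mK' w) (mH' w)) sK sK'.
  apply: small_trans; first lra.
  move=> w; rewrite le_eqVlt; apply/orP; left; apply/eqP.
  by congr energy; apply/funext => s; rewrite opprD addrACA.
- apply: small_trans (smallD dJ dJ'); first lra.
  by move=> w; rewrite -EFinD lee_fin opprD addrACA ler_normD.
Qed.

Lemma ito_limitZ x H I : ito_limit H I ->
  ito_limit (fun s w => x *: H s w) (fun w => x * I w).
Proof.
move=> [mH HI]; split; first by move=> w; exact: measurable_pathZ.
(* [k] dominates both [x ^+ 2], which scales the energy, and the absolute value of [x], which scales
   the integral; it is at least 1, as [smallZ] requires. *)
move=> e e0; pose k := 1 + x ^+ 2.
have k1 : 1 <= k by rewrite lerDl sqr_ge0.
have k0 : 0 < k by exact: lt_le_trans k1.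
have ek : 0 < e / k by rewrite divr_gt0.
have [K [J [eK sK dJ]]] := HI _ ek.
have mK w : measurable_path T (fun s => K s w) by exact: elementary_measurable_path eK.
exists (fun s w => x *: K s w), (fun w => x * J w); split.
- exact: elementaryZ.
- have := smallZ (ltW ek) k1 sK; rewrite mulrC divfK ?gt_eqF//.
  apply: small_trans => // w.
  rewrite [leLHS](_ : _ = nrg (fun s w => x *: (K s w - H s w)) w); last first.
    by congr energy; apply/funext => s; rewrite scalerBr.
  rewrite energyZ; last exact: measurable_pathB.
  by rewrite lee_wpmul2r ?energy_ge0// lee_fin lerDr.
- have := smallZ (ltW ek) k1 dJ; rewrite mulrC divfK ?gt_eqF//.
  apply: small_trans => // w; rewrite -mulrBr normrM -EFinM lee_fin.
  apply: ler_wpM2r => //.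
  have : 0 <= (`|x| - 1) ^+ 2 by exact: sqr_ge0.
  by rewrite /k -(real_normK (num_real x)) sqrrB1 expr2; have := normr_ge0 x; nra.
Qed.

Lemma ito_limitB H I H' I' : ito_limit H I -> ito_limit H' I' ->
  ito_limit (fun s w => H s w - H' s w) (fun w => I w - I' w).
Proof.
move=> HI HI'.
have -> : (fun s w => H s w - H' s w) = (fun s w => H s w + (-1) *: H' s w).
  by apply/funext => s; apply/funext => w; rewrite scaleN1r.
have -> : (fun w => I w - I' w) = (fun w => I w + (-1) * I' w).
  by apply/funext => w; rewrite mulN1r.
exact: ito_limitD HI (ito_limitZ (-1) HI').
Qed.

(** Two limits differ by a limit for the zero integrand, whose energy is below every threshold. *)
Lemma ito_limit_unique H I I' : ito_limit H I -> ito_limit H I' ->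
  {ae P, forall w, I w = I' w}.
Proof.
move=> HI HI'; have HB := ito_limitB HI HI'.
have /small_null : forall e, 0 < e -> small P e (dist I I').
  move=> e e0; have [m m0 Hm] := ito_limit_small e0.
  apply: Hm HB _; exists set0; split => //.
  - by rewrite measure0 lee_fin ltW.
  - by move=> w _; rewrite energy0 ?lee_fin ?ltW// => s; rewrite subrr.
apply: filterS => w; rewrite lee_fin normr_le0 subr_eq0.
by move/eqP.
Qed.

(** The approximants of [H] need not vanish before [a], where multiplication by [x] would break
    adaptedness, so only their part after [a] is multiplied. The part before [a] is discarded: as
    [H] is 0 there, its energy is at most that of the approximation error, and its integral [J2] is
    small. *)
Lemma ito_limit_mul_after a (x : Omega -> R) M H I : 0 <= a -> a <= T ->
  past a x -> (forall w, `|x w| <= M) ->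
  (forall s w, s <= a -> H s w = 0) -> ito_limit H I ->
  ito_limit (fun s w => x w *: H s w) (fun w => x w * I w).
Proof.
move=> a0 aT mx xM Ha [mH HI]; split; first by move=> w; exact: measurable_pathZ.
move=> e e0; pose k := 1 + M ^+ 2.
have M0 : 0 <= M by exact: le_trans (xM point).
have k1 : 1 <= k by rewrite lerDl sqr_ge0.
have Mk : M <= k by rewrite /k; have := sqr_ge0 (M - 1); rewrite sqrrB1 expr2; nra.
have k0 : 0 < k by exact: lt_le_trans k1.
have ek : 0 < e / (2 * k) by rewrite divr_gt0// mulr_gt0.
have [m m0 Hm] := elementary_small T0 BM ek.
pose r := Num.min m (e / (2 * k)).
have r0 : 0 < r by rewrite lt_min m0.
have rk : k * r <= e / 2.
  have -> : e / 2 = k * (e / (2 * k)) by field; rewrite gt_eqF.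
  by rewrite ler_pM2l// ge_min lexx orbT.
have [K [J [eK sK dJ]]] := HI r r0.
have mK w : measurable_path T (fun s => K s w) by exact: elementary_measurable_path eK.
have [J1 [J2 [e1 e2 eJ]]] := elementary_mul_after a0 aT mx xM eK.
have mKH w : measurable_path T (fun s => K s w - H s w) by exact: measurable_pathB.
have mK2 w : measurable_path T (fun s => if a < s then 0 else K s w).
  exact: elementary_measurable_path e2.
have mK1 w : measurable_path T (fun s => if a < s then K s w else 0).
  rewrite (_ : (fun s => _) = (fun s => K s w - (if a < s then 0 else K s w))).
    exact: measurable_pathB.
  by apply/funext => s; case: ifP => _; rewrite ?subr0 ?subrr.
exists (fun s w => x w *: (if a < s then K s w else 0)), (fun w => x w * J1 w); split => //.
- have := smallZ (ltW r0) k1 sK; apply: small_trans; first lra.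
  move=> w.
  rewrite [leLHS](_ : _ = energy T (fun s => x w *: ((if a < s then K s w else 0) - H s w))); last first.
    by congr energy; apply/funext => s; rewrite scalerBr.
  rewrite energyZ; last exact: measurable_pathB.
  apply: lee_pmul; rewrite ?energy_ge0 ?lee_fin ?sqr_ge0//.
    rewrite (@le_trans _ _ (M ^+ 2)) ?lerDr//.
    by rewrite -(real_normK (num_real (x w))) lerXn2r ?nnegrE.
  apply: le_energy => //; first exact: measurable_pathB.
  move=> s _; case: ltP => // sa.
  by rewrite Ha// subrr sqnorm0 sqnorm_ge0.
- have sJ2 : small P (e / (2 * k)) (fun w => `|J2 w|%:E).
    apply: Hm e2 _; apply: small_trans sK; first by rewrite ge_min lexx.
    move=> w; apply: le_energy => // s _; case: ltP => sa.
      by rewrite sqnorm0 sqnorm_ge0.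
    by rewrite Ha// subr0.
  have := smallD (smallZ (ltW r0) k1 dJ) (smallZ (ltW ek) k1 sJ2).
  apply: small_trans.
    have -> : k * (e / (2 * k)) = e / 2 by field; rewrite gt_eqF.
    by lra.
  move=> w; rewrite -!EFinM -EFinD lee_fin -mulrDr -mulrBr normrM.
  apply: ler_pM => //; first exact: le_trans (xM w) Mk.
  rewrite (_ : J1 w - I w = J w - I w - J2 w); last by rewrite eJ; ring.
  exact: ler_normB.
Qed.

End ito_limits.

(** * Comparison with the Ito integral of simple processes *)

Section ito_conversion.
Context {R : realType} {n : nat} {dO : measure_display} {Omega : measurableType dO}.
Variables (P : probability Omega R) (W : R -> Omega -> 'cV[R]_n) (T : R).
Hypothesis T0 : 0 <= T.
Hypothesis BM : standard_brownian_motion P W T.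
Implicit Types (H : R -> Omega -> 'cV[R]_n) (I : Omega -> R).

Local Notation past := (past_fun P W).
Local Notation elem := (elementary P W T).
Local Notation nrg H w := (energy T (fun s => H s w)).

Lemma elementary_interval a b c : 0 <= a -> a <= b -> b <= T ->
  past_bounded P W a c ->
  elem (fun s w => if a < s <= b then c w else 0) (fun w => dot (c w) (W b w - W a w)).
Proof.
move=> a0 ab bT cb.
by apply: elementary_eq (elementaryS a0 ab bT cb (elementary0 P W T)) => [s w|w];
  rewrite addr0.
Qed.

Lemma elementary_simple t (h : simple_process P W t) : t <= T ->
  elem (sp_process h) (sp_integral h).
Proof.
move=> tT.
have ind N : elem (fun s w => \sum_(k < N)
    (if sp_time h k < s <= sp_time h k.+1 then sp_coef h k w else 0))
    (fun w => \sum_(k < N) dot (sp_coef h k w)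
      (W (sp_time h k.+1) w - W (sp_time h k) w)).
  elim: N => [|N IH].
    by apply: elementary_eq (elementary0 P W T) => [s w|w]; rewrite big_ord0.
  have t0 : 0 <= sp_time h N.
    elim: N {IH} => [|N IH]; first exact: sp_time_ge0.
    exact: le_trans (sp_time_ndecr h N).
  have cb : past_bounded P W (sp_time h N) (sp_coef h N).
    split; first by move=> i; exact (proj1 (adapted_atP _ _ _ _) (@sp_coef_adapted _ _ _ _ P W t h N) i).
    have [M hM] := sp_coef_bounded h.
    by exists (M ^+ 2) => w; apply: enorm_le.
  have := elementary_interval t0 (sp_time_ndecr h N)
    (le_trans (sp_time_le h N.+1) tT) cb.
  move/(elementaryD IH); apply: elementary_eq => [s w|w];
    by rewrite big_ord_recr.
exact: ind.
Qed.

Lemma measurable_sp_process t (h : simple_process P W t) (D : set R) i :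
  t <= T -> measurable D ->
  measurable_fun (setT `*` D) (fun p : Omega * R => sp_process h p.2 p.1 i 0).
Proof.
move=> tT mD; apply: measurable_funTS.
rewrite (_ : (fun p => _) = (fun p : Omega * R => \sum_(k < sp_size h)
  (if (sp_time h k < p.2) && (p.2 <= sp_time h k.+1) then sp_coef h k p.1 i 0 else 0))).
  apply: (@measurable_sum _ _ _ setT _ _ (fun (k : 'I_(sp_size h)) (p : Omega * R) =>
    (if (sp_time h k < p.2) && (p.2 <= sp_time h k.+1) then sp_coef h k p.1 i 0 else 0))) => k.
  apply: measurable_fun_ifT.
  - by apply: measurable_and; [apply: measurable_fun_ltr|apply: measurable_fun_ler].
  - have mc : measurable_fun setT (fun w => sp_coef h k w i 0).
      have pc : past (sp_time h k) (fun w => sp_coef h k w i 0).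
        exact (proj1 (adapted_atP _ _ _ _) (@sp_coef_adapted _ _ _ _ P W t h k) i).
      exact (past_fun_measurable BM (le_trans (sp_time_le h k) tT) pc).
    exact: measurableT_comp mc _.
  - exact: measurable_cst.
apply/funext => p; rewrite /sp_process summxE; apply: eq_bigr => k _.
by case: ifP => // _; rewrite mxE.
Qed.

Lemma measurable_sp_integral t (h : simple_process P W t) : t <= T ->
  measurable_fun setT (sp_integral h).
Proof.
move=> tT; apply: (@measurable_sum _ _ _ setT _ _ (fun (j : 'I_(sp_size h)) w =>
  dot (sp_coef h j w) (W (sp_time h j.+1) w - W (sp_time h j) w))) => j.
have tge k : 0 <= sp_time h k.
  elim: k => [|k IH]; first exact: sp_time_ge0.
  exact: le_trans (sp_time_ndecr _ k).
apply: measurable_dot => i.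
  have pc : past (sp_time h j) (fun w => sp_coef h j w i 0).
    exact (proj1 (adapted_atP _ _ _ _) (@sp_coef_adapted _ _ _ _ P W t h j) i).
  exact (past_fun_measurable BM (le_trans (sp_time_le _ j) tT) pc).
apply: (measurable_increment BM) => //; first exact: sp_time_ndecr.
exact: le_trans (sp_time_le _ _) tT.
Qed.

Lemma measurable_sqnorm_section (t : R) H H' :
  (forall i, measurable_fun (setT `*` `[0, t]) (fun p : Omega * R => H p.2 p.1 i 0)) ->
  (forall i, measurable_fun (setT `*` `[0, t]) (fun p : Omega * R => H' p.2 p.1 i 0)) ->
  measurable_fun setT (fun w =>
    \int[lebesgue_measure]_(s in `[0%R, t]) (sqnorm (H s w - H' s w))%:E)%E.
Proof.
move=> mH mH'.
apply: (@measurable_integral_section _ Omega R `[0, t]%classic _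
  (fun p => (sqnorm (H p.2 p.1 - H' p.2 p.1))%:E)) => //.
- apply/measurable_EFinP; apply: measurable_dot => i;
  rewrite (_ : (fun p => _) = (fun p : Omega * R => H p.2 p.1 i 0 - H' p.2 p.1 i 0));
  by [exact: measurable_funB|apply/funext => p; rewrite !mxE].
- by move=> p; rewrite lee_fin sqnorm_ge0.
Qed.

(** Cutting the integrand after [t] brings integrals over different [[0, t]] to the common horizon
    [T], where they can be subtracted. *)
Lemma is_ito_limit t H I : 0 <= t -> t <= T -> is_ito P W t H I ->
  ito_limit P W T (fun s w => if s <= t then H s w else 0) I.
Proof.
move=> t0 tT [mH mI [h [cH cI]]].
have HT w i : measurable_fun `[0, T] (fun s => (if s <= t then H s w else 0) i 0).
  have mHw : measurable_fun `[0, t] (fun s => H s w i 0).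
    exact: (@measurable_section _ _ _ _ _ _ _ (fun p : Omega * R => H p.2 p.1 i 0)).
  apply: (@eq_measurable_fun _ _ _ _ _ ((fun s => H s w i 0) \_ `[0, t])).
    move=> s; rewrite inE /= in_itv/= => /andP[s0 sT].
    rewrite /patch mem_setE in_itv/= s0/=.
    by case: ifP => // _; rewrite mxE.
  apply: measurable_funTS; have mt : measurable (`[0, t] : set R) by [].
  exact: (measurable_restrictT _ mt).1.
split; first exact: HT.
move=> e e0.
have mE k : measurable_fun setT (fun w =>
    \int[lebesgue_measure]_(s in `[0%R, t]) (sqnorm (sp_process (h k) s w - H s w))%:E)%E.
  by apply: measurable_sqnorm_section => // i; exact: measurable_sp_process.
have mS k : measurable_fun setT (fun w => (sp_integral (h k) w - I w)%:E).
  apply/measurable_EFinP; apply: measurable_funB => //.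
  exact: measurable_sp_integral.
have [n1 Hn1] := cvg_prob_small mE cH e0.
have [n2 Hn2] := cvg_prob_small mS cI e0.
pose k := maxn n1 n2.
exists (sp_process (h k)), (sp_integral (h k)); split.
- exact: elementary_simple.
- apply: small_trans (Hn1 k (leq_maxl _ _)) => // w.
  rewrite gee0_abs; last by apply: integral_ge0 => s _; rewrite lee_fin sqnorm_ge0.
  rewrite le_eqVlt; apply/orP; left; apply/eqP; rewrite /energy.
  transitivity (\int[lebesgue_measure]_(s in `[0%R, T] `&` `[0%R, t])
      (sqnorm (sp_process (h k) s w - H s w))%:E)%E.
    rewrite integral_mkcondr; apply: eq_integral => s.
    rewrite inE /= in_itv/= => /andP[s0 sT].
    rewrite /patch mem_setE in_itv/= s0/=; case: leP => // ts.
    rewrite /sp_process big1 ?subr0 ?sqnorm0// => j _; case: ifPn => // /andP[_ sj].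
    by move: ts; rewrite ltNge (le_trans sj (sp_time_le _ _)).
  congr integral; apply/seteqP; split => s /=; rewrite !in_itv/=; first by case.
  by move=> /andP[s0 st]; rewrite s0 st (le_trans st tT).
- by apply: small_trans (Hn2 k (leq_maxr _ _)) => // w; rewrite -abse_EFin.
Qed.

(** The way back at the horizon [T]: with joint measurability restored, a limit obtained by
    approximation witnesses that [ito] is not at its default value. *)
Lemma ito_limit_is_ito H I :
  (forall i, measurable_fun (setT `*` `[0, T]) (fun p : Omega * R => H p.2 p.1 i 0)) ->
  measurable_fun setT I -> ito_limit P W T H I -> is_ito P W T H I.
Proof.
move=> mH mI [_ HI].
have step e : 0 < e -> exists h : simple_process P W T,
    small P e (fun w => \int[lebesgue_measure]_(s in `[0%R, T])
             (sqnorm (sp_process h s w - H s w))%:E)%E /\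
    small P e (fun w => `|sp_integral h w - I w|%:E).
  move=> e0; have [K [J [eK sK dJ]]] := HI e e0.
  have [tau [c [N [[ndt tT mc [M cM]] [KE JE]]]]] := elementary_steps T0 eK.
  have tau0 : 0 <= tau 0 by case/andP: (tT 0).
  have taun k : tau k <= tau k.+1 by exact: ndt.
  have tauT k : tau k <= T by case/andP: (tT k).
  have ca k : adapted_at P W (tau k) (c k) by exact (proj2 (adapted_atP _ _ _ _) (mc k)).
  have cb : exists M : R, forall k w, enorm (c k w) <= M.
    by exists (Num.sqrt M) => k w; rewrite ler_wsqrtr.
  exists (SimpleProcess N tau0 taun tauT ca cb); split.
    apply: small_trans sK => // w; rewrite le_eqVlt; apply/orP; left; apply/eqP.
    by apply: eq_integral => s _; rewrite KE.
  by apply: small_trans dJ => // w; rewrite JE.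
have /choice[h Hh] : forall k : nat, exists h : simple_process P W T,
    small P (k.+1%:R^-1) (fun w => \int[lebesgue_measure]_(s in `[0%R, T])
             (sqnorm (sp_process h s w - H s w))%:E)%E /\
    small P (k.+1%:R^-1) (fun w => `|sp_integral h w - I w|%:E).
  by move=> k; apply: step; rewrite invr_gt0.
split => //; exists h; split; apply: small_cvg_prob.
- by move=> k; apply: measurable_sqnorm_section => // i; exact: measurable_sp_process.
- move=> k; apply: small_trans (Hh k).1 => // w; rewrite gee0_abs//.
  by apply: integral_ge0 => s _; rewrite lee_fin sqnorm_ge0.
- move=> k; apply/measurable_EFinP; apply: measurable_funB => //.
  exact: measurable_sp_integral.
- by move=> k; apply: small_trans (Hh k).2 => // w; rewrite -abse_EFin.
Qed.

End ito_conversion.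

Lemma continuous_bigsum (R : realType) I (r : seq I) (F : I -> R -> R) :
  (forall i, continuous (F i)) -> continuous (fun s => \sum_(i <- r) F i s).
Proof.
move=> cF; elim: r => [|i r IH] s.
  by under eq_fun do rewrite big_nil; rewrite ?big_nil; exact: cvg_cst.
under eq_fun do rewrite big_cons; rewrite ?big_cons.
by apply: cvgD; [exact: cF|exact: IH].
Qed.

Lemma continuous_bigprod (R : realType) I (r : seq I) (F : I -> R -> R) :
  (forall i, continuous (F i)) -> continuous (fun s => \prod_(i <- r) F i s).
Proof.
move=> cF; elim: r => [|i r IH] s.
  by under eq_fun do rewrite big_nil; rewrite ?big_nil; exact: cvg_cst.
under eq_fun do rewrite big_cons; rewrite ?big_cons.
by apply: cvgM; [exact: cF|exact: IH].
Qed.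

Lemma measurable_fun_lt d (T : measurableType d) (R : realType) (f : T -> R) :
  (forall a, measurable [set x | f x < a]) -> measurable_fun setT f.
Proof.
move=> mf; apply: (measurability (RGenInftyO.G (R := R)) (RGenInftyO.measurableE R)).
move=> _ [_ [a ->] <-]; rewrite setTI.
rewrite (_ : _ @^-1` _ = [set x | f x < a])//.
Qed.

(** * Uniform grids *)

Section grid.
Context {R : realType}.
Implicit Types (c s : R) (y : R -> R).

Definition grid c (m k : nat) : R := c * k%:R / m.+1%:R.

(** The value on each cell is taken at its left end, where it is already known; along a path, such a
    sum is a simple path functional. *)
Definition gridsum c (m : nat) (y : R -> R) s : R :=
  \sum_(k < m.+1) (if grid c m k < s <= grid c m k.+1 then y (grid c m k) else 0).

Lemma grid0 c m : grid c m 0 = 0. Proof. by rewrite /grid mulr0 mul0r. Qed.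

Lemma gridS c m : grid c m m.+1 = c.
Proof. by rewrite /grid mulfK// pnatr_eq0. Qed.

Lemma grid_ndecr c m : 0 <= c -> nondecreasing_seq (grid c m).
Proof.
move=> c0 i j ij; rewrite /grid ler_pM2r ?invr_gt0 ?ltr0n//.
by rewrite ler_wpM2l// ler_nat.
Qed.

Lemma grid_step c m k : grid c m k.+1 - grid c m k = c / m.+1%:R.
Proof. by rewrite /grid -mulrBl -mulrBr -natrB// subSnn mulr1. Qed.

(** The cells partition []0, c]]. This sum serves as a partition of unity, which turns bounds on
    single cells into bounds on a grid sum. *)
Lemma gridsum_cst c m s : 0 <= c ->
  gridsum c m (fun=> 1) s = (if 0 < s <= c then 1 else 0).
Proof.
move=> c0; pose phi r : R := if s <= r then 1 else 0.
have gnd := grid_ndecr m c0.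
rewrite /gridsum (eq_bigr (fun k : 'I_m.+1 => phi (grid c m k.+1) - phi (grid c m k))).
  rewrite -(big_mkord xpredT (fun k => phi (grid c m k.+1) - phi (grid c m k))).
  rewrite telescope_sumr// gridS grid0 /phi.
  by case: (leP s 0) => s0 /=; rewrite ?subr0// (le_trans s0 c0) subrr.
move=> k _; have kk : grid c m k <= grid c m k.+1 by exact: gnd.
rewrite /phi; case: (leP s (grid c m k)) => sk /=; last by rewrite subr0.
by rewrite (le_trans sk kk) subrr.
Qed.

Lemma gridsum_bound c m y s M : 0 <= c -> (forall r, `|y r| <= M) ->
  `|gridsum c m y s| <= M.
Proof.
move=> c0 yM; have M0 : 0 <= M by exact: le_trans (yM 0).
apply: (@le_trans _ _ (M * gridsum c m (fun=> 1) s)).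
  rewrite /gridsum mulr_sumr; apply: le_trans (ler_norm_sum _ _ _) _.
  by apply: ler_sum => k _; case: ifP => _; rewrite ?normr0 ?mulr0 ?mulr1.
rewrite gridsum_cst//; case: ifP => _; first by rewrite mulr1.
by rewrite mulr0.
Qed.

Lemma cvg_gridsum c y s : 0 <= c -> continuous y ->
  gridsum c m y s @[m --> \oo] --> (if 0 < s <= c then y s else 0).
Proof.
move=> c0 cy; case: ifPn => [/andP[s0 sc]|nsc]; last first.
  rewrite (_ : (fun m => _) = cst 0); first exact: cvg_cst.
  apply/funext => m; rewrite /gridsum big1// => k _; case: ifPn => // /andP[ks sk].
  exfalso; move/negP: nsc; apply.
  have gnd := grid_ndecr m c0.
  have k0 : grid c m 0 <= grid c m k by exact: gnd.
  have k1 : grid c m k.+1 <= grid c m m.+1 by apply: gnd; exact: ltn_ord.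
  rewrite grid0 in k0; rewrite gridS in k1.
  by rewrite (le_lt_trans k0 ks) (le_trans sk k1).
apply/cvgrPdist_le => e e0.
have [r r0 Hr] : exists2 r, 0 < r & forall z, `|s - z| < r -> `|y s - y z| <= e.
  by have /cvgrPdist_le/(_ _ e0)/nbhs_ballP[r /= r0 Hr] := cy s; exists r.
have c1 : 0 < r / (c + 1) by rewrite divr_gt0// ltr_wpDl.
have [N _ HN] := near_infty_natSinv_lt (PosNum c1).
exists N => // m /HN /= mr.
have -> : y s - gridsum c m y s = \sum_(k < m.+1)
    (if grid c m k < s <= grid c m k.+1 then y s - y (grid c m k) else 0).
  have ys : y s * gridsum c m (fun=> 1) s = y s by rewrite gridsum_cst// s0 sc mulr1.
  rewrite -{1}ys /gridsum mulr_sumr -sumrB; apply: eq_bigr => k _.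
  by case: ifP => _; rewrite ?mulr1// mulr0 subrr.
apply: (@le_trans _ _ (e * gridsum c m (fun=> 1) s)); last first.
  by rewrite gridsum_cst// s0 sc mulr1.
rewrite /gridsum mulr_sumr; apply: le_trans (ler_norm_sum _ _ _) _.
apply: ler_sum => k _; case: ifPn => [/andP[ks sk]|_]; last by rewrite normr0 mulr0.
rewrite mulr1; apply: Hr; rewrite ger0_norm; last by rewrite subr_ge0 ltW.
apply: (@le_lt_trans _ _ (c / m.+1%:R)).
  by rewrite -(grid_step c m k) lerD2r.
have := mr; rewrite ltr_pdivlMr ?ltr_wpDl// mulrC => h; apply: le_lt_trans h.
by rewrite ler_pM2r ?invr_gt0 ?ltr0n// lerDl.
Qed.

End grid.

(** * Measurability on path space *)

Section path_space_measurability.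
Context {R : realType} {n : nat} (T : R) (xinit : 'cV[R]_n) (T0 : 0 < T).
Local Notation C := (path_space T xinit).
Local Notation E := (g_sigma_algebraType (@coordinate_sets R n)).

Lemma eval_path_clamp (x : C) s :
  eval_path x s = eval_path x (Num.min T (Num.max 0 s)).
Proof. exact: path_clamp. Qed.

Lemma clamp_itv s : 0 <= Num.min T (Num.max 0 s) <= T.
Proof. by rewrite le_min ge_min le_max (ltW T0) !lexx. Qed.

Lemma continuous_eval_path (x : C) i : continuous (fun s => eval_path x s i 0).
Proof.
move=> s; apply: (@continuous_comp _ _ _ (eval_path x) (fun v : 'cV[R]_n => v i 0)).
  exact (@path_continuous R n T xinit x s).
exact: coord_continuous.
Qed.

Lemma coord_le_enorm (v : 'cV[R]_n) i : `|v i 0| <= enorm v.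
Proof.
rewrite -sqrtr_sqr ler_wsqrtr// /sqnorm /dot (bigD1 i)//= -expr2 lerDl.
by apply: sumr_ge0 => j _; rewrite -expr2 sqr_ge0.
Qed.

(** [supdist] is a real supremum, meaningful only for a bounded set; continuity of the paths on a
    compact interval provides the bound. *)
Lemma coord_le_supdist (x y : C) s i : 0 <= s <= T ->
  `|eval_path x s i 0 - eval_path y s i 0| <= supdist x y.
Proof.
move=> sT; apply: (@le_trans _ _ (enorm (eval_path x s - eval_path y s))).
  by have := coord_le_enorm (eval_path x s - eval_path y s) i; rewrite !mxE.
apply: ub_le_sup; last by exists s => //; rewrite /= in_itv.
pose f s := sqnorm (eval_path x s - eval_path y s).
have cf : continuous f.
  apply: (continuous_bigsum (F := fun j s => (eval_path x s - eval_path y s) j 0 *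
    (eval_path x s - eval_path y s) j 0)) => j.
  have cj : continuous (fun s => (eval_path x s - eval_path y s) j 0).
    rewrite (_ : (fun s => _) = (fun s => eval_path x s j 0 - eval_path y s j 0)).
      by move=> r; apply: cvgB; exact: continuous_eval_path.
    by apply/funext => r; rewrite !mxE.
  by move=> r; apply: cvgM; exact: cj.
have [c _ fc] := EVT_max (ltW T0) (continuous_subspaceT cf).
exists (Num.sqrt (f c)) => _ [r rT <-].
by rewrite ler_wsqrtr// fc.
Qed.

(** Sublevel sets of a coordinate are open for [supdist], the radius being the distance to the level
    [a]. The time is clamped first because [supdist] sees only [[0, T]]. *)
Lemma measurable_eval_path s i :
  measurable_fun setT (fun x : C => eval_path x s i 0).
Proof.
apply: measurable_fun_lt => a; apply: sub_sigma_algebra => x /= xa.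
have := xa; rewrite eval_path_clamp => xa'.
set s' := Num.min _ _ in xa'.
exists (a - eval_path x s' i 0); first by rewrite subr_gt0.
move=> y xy; rewrite eval_path_clamp -/s'.
have := le_lt_trans (coord_le_supdist x y i (clamp_itv s)) xy.
rewrite -/s' distrC => /(le_lt_trans (ler_norm _)); lra.
Qed.

Lemma measurable_coordinates d (S : measurableType d) (D : set S) (f : S -> E) :
  (forall i, measurable_fun D (fun w => f w i 0)) -> measurable_fun D f.
Proof.
move=> mf mD.
suff : measurable_fun D f by exact.
refine (@measurability _ _ S E D f (@coordinate_sets R n) erefl _).
by move=> _ [_ [i [B [mB ->]]] <-]; exact: mf.
Qed.

Lemma measurable_coordinate i : measurable_fun setT (fun v : E => v i 0).
Proof.
by move=> _ B mB; rewrite setTI; apply: sub_sigma_algebra; exists i, B.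
Qed.

Lemma measurable_eval_pathE s : measurable_fun setT (fun x : C => eval_path x s : E).
Proof. by apply: measurable_coordinates => i; exact: measurable_eval_path. Qed.

(** A Caratheodory function: measurable in the path and continuous in time, hence jointly measurable
    as a limit of grid sums. *)
Lemma measurable_eval_joint :
  measurable_fun setT (fun p : C * R => eval_path p.1 p.2 : E).
Proof.
apply: measurable_coordinates => i.
pose cl (p : C * R) := Num.min T (Num.max 0 p.2).
have mcl : measurable_fun setT cl.
  by apply: measurable_minr => //; apply: measurable_maxr.
(* Grid sums vanish at time 0, so the initial value is added there. *)
pose f m (p : C * R) := gridsum T m (fun r => eval_path p.1 r i 0) (cl p) +
  (if cl p <= 0 then xinit i 0 else 0).
apply: (@measurable_fun_cvg _ _ _ _ f) => [m|p _].
  apply: measurable_funD; last first.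
    by apply: measurable_fun_ifT => //; exact: measurable_fun_ler.
  apply: (@measurable_sum _ _ _ setT _ _ (fun (k : 'I_m.+1) p =>
    if grid T m k < cl p <= grid T m k.+1 then eval_path p.1 (grid T m k) i 0 else 0)) => k.
  apply: measurable_fun_ifT => //.
    by apply: measurable_and; [exact: measurable_fun_ltr|exact: measurable_fun_ler].
  exact: measurableT_comp (measurable_eval_path _ _) _.
have /andP[cl0 clT] := clamp_itv p.2.
rewrite eval_path_clamp -/(cl p).
have cv := @cvg_gridsum R T (fun r => eval_path p.1 r i 0) (cl p) (ltW T0)
  (@continuous_eval_path p.1 i).
rewrite (_ : eval_path p.1 (cl p) i 0 =
    (if 0 < cl p <= T then eval_path p.1 (cl p) i 0 else 0) +
    (if cl p <= 0 then xinit i 0 else 0)).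
  by apply: cvgD => //; exact: cvg_cst.
rewrite /cl clT andbT; case: (ltP 0 (cl p)) => [|c0]; rewrite -/(cl p).
  by rewrite addr0.
have -> : cl p = 0 by apply/eqP; rewrite eq_le c0.
by rewrite add0r /eval_path path_init.
Qed.

Section along.
Context {dS : measure_display} {S : measurableType dS} (Y : S -> C).
Hypothesis mY : measurable_fun setT Y.

Lemma measurable_pair_along :
  measurable_fun setT (fun p : S * R => (eval_path (Y p.1) p.2 : E, p.2)).
Proof.
apply: measurable_fun_pair => //.
apply: (measurableT_comp (f := fun p : C * R => eval_path p.1 p.2 : E)
  (g := fun p : S * R => (Y p.1, p.2))); first exact: measurable_eval_joint.
by apply: measurable_fun_pair => //; exact: measurableT_comp.
Qed.

Lemma measurable_coeff_along (h : 'cV[R]_n -> R -> R) : measurable_coeff T h ->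
  measurable_fun (setT `*` `[0, T])
    (fun p : S * R => h (eval_path (Y p.1) p.2) p.2).
Proof.
move=> mh.
apply: (measurable_comp (F := (setT : set E) `*` `[0, T]) _ _ mh
  (g := fun p : S * R => (eval_path (Y p.1) p.2 : E, p.2))).
- by apply: measurableX.
- by move=> _ [p [_ pT] <-].
- by apply: measurable_funTS; exact: measurable_pair_along.
Qed.

End along.

End path_space_measurability.

Import HBNNSimple.

(** * Density of simple path functionals *)

Section density.
Context {R : realType} {n : nat} (T : R) (xinit : 'cV[R]_n) (T0 : 0 < T).
Local Notation C := (path_space T xinit).
Local Notation E := (g_sigma_algebraType (@coordinate_sets R n)).
Local Notation mu := (@lebesgue_measure R).
Implicit Types (F G H : C -> R -> 'cV[R]_n) (f g : C -> R -> R).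

Local Notation unit_vec i := (delta_mx i 0 : 'cV[R]_n).

(* The integral of [h] against the path is the path functional [J], hence does
   not depend on the law of the path. *)
Inductive path_simple : (C -> R -> 'cV[R]_n) -> (C -> R) -> Prop :=
| path_simple0 : path_simple (fun _ _ => 0) (fun=> 0)
| path_simpleS a b i (phi : E -> R) h J : 0 <= a -> a <= b -> b <= T ->
    measurable_fun setT phi -> (exists M, forall v, `|phi v| <= M) ->
    path_simple h J ->
    path_simple
      (fun x s => (if a < s <= b then phi (eval_path x a) else 0) *: unit_vec i + h x s)
      (fun x => phi (eval_path x a) * (eval_path x b i 0 - eval_path x a i 0) + J x).

Lemma path_simple_eq h J h' : (forall x s, h x s = h' x s) ->
  path_simple h J -> path_simple h' J.
Proof.
move=> hh; have -> // : h = h'.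
by apply/funext => x; apply/funext => s; exact: hh.
Qed.

Lemma path_simpleD h J h' J' : path_simple h J -> path_simple h' J' ->
  exists J'', path_simple (fun x s => h x s + h' x s) J''.
Proof.
move=> ph ph'; elim: ph => [|a b i phi {}h {}J a0 ab bT mphi bphi ph [J2 IH]].
  by exists J'; apply: path_simple_eq ph' => x s; rewrite add0r.
exists (fun x => phi (eval_path x a) * (eval_path x b i 0 - eval_path x a i 0) + J2 x).
apply: path_simple_eq (path_simpleS i a0 ab bT mphi bphi IH) => x s.
by rewrite addrA.
Qed.

Definition joint_measurable F := forall i,
  measurable_fun (setT `*` `[0, T]) (fun p : C * R => F p.1 p.2 i 0).

Lemma joint_measurableD F G : joint_measurable F -> joint_measurable G ->
  joint_measurable (fun x s => F x s + G x s).
Proof.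
move=> mF mG i; rewrite (_ : (fun p => _) = (fun p : C * R => F p.1 p.2 i 0 + G p.1 p.2 i 0)).
  exact: measurable_funD.
by apply/funext => p; rewrite mxE.
Qed.

Lemma joint_measurable_scale f (v : 'cV[R]_n) :
  measurable_fun (setT `*` `[0, T]) (fun p : C * R => f p.1 p.2) ->
  joint_measurable (fun x s => f x s *: v).
Proof.
move=> mf i; rewrite (_ : (fun p => _) = (fun p : C * R => f p.1 p.2 * v i 0)).
  by apply: measurable_funM => //; exact: measurable_cst.
by apply/funext => p; rewrite mxE.
Qed.

Lemma joint_measurableZ (a : R) F : joint_measurable F ->
  joint_measurable (fun x s => a *: F x s).
Proof.
move=> mF i; rewrite (_ : (fun p => _) = (fun p : C * R => a * F p.1 p.2 i 0)).
  by apply: measurable_funM; [exact: measurable_cst|exact: mF].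
by apply/funext => p; rewrite mxE.
Qed.

Lemma joint_measurableB F G : joint_measurable F -> joint_measurable G ->
  joint_measurable (fun x s => F x s - G x s).
Proof.
move=> mF mG; rewrite (_ : (fun x s => _) = (fun x s => F x s + (-1) *: G x s)).
  by apply: joint_measurableD => //; exact: joint_measurableZ.
by apply/funext => x; apply/funext => s; rewrite scaleN1r.
Qed.

Lemma path_simple_joint h J : path_simple h J -> joint_measurable h.
Proof.
elim=> [|a b i phi {}h {}J a0 ab bT mphi bphi ph IH]; first by move=> i; exact: measurable_cst.
apply: joint_measurableD => //.
apply: (@joint_measurable_scale (fun x s => if a < s <= b then phi (eval_path x a) else 0)).
apply: measurable_funTS; apply: measurable_fun_ifT => //.
  by apply: measurable_and; [exact: measurable_fun_ltr|exact: measurable_fun_ler].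
apply: (measurableT_comp mphi).
exact (measurableT_comp (@measurable_eval_pathE R n T xinit T0 a) (@measurable_fst _ _ C R)).
Qed.

(** An abstract size [N], satisfying a triangle inequality up to the factor 2. The scaling factor
    $|a| + a^2$ admits sums of quadratic and of absolute linear terms; both kinds occur when
    martingale part and drift are to be approximated together. *)
Variables (m : probability C R) (N : 'cV[R]_n -> 'cV[R]_n -> R -> R).
Hypothesis N_ge0 : forall v y s, 0 <= N v y s.
Hypothesis ND : forall v w y s, N (v + w) y s <= 2 * N v y s + 2 * N w y s.
Hypothesis NZ : forall a v y s, N (a *: v) y s <= (`|a| + a ^+ 2) * N v y s.
Hypothesis mN : forall F, joint_measurable F ->
  measurable_fun (setT `*` `[0, T])
    (fun p : C * R => N (F p.1 p.2) (eval_path p.1 p.2) p.2).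
Hypothesis N_unit : {ae m, forall x, forall i, mu.-integrable `[0, T]
  (fun s => (N (unit_vec i) (eval_path x s) s)%:E)}.

Definition gap F G (x : C) : \bar R :=
  (\int[mu]_(s in `[0%R, T]) (N (F x s - G x s) (eval_path x s) s)%:E)%E.

Lemma gap_ge0 F G x : (0 <= gap F G x)%E.
Proof. by apply: integral_ge0 => s _; rewrite lee_fin. Qed.

Lemma measurable_gap F G : joint_measurable F -> joint_measurable G ->
  measurable_fun setT (gap F G).
Proof.
move=> mF mG; apply: (@measurable_integral_section _ C R `[0, T]%classic _
  (fun p => (N (F p.1 p.2 - G p.1 p.2) (eval_path p.1 p.2) p.2)%:E)) => //.
- apply/measurable_EFinP.
  by apply: (mN (F := fun x s => F x s - G x s)); exact: joint_measurableB.
- by move=> p; rewrite lee_fin.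
Qed.

Lemma measurable_N_section F x : joint_measurable F ->
  measurable_fun `[0, T] (fun s => (N (F x s) (eval_path x s) s)%:E).
Proof.
move=> mF; apply/measurable_EFinP.
exact: (@measurable_section _ _ _ _ _ _ _
  (fun p : C * R => N (F p.1 p.2) (eval_path p.1 p.2) p.2) x (mN mF)).
Qed.

Lemma le_integral_N F1 F2 F3 (a b : R) x : joint_measurable F1 ->
  joint_measurable F2 -> joint_measurable F3 -> 0 <= a -> 0 <= b ->
  (forall s, 0 <= s <= T -> N (F1 x s) (eval_path x s) s <=
    a * N (F2 x s) (eval_path x s) s + b * N (F3 x s) (eval_path x s) s) ->
  (\int[mu]_(s in `[0%R, T]) (N (F1 x s) (eval_path x s) s)%:E <=
   a%:E * \int[mu]_(s in `[0%R, T]) (N (F2 x s) (eval_path x s) s)%:E +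
   b%:E * \int[mu]_(s in `[0%R, T]) (N (F3 x s) (eval_path x s) s)%:E)%E.
Proof.
move=> m1 m2 m3 a0 b0 le123.
have M1 := measurable_N_section x m1.
have M2 := measurable_N_section x m2.
have M3 := measurable_N_section x m3.
rewrite -!ge0_integralZl_EFin//; try by move=> s _; rewrite lee_fin.
rewrite -ge0_integralD//; try by
  [move=> s _; rewrite -EFinM lee_fin mulr_ge0|exact: measurable_funeM].
apply: ge0_le_integral => //.
- by move=> s _; rewrite lee_fin.
- by apply: emeasurable_funD; exact: measurable_funeM.
Qed.

Lemma gap_trans F G H x : joint_measurable F -> joint_measurable G ->
  joint_measurable H -> (gap F H x <= 2%:E * gap F G x + 2%:E * gap G H x)%E.
Proof.
move=> mF mG mH.
apply: (@le_integral_N (fun x s => F x s - H x s) (fun x s => F x s - G x s)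
  (fun x s => G x s - H x s)) => //; try exact: joint_measurableB.
move=> s _; rewrite (_ : F x s - H x s = (F x s - G x s) + (G x s - H x s)) ?ND//.
by rewrite addrA subrK.
Qed.

Definition approximable F := joint_measurable F /\
  forall e, 0 < e -> exists h J, path_simple h J /\ small m e (gap h F).

Lemma N0 y s : N 0 y s = 0.
Proof.
apply/eqP; rewrite eq_le N_ge0 andbT.
by have := NZ 0 0 y s; rewrite scale0r normr0 expr0n/= addr0 mul0r.
Qed.

Lemma approximable_simple h J : path_simple h J -> approximable h.
Proof.
move=> ph; split; first exact: path_simple_joint ph.
move=> e e0; exists h, J; split => //; exists set0; split => //.
  by rewrite measure0 lee_fin ltW.
move=> x _; rewrite /gap integral0_eq ?lee_fin ?ltW// => s _.
by rewrite subrr N0.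
Qed.

Lemma approximableD F G : approximable F -> approximable G ->
  approximable (fun x s => F x s + G x s).
Proof.
move=> [mF aF] [mG aG]; split; first exact: joint_measurableD.
move=> e e0; have e4 : 0 < e / 4 by rewrite divr_gt0.
have [h [J [ph sh]]] := aF _ e4; have [h' [J' [ph' sh']]] := aG _ e4.
have [J'' phh] := path_simpleD ph ph'.
exists (fun x s => h x s + h' x s), J''; split => //.
have := smallD (smallZ (ltW e4) (ler1n _ 2) sh) (smallZ (ltW e4) (ler1n _ 2) sh').
apply: small_trans; first lra.
have mh := path_simple_joint ph; have mh' := path_simple_joint ph'.
move=> x; apply: (@le_integral_N (fun x s => h x s + h' x s - (F x s + G x s))
  (fun x s => h x s - F x s) (fun x s => h' x s - G x s)) => //;
  try by [exact: joint_measurableB|apply: joint_measurableB; exact: joint_measurableD].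
by move=> s _; rewrite opprD addrACA.
Qed.

Lemma approximable_close F : joint_measurable F ->
  (forall e, 0 < e -> exists2 G, approximable G & small m e (gap G F)) ->
  approximable F.
Proof.
move=> mF aF; split => // e e0; have e4 : 0 < e / 4 by rewrite divr_gt0.
have [G [mG aG] sG] := aF _ e4; have [h [J [ph sh]]] := aG _ e4.
exists h, J; split => //.
have := smallD (smallZ (ltW e4) (ler1n _ 2) sh) (smallZ (ltW e4) (ler1n _ 2) sG).
apply: small_trans; first lra.
by move=> x; apply: gap_trans => //; exact: path_simple_joint ph.
Qed.

Lemma path_simpleZ (a : R) h J : path_simple h J ->
  exists J', path_simple (fun x s => a *: h x s) J'.
Proof.
elim=> [|p q i phi {}h {}J p0 pq qT mphi [M bphi] ph [J2 IH]].
  exists (fun=> 0); apply: path_simple_eq path_simple0 => x s; by rewrite scaler0.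
have mphi' : measurable_fun setT (fun v => a * phi v).
  by apply: measurable_funM => //; exact: measurable_cst.
have bphi' : exists M, forall v, `|a * phi v| <= M.
  by exists (`|a| * M) => v; rewrite normrM ler_wpM2l.
eexists; apply: path_simple_eq (path_simpleS i p0 pq qT mphi' bphi' IH) => x s.
by rewrite scalerDr scalerA; case: ifP => _ //; rewrite mulr0.
Qed.

Lemma approximableZ (a : R) F : approximable F -> approximable (fun x s => a *: F x s).
Proof.
move=> [mF aF]; split; first exact: joint_measurableZ.
move=> e e0; pose k := 1 + (`|a| + a ^+ 2).
have a0 : 0 <= `|a| + a ^+ 2 by rewrite addr_ge0// sqr_ge0.
have k1 : 1 <= k by rewrite lerDl.
have k0 : 0 < k by exact: lt_le_trans k1.
have ek : 0 < e / k by rewrite divr_gt0.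
have [h [J [ph sh]]] := aF _ ek.
have [J' ph'] := path_simpleZ a ph.
exists (fun x s => a *: h x s), J'; split => //.
have := smallZ (ltW ek) k1 sh; rewrite mulrC divfK ?gt_eqF//.
apply: small_trans => // x.
have mh := path_simple_joint ph.
rewrite (_ : (k%:E * _ = k%:E * gap h F x + 0%:E * gap h F x)%E); last first.
  by rewrite mul0e adde0.
apply: (@le_integral_N (fun x s => a *: h x s - a *: F x s)
  (fun x s => h x s - F x s) (fun x s => h x s - F x s)) => //; try exact: joint_measurableB.
- by apply: joint_measurableB; exact: joint_measurableZ.
- exact: ltW.
- move=> s _; rewrite -scalerBr mul0r addr0; apply: le_trans (NZ _ _ _ _) _.
  by apply: ler_wpM2r => //; rewrite /k lerDr.
Qed.

(** Dominated convergence in time, path by path, makes the gaps tend to 0 almost surely;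
    [ae_cvg_small] turns this into closeness in probability. *)
Lemma approximable_lim (F_ : nat -> C -> R -> 'cV[R]_n) F (G : C -> R -> R) :
  (forall k, approximable (F_ k)) -> joint_measurable F ->
  {ae m, forall x, mu.-integrable `[0, T] (fun s => (G x s)%:E)} ->
  (forall k x s, 0 <= s <= T -> N (F_ k x s - F x s) (eval_path x s) s <= G x s) ->
  (forall x s, 0 <= s <= T ->
    N (F_ k x s - F x s) (eval_path x s) s @[k --> \oo] --> 0) ->
  approximable F.
Proof.
move=> aF mF iG FG cF; apply: approximable_close => // e e0.
have mF_ k : joint_measurable (F_ k) by have [] := aF k.
have [|||k sk] := @ae_cvg_small _ C R m (fun k => gap (F_ k) F) _ _ _ e e0.
- by move=> k; exact: measurable_gap.
- by move=> k x; exact: gap_ge0.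
- apply: filterS iG => x iGx.
  have mk k : measurable_fun `[0, T]
      (fun s => (N (F_ k x s - F x s) (eval_path x s) s)%:E).
    by apply: (@measurable_N_section (fun x s => F_ k x s - F x s));
      exact: joint_measurableB.
  have [||_ _ /=] := @dominated_convergence _ _ R mu `[0, T]%classic (measurable_itv _)
    (fun k s => (N (F_ k x s - F x s) (eval_path x s) s)%:E) (cst 0%E)
    (fun s => (G x s)%:E) mk (measurable_cst _) _ iGx.
  + apply: aeW => s; rewrite /= in_itv/= => sT.
    by apply: cvg_EFin; [exact: nearW|exact: cF].
  + apply: aeW => s k; rewrite /= in_itv/= => sT.
    by rewrite lee_fin ger0_norm// FG.
  by rewrite integral0.
- by exists (F_ k).
Qed.

Local Notation scalar f i := (fun x s => f x s *: unit_vec i).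

(** A factor bounded by [K] costs at most $K + K^2$ times the size of a unit vector, which is
    integrable in time by [N_unit]. *)
Lemma approximable_scalar_lim i (f_ : nat -> C -> R -> R) f (K : R) :
  (forall k, approximable (scalar (f_ k) i)) ->
  measurable_fun (setT `*` `[0, T]) (fun p : C * R => f p.1 p.2) ->
  (forall k x s, 0 <= s <= T -> `|f_ k x s - f x s| <= K) ->
  (forall x s, 0 <= s <= T -> f_ k x s @[k --> \oo] --> f x s) ->
  approximable (scalar f i).
Proof.
move=> af mf fK cf.
apply: (@approximable_lim (fun k => scalar (f_ k) i) _
  (fun x s => (K + K ^+ 2) * N (unit_vec i) (eval_path x s) s)) => //.
- exact: joint_measurable_scale.
- apply: filterS N_unit => x /(_ i) iN.
  by apply: eq_integrable (integrableZl _ (K + K ^+ 2) iN).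
- move=> k x s sT; rewrite -scalerBl; apply: le_trans (NZ _ _ _ _) _.
  apply: ler_wpM2r => //; apply: lerD; first exact: fK.
  rewrite -real_normK ?num_real//; apply: lerXn2r; rewrite ?nnegrE//; last exact: fK.
  exact: le_trans (fK k x s sT).
- move=> x s sT; have c0 : f_ k x s - f x s @[k --> \oo] --> 0.
    by rewrite -(subrr (f x s)); apply: cvgB; [exact: cf|exact: cvg_cst].
  apply: (@squeeze_cvgr _ _ _ _ (cst 0)
    (fun k => (`|f_ k x s - f x s| + (f_ k x s - f x s) ^+ 2) *
      N (unit_vec i) (eval_path x s) s)); first by
      apply: nearW => k; rewrite N_ge0 -scalerBl NZ.
    exact: cvg_cst.
  rewrite -[X in _ --> X](mul0r (N (unit_vec i) (eval_path x s) s)).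
  apply: cvgM; last exact: cvg_cst.
  rewrite -[X in _ --> X]addr0; apply: cvgD.
    by rewrite -[X in _ --> X](@normr0 _ R); apply: cvg_norm.
  by rewrite -[X in _ --> X](mulr0 (0 : R)); under eq_fun do rewrite expr2; apply: cvgM.
Qed.

Lemma gridsum_approximable i (phi : E -> R) K c k : 0 <= c -> c <= T ->
  measurable_fun setT phi -> (forall v, `|phi v| <= K) ->
  approximable (scalar (fun x s => gridsum c k (fun r => phi (eval_path x r)) s) i).
Proof.
move=> c0 cT mphi phiK; rewrite /gridsum.
have ind M : (M <= k.+1)%N -> exists J, path_simple (scalar (fun x s => \sum_(j < M)
    (if grid c k j < s <= grid c k j.+1 then phi (eval_path x (grid c k j)) else 0)) i) J.
  elim: M => [_|M IH Mk].
    exists (fun=> 0); apply: path_simple_eq path_simple0 => x s.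
    by rewrite big_ord0 scale0r.
  have [J IHJ] := IH (ltnW Mk).
  have gnd := grid_ndecr k c0.
  have g0 : 0 <= grid c k M by rewrite -(grid0 c k); exact: gnd.
  have g1 : grid c k M <= grid c k M.+1 by exact: gnd.
  have g2 : grid c k M.+1 <= T.
    by apply: le_trans cT; rewrite -[leRHS](gridS c k); exact: gnd.
  have bphi : exists M, forall v, `|phi v| <= M by exists K.
  eexists; apply: path_simple_eq (path_simpleS i g0 g1 g2 mphi bphi IHJ) => x s.
  by rewrite big_ord_recr/= addrC scalerDl.
have [J pJ] := ind k.+1 (leqnn _).
exact: approximable_simple pJ.
Qed.

Lemma continuous_approximable i (phi : E -> R) K c : 0 <= c -> c <= T ->
  measurable_fun setT phi -> (forall v, `|phi v| <= K) ->
  (forall x : C, continuous (fun s => phi (eval_path x s))) ->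
  approximable (scalar (fun x s => if 0 < s <= c then phi (eval_path x s) else 0) i).
Proof.
move=> c0 cT mphi phiK cphi.
apply: (@approximable_scalar_lim i
  (fun k x s => gridsum c k (fun r => phi (eval_path x r)) s) _ (2 * K)).
- by move=> k; exact: (@gridsum_approximable i phi K).
- apply: measurable_funTS; apply: measurable_fun_ifT => //.
    by apply: measurable_and; [exact: measurable_fun_ltr|exact: measurable_fun_ler].
  exact (measurableT_comp mphi (@measurable_eval_joint R n T xinit T0)).
- move=> k x s _; apply: le_trans (ler_normB _ _) _.
  rewrite mulr2n mulrDl mul1r; apply: lerD; first exact: gridsum_bound.
  by case: ifP => _ //; rewrite normr0 (le_trans _ (phiK point)).
- by move=> x s _; exact: cvg_gridsum.
Qed.

(** Continuous functions converging to the indicator of $z > 0$. They lead from continuous functions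
    of the state to indicators of open boxes. *)
Definition ramp (k : nat) (z : R) : R := Num.min 1 (Num.max 0 (k%:R * z)).

Lemma ramp_itv k z : 0 <= ramp k z <= 1.
Proof. by rewrite /ramp le_min ge_min le_max !lexx ler01. Qed.

Lemma continuous_ramp k : continuous (ramp k).
Proof.
move=> z; apply: (@continuous_min _ _ (cst 1 : R -> R^o)
  ((cst 0 : R -> R^o) \max (fun z => k%:R * z)) z).
  exact: cvg_cst.
apply: (@continuous_max _ _ (cst 0 : R -> R^o) (fun z => k%:R * z) z).
  exact: cvg_cst.
by apply: cvgM; [exact: cvg_cst|exact: cvg_id].
Qed.

Lemma cvg_ramp z : ramp k z @[k --> \oo] --> (if 0 < z then 1 else 0 : R).
Proof.
case: ltP => z0; last first.
  rewrite (_ : (fun k => _) = cst 0); first exact: cvg_cst.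
  apply/funext => k; rewrite /ramp max_l ?min_r//.
  by rewrite mulr_ge0_le0.
apply: cvg_near_cst.
have [M _ HM] := near_infty_natSinv_lt (PosNum z0).
exists M.+1 => // k /= Mk; rewrite /ramp max_r; last by rewrite mulr_ge0// ltW.
apply: min_l; case: k Mk => // k; rewrite ltnS => /HM /ltW /=.
by rewrite -ler_pdivrMl ?ltr0n// mulr1.
Qed.

Lemma box_approximable i (a : 'I_n -> R) (c : R) :
  approximable (scalar (fun x s => if 0 < s <= c then
    \prod_(j < n) (if eval_path x s j 0 < a j then 1 else 0) else 0) i).
Proof.
have mlt j : measurable_fun setT (fun v : E => a j - v j 0).
  by apply: measurable_funB => //; exact: measurable_coordinate.
(* Grid sums need an end point in [[0, T]], while boxes allow any [c]; for times up to [T] the two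
   cuts coincide. *)
pose c' := Num.max 0 (Num.min T c).
have c'0 : 0 <= c' by rewrite le_max lexx.
have c'T : c' <= T by rewrite ge_max ge_min lexx ltW.
have cc' s : s <= T -> (0 < s <= c') = (0 < s <= c).
  move=> sT; rewrite le_max le_min sT/= leNgt.
  by case: (0 < s).
have prod01 k (x : C) s : 0 <= \prod_(j < n) ramp k (a j - eval_path x s j 0) <= 1.
  elim/big_ind : _ => [|u v /andP[u0 u1] /andP[v0 v1]|j _].
  - by rewrite ler01 lexx.
  - by rewrite mulr_ge0//= mulr_ile1.
  - exact: ramp_itv.
pose phi k (v : E) := \prod_(j < n) ramp k (a j - v j 0).
apply: (@approximable_scalar_lim i
  (fun k x s => if 0 < s <= c' then phi k (eval_path x s) else 0) _ 1).
- move=> k; apply: (@continuous_approximable i (phi k) 1) => //.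
  + apply: measurable_prod => j _; apply: measurable_minr => //.
    apply: measurable_maxr => //; apply: measurable_funM => //; exact: mlt.
  + move=> v; have : 0 <= phi k v <= 1.
      rewrite /phi; elim/big_ind : _ => [|u w /andP[u0 u1] /andP[w0 w1]|j _].
      * by rewrite ler01 lexx.
      * by rewrite mulr_ge0//= mulr_ile1.
      * exact: ramp_itv.
    by move=> /andP[v0 v1]; rewrite ger0_norm.
  + move=> x; apply: (continuous_bigprod
      (F := fun j s => ramp k (a j - eval_path x s j 0))) => j s.
    apply: (@continuous_comp _ _ _ (fun s => a j - eval_path x s j 0) (ramp k)).
      by apply: cvgB; [exact: cvg_cst|exact: continuous_eval_path].
    exact: continuous_ramp.
- apply: measurable_funTS; apply: measurable_fun_ifT => //.
    by apply: measurable_and; [exact: measurable_fun_ltr|exact: measurable_fun_ler].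
  apply: measurable_prod => j _; apply: measurable_fun_ifT => //.
  apply: measurable_fun_ltr => //.
  exact (measurableT_comp (measurable_coordinate j) (@measurable_eval_joint R n T xinit T0)).
- move=> k x s /andP[_ sT]; rewrite cc'//; case: ifP => _; last by rewrite subrr normr0.
  have /andP[p0 p1] := prod01 k x s.
  have : 0 <= \prod_(j < n) (if eval_path x s j 0 < a j then 1 else 0 : R) <= 1.
    elim/big_ind : _ => [|u w /andP[u0 u1] /andP[w0 w1]|j _].
    * by rewrite ler01 lexx.
    * by rewrite mulr_ge0//= mulr_ile1.
    * by case: ifP; rewrite ?lexx ler01.
  move=> /andP[q0 q1]; rewrite /phi ler_norml; lra.
- move=> x s /andP[_ sT]; rewrite cc'//; case: ifP => _; last exact: cvg_cst.
  rewrite /phi; elim: (index_enum _) => [|j r IH].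
    by under eq_fun do rewrite big_nil; rewrite ?big_nil; exact: cvg_cst.
  under eq_fun do rewrite big_cons; rewrite ?big_cons.
  apply: cvgM => //; rewrite -subr_gt0; exact: cvg_ramp.
Qed.

(** Open in space, since ramps reach strict inequalities, and closed on the right in time, to match
    the intervals [0 < s <= c]. *)
Definition boxes : set (set (E * R)) := [set A | exists (a : 'I_n -> R) (c : R),
  A = [set p : E * R | (forall j, p.1 j 0 < a j) /\ p.2 <= c]].

Lemma measurable_boxes : boxes `<=` measurable.
Proof.
move=> _ [a [c ->]].
rewrite (_ : mkset _ = (\bigcap_(j in [set: 'I_n]) [set p : E * R | p.1 j 0 < a j]) `&`
    [set p : E * R | p.2 <= c]); last first.
  apply/seteqP; split => p [h1 h2]; split => //; first by move=> j _; exact: h1.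
  by move=> j; exact: h1.
apply: measurableI.
  apply: fin_bigcap_measurable => // j _.
  rewrite -[X in measurable X]setTI; apply: (measurable_fun_ltr _ (measurable_cst _) measurableT (Y := [set true])) => //.
  exact (measurableT_comp (measurable_coordinate j) (@measurable_fst _ _ E R)).
rewrite -[X in measurable X]setTI.
exact: (measurable_fun_ler (@measurable_snd _ _ E R) (measurable_cst c) measurableT (Y := [set true])).
Qed.

Lemma setI_closed_boxes : setI_closed boxes.
Proof.
move=> _ _ [a [c ->]] [a' [c' ->]].
exists (fun j => Num.min (a j) (a' j)), (Num.min c c').
apply/seteqP; split => p /=.
  by move=> [[h1 h2] [h1' h2']]; split; [move=> j; rewrite lt_min h1 h1'|rewrite le_min h2].
move=> [h]; rewrite le_min => /andP[h2 h2'].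
by split; split => // j; have := h j; rewrite lt_min => /andP[].
Qed.

(** A box bounds all coordinates at once; a bound on a single coordinate is recovered as a countable
    union over bounds [k] on the others. In time the closed bound becomes strict through the levels
    [a - k.+1%:R^-1]. *)
Lemma g_sigma_boxes : measurable = <<s boxes >>.
Proof.
apply/seteqP; split; last first.
  by apply: smallest_sub; [exact: sigma_algebra_measurable|exact: measurable_boxes].
pose B := g_sigma_algebraType boxes.
have bound (p : E * R) : exists k : nat, (forall j, p.1 j 0 < k%:R) /\ p.2 <= k%:R.
  pose M := \sum_(j < n) `|p.1 j 0| + `|p.2|.
  have M0 : 0 <= M by rewrite addr_ge0// sumr_ge0.
  exists (Num.bound M).
  have HM : M < (Num.bound M)%:R by exact: archi_boundP.
  split; last by rewrite ltW// (le_lt_trans _ HM)// (le_trans (ler_norm _))// lerDr sumr_ge0.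
  move=> j; rewrite (le_lt_trans _ HM)// (le_trans (ler_norm _))//.
  by rewrite /M (bigD1 j)//= -addrA lerDl addr_ge0// sumr_ge0.
have m1 j : measurable_fun (setT : set B) (fun p : B => p.1 j 0 : R).
  apply: measurable_fun_lt => a.
  rewrite (_ : mkset _ = \bigcup_k [set p : B | (forall l, p.1 l 0 <
      (if l == j then Num.min a k%:R else k%:R)) /\ p.2 <= k%:R]).
    by apply: bigcupT_measurable => k; apply: sub_sigma_algebra; eexists _, _.
  apply/seteqP; split => p /=.
    move=> pa; have [k [h1 h2]] := bound p; exists k => //; split => // l.
    by case: eqP => [->|_]; rewrite ?lt_min ?pa h1.
  by move=> [k _ [/(_ j)]]; rewrite eqxx lt_min => /andP[].
have m2 : measurable_fun (setT : set B) (fun p : B => p.2 : R).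
  apply: measurable_fun_lt => a.
  rewrite (_ : mkset _ = ~` [set p : B | a <= p.2]); last first.
    by apply/seteqP; split => p /=; rewrite ltNge => /negP.
  apply: measurableC.
  rewrite (_ : mkset _ = ~` \bigcup_k [set p : B | p.2 <= a - k.+1%:R^-1]).
    apply: measurableC; apply: bigcupT_measurable => k.
    rewrite (_ : mkset _ = \bigcup_l [set p : B | (forall j, p.1 j 0 < l%:R) /\
        p.2 <= a - k.+1%:R^-1]).
      by apply: bigcupT_measurable => l; apply: sub_sigma_algebra; eexists _, _.
    apply/seteqP; split => p /=; last by move=> [l _ []].
    by move=> h; have [l [h1 _]] := bound p; exists l.
  apply/seteqP; split => p /=.
    move=> ap [k _ /= h]; have := le_trans ap h.
    by rewrite leNgt ltrBlDr ltrDl invr_gt0 ltr0n.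
  move=> h; rewrite leNgt; apply/negP => pa; apply: h.
  have pa0 : 0 < a - p.2 by rewrite subr_gt0.
  have [k _ /(_ k (leqnn _)) /= hk] := near_infty_natSinv_lt (PosNum pa0).
  by exists k => //=; rewrite lerBrDl -lerBrDr; exact: ltW.
have mid : measurable_fun (setT : set B) (fun p : B => (p.1 : E, p.2 : R)).
  by apply: measurable_fun_pair => //; exact: measurable_coordinates.
move=> A mA; have := mid measurableT A mA; rewrite setTI.
by rewrite (_ : _ @^-1` _ = A)//; apply/seteqP; split => -[].
Qed.

Lemma approximable_scalarD i f g : approximable (scalar f i) ->
  approximable (scalar g i) -> approximable (scalar (fun x s => f x s + g x s) i).
Proof.
move=> af ag; have := approximableD af ag; congr approximable.
by apply/funext => x; apply/funext => s; rewrite scalerDl.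
Qed.

Lemma approximable_scalarZ i (a : R) f : approximable (scalar f i) ->
  approximable (scalar (fun x s => a * f x s) i).
Proof.
move=> af; have := approximableZ a af; congr approximable.
by apply/funext => x; apply/funext => s; rewrite scalerA.
Qed.

Lemma approximable0 : approximable (fun _ _ => 0).
Proof. exact: approximable_simple path_simple0. Qed.

(** A Dynkin argument from the boxes. The guard [0 < s] is there because simple path functionals
    vanish at time 0. *)
Lemma set_approximable i (A : set (E * R)) : measurable A ->
  approximable (scalar (fun x s => if 0 < s then \1_A (eval_path x s : E, s) else 0) i).
Proof.
have mpair := measurable_pair_along T0 (@measurable_id _ C setT).
have mind (B : set (E * R)) : measurable B ->
    measurable_fun (setT `*` `[0, T])
      (fun p : C * R => if 0 < p.2 then \1_B (eval_path p.1 p.2 : E, p.2) else 0 : R).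
  move=> mB; apply: measurable_funTS; apply: measurable_fun_ifT => //.
    exact: measurable_fun_ltr.
  exact (measurableT_comp (measurable_indic mB) mpair).
have ind01 (B : set (E * R)) p : 0 <= (\1_B p : R) <= 1.
  by rewrite indicE; case: (_ \in _); rewrite ?lexx ler01.
have mboxes : boxes `<=` approximable \o
    (fun A => scalar (fun x s => if 0 < s then \1_A (eval_path x s : E, s) else 0) i).
  move=> _ [a [c ->]] /=.
  have := box_approximable i a c; congr approximable.
  apply/funext => x; apply/funext => s; congr (_ *: _).
  case: (ltP 0 s) => //= s0; rewrite indicE.
  case: (leP s c) => sc; last first.
    by rewrite memNset//= => -[_]; rewrite leNgt sc.
  have [h|h] := pselect (forall j, eval_path x s j 0 < a j).
    by rewrite mem_set// big1// => j _; rewrite h.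
  rewrite memNset; last by move=> [].
  have /existsNP[j /negP hj] := h.
  by rewrite (bigD1 j)//= (negbTE hj) mul0r.
(* The whole space is reached as the limit of the boxes [D k]; the time bound [T] excludes nothing
   in [[0, T]]. *)
have appT : approximable (scalar (fun x s => if 0 < s then
    \1_[set: E * R] (eval_path x s : E, s) else 0) i).
  pose D (k : nat) : set (E * R) := [set p : E * R | (forall j, p.1 j 0 < k%:R) /\ p.2 <= T].
  apply: (@approximable_scalar_lim i (fun k x s => if 0 < s then
      \1_(D k) (eval_path x s : E, s) else 0) _ 1).
  - by move=> k; apply: mboxes; eexists _, _.
  - exact: mind.
  - move=> k x s _; case: ifP => _; last by rewrite subrr normr0.
    have /andP[h1 h2] := ind01 (D k) (eval_path x s : E, s).
    by rewrite [X in _ - X]indicE in_setT/= ler_norml; lra.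
  - move=> x s /andP[_ sT]; case: ifP => _; last exact: cvg_cst.
    rewrite [X in _ --> X]indicE in_setT/=; apply: cvg_near_cst.
    pose M := \sum_(j < n) `|eval_path x s j 0|.
    have M0 : 0 <= M by rewrite sumr_ge0.
    exists (Num.bound M) => // k /= Mk.
    rewrite indicE mem_set//; split => //= j.
    apply: (@le_lt_trans _ _ M); last first.
      apply: (@lt_le_trans _ _ (Num.bound M)%:R); first exact: archi_boundP.
      by rewrite ler_nat.
    by rewrite (le_trans (ler_norm _))// /M (bigD1 j)//= lerDl sumr_ge0.
move: A; rewrite g_sigma_boxes.
apply: (@dynkin_induction _ _ boxes (fun A => approximable
  (scalar (fun x s => if 0 < s then \1_A (eval_path x s : E, s) else 0) i))).
- exact: g_sigma_boxes.
- exact: setI_closed_boxes.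
- exact: appT.
- exact: mboxes.
- move=> A mA aA; have := approximableD appT (approximableZ (-1) aA).
  congr approximable; apply/funext => x; apply/funext => s.
  rewrite scalerA -scalerDl; congr (_ *: _); case: ifP => _; last by rewrite mulr0 addr0.
  rewrite !indicE in_setT in_setC; case: (_ \in A) => /=; ring.
- move=> F mF tF aF.
  (* Disjointness makes the partial sums indicators of finite unions, so they stay within distance 1
     of the limit. *)
  pose S k (x : C) s : R := \sum_(j < k) (if 0 < s then \1_(F j) (eval_path x s : E, s) else 0).
  have SE k x s : S k x s = if 0 < s then \1_(\big[setU/set0]_(j < k) F j) (eval_path x s : E, s) else 0.
    rewrite /S; case: ifP => _; last by rewrite big1.
    elim: k => [|k IH]; first by rewrite !big_ord0 indic0.
    rewrite !big_ord_recr/= IH !indicE in_setU.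
    case: (boolP (_ \in \big[setU/set0]_(j < k) F j)) => h1; last by rewrite add0r.
    rewrite (_ : (_ \in F k) = false) ?addr0//; apply/negbTE; rewrite notin_setE => h2.
    move: h1; rewrite inE -bigcup_mkord => -[j jk h1].
    have := tF j k I I (ex_intro _ _ (conj h1 h2)) => jk'.
    by move: jk; rewrite jk' /= ltnn.
  apply: (@approximable_scalar_lim i S _ 1).
  + elim=> [|k IH].
      have := approximable0; congr approximable.
      by apply/funext => x; apply/funext => s; rewrite /S big_ord0 scale0r.
    have := approximable_scalarD IH (aF k); congr approximable.
    by apply/funext => x; apply/funext => s; rewrite /S big_ord_recr.
  + by apply: mind; exact: bigcupT_measurable.
  + move=> k x s _; rewrite SE; case: ifP => _; last by rewrite subrr normr0.
    have /andP[h1 h2] := ind01 (\big[setU/set0]_(j < k) F j) (eval_path x s : E, s).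
    have /andP[h3 h4] := ind01 (\bigcup_k F k) (eval_path x s : E, s).
    by rewrite ler_norml; lra.
  + move=> x s _; under eq_fun do rewrite SE; case: ifP => _; last exact: cvg_cst.
    apply: cvg_near_cst; rewrite indicE.
    case: (boolP (_ \in \bigcup_k F k)) => [|h].
      rewrite inE => -[j _ Fj]; exists j.+1 => // k /= jk.
      rewrite indicE mem_set// -bigcup_mkord; exists j => //.
    apply: nearW => k; rewrite indicE memNset//= -bigcup_mkord => -[j _ Fj].
    by move: h; rewrite notin_setE; apply; exists j.
Qed.

(** Nonnegative simple functions increase to [phi] from below, so the bound [K] applies to every
    approximation error. *)
Lemma bounded_scalar_approximable i (phi : 'cV[R]_n -> R -> R) K :
  measurable_coeff T phi -> (forall y s, 0 <= s <= T -> 0 <= phi y s <= K) ->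
  approximable (scalar (fun x s => if 0 < s then phi (eval_path x s) s else 0) i).
Proof.
move=> mphi phiK.
pose D := (setT : set E) `*` `[0, T]%classic.
have mD : measurable D by exact: measurableX.
pose f : E * R -> R := (fun p => phi p.1 p.2) \_ D.
have mf : measurable_fun setT (EFin \o f).
  by apply/measurable_EFinP; exact: (measurable_restrictT _ mD).1.
have fK p : 0 <= f p.
  rewrite /f /patch; case: ifPn => //; rewrite inE => -[_ /=].
  by rewrite in_itv/= => sT; case/andP: (phiK p.1 p.2 sT).
pose g := nnsfun_approx measurableT mf.
have gf k p : g k p <= f p.
  rewrite -lee_fin /g nnsfun_approxE.
  by apply: (le_approx (D := setT)) => // q _; rewrite lee_fin.
have fE x s : 0 <= s <= T -> f (eval_path x s : E, s) = phi (eval_path x s) s.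
  by move=> sT; rewrite /f /patch mem_set//; split => //=; rewrite in_itv.
apply: (@approximable_scalar_lim i (fun k x s => if 0 < s then
  g k (eval_path x s : E, s) else 0) _ K).
- move=> k.
  have sum_approx (r : seq R) : approximable (scalar (fun x s => if 0 < s then
      \sum_(y <- r) y * \1_(g k @^-1` [set y]) (eval_path x s : E, s) else 0) i).
    elim: r => [|y r IH].
      have := approximable0; congr approximable.
      apply/funext => x; apply/funext => s; rewrite big_nil if_same.
      by rewrite scale0r.
    have mg : measurable (g k @^-1` [set y]) by exact: measurable_funPTI.
    have := approximable_scalarD (approximable_scalarZ y (set_approximable i mg)) IH.
    congr approximable; apply/funext => x; apply/funext => s; congr (_ *: _).
    by rewrite big_cons; case: ifP => _ //; rewrite mulr0 addr0.
  have := sum_approx (finmap.enum_fset (fset_set (range (g k)))).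
  congr approximable; apply/funext => x; apply/funext => s; congr (_ *: _).
  by rewrite fimfunE fsbig_finite.
- have := measurable_coeff_along T0 (@measurable_id _ C setT) mphi.
  move=> mphi'; apply: measurable_fun_if => //.
  + exact: measurableX.
  + by apply: measurable_funTS; exact: measurable_fun_ltr.
  + by apply: measurable_funS mphi'; [exact: measurableX|move=> p []].
- move=> k x s sT; case: ifP => _; last first.
    rewrite subrr normr0; have /andP[h1 h2] := phiK 0 s sT; exact: le_trans h2.
  have := gf k (eval_path x s : E, s); rewrite fE// => g1.
  have /andP[h1 h2] := phiK (eval_path x s) s sT.
  have g0 : 0 <= g k (eval_path x s : E, s) by [].
  by rewrite ler_norml; lra.
- move=> x s sT; case: ifP => _; last exact: cvg_cst.
  rewrite -fE//.
  have := @cvg_nnsfun_approx _ _ _ _ measurableT _ mf _ (eval_path x s : E, s) I.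
  move=> /(_ (fun q _ => ltac:(by rewrite lee_fin; exact: fK))).
  by move/fine_cvgP => [_]; apply.
Qed.

Lemma scalar_approximable i (phi : 'cV[R]_n -> R -> R) K :
  measurable_coeff T phi -> (forall y s, 0 <= s <= T -> `|phi y s| <= K) ->
  approximable (scalar (fun x s => if 0 < s then phi (eval_path x s) s else 0) i).
Proof.
move=> mphi phiK.
have m1 : measurable_coeff T (fun y s => Num.max (phi y s) 0).
  exact: measurable_maxr.
have m2 : measurable_coeff T (fun y s => Num.max (- phi y s) 0).
  by apply: measurable_maxr => //; exact: measurable_funN.
have K0 s : 0 <= s <= T -> 0 <= K by move=> sT; exact: le_trans (phiK 0 s sT).
have a1 := @bounded_scalar_approximable i _ K m1.
have a2 := @bounded_scalar_approximable i _ K m2.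
have := approximable_scalarD (a1 _) (approximable_scalarZ (-1) (a2 _)).
move=> H; have {}H : approximable (scalar (fun x s =>
    (if 0 < s then Num.max (phi (eval_path x s) s) 0 else 0) +
    -1 * (if 0 < s then Num.max (- phi (eval_path x s) s) 0 else 0)) i).
  apply: H => y s sT; have := phiK y s sT; rewrite ler_norml => /andP[h1 h2];
    rewrite le_max lexx orbT/= ge_max (K0 s sT) andbT //; lra.
move: H; congr approximable; apply/funext => x; apply/funext => s; congr (_ *: _).
case: ifP => _; last by rewrite mulr0 addr0.
case: (leP (phi (eval_path x s) s) 0) => h.
  by rewrite max_l ?oppr_ge0//; ring.
by rewrite max_r ?oppr_le0 ?ltW//; ring.
Qed.

Lemma sum_unit_vec (v : 'cV[R]_n) : v = \sum_i v i 0 *: unit_vec i.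
Proof.
apply/colP => i; rewrite summxE (bigD1 i)//= big1 => [|j ji].
  by rewrite !mxE !eqxx mulr1 addr0.
by rewrite !mxE eq_sym (negbTE ji) mulr0.
Qed.

(** Bounded coefficients are approximated coordinate by coordinate. For unbounded ones a truncation
    error is either 0 or [- psi], of size at most $(1 + 1) N(\psi)$, which dominates. *)
Theorem coeff_approximable (psi : 'cV[R]_n -> R -> 'cV[R]_n) :
  measurable_vcoeff T psi ->
  {ae m, forall x, mu.-integrable `[0, T]
    (fun s => (N (psi (eval_path x s) s) (eval_path x s) s)%:E)} ->
  approximable (fun x s => if 0 < s then psi (eval_path x s) s else 0).
Proof.
move=> mpsi ipsi.
have mjoint (phi : 'cV[R]_n -> R -> 'cV[R]_n) : measurable_vcoeff T phi ->
    joint_measurable (fun x s => if 0 < s then phi (eval_path x s) s else 0).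
  move=> mphi i.
  have mphi' := measurable_coeff_along T0 (@measurable_id _ C setT) (mphi i).
  rewrite (_ : (fun p => _) = (fun p : C * R =>
      if 0 < p.2 then phi (eval_path p.1 p.2) p.2 i 0 else 0)); last first.
    by apply/funext => p; case: ifP => // _; rewrite mxE.
  apply: measurable_fun_if => //.
  + exact: measurableX.
  + by apply: measurable_funTS; exact: measurable_fun_ltr.
  + by apply: measurable_funS mphi'; [exact: measurableX|move=> p []].
(* The whole vector is dropped as soon as one coordinate is large: the integrability of [N] is
   assumed for [psi], which gives no control over its coordinates taken separately. *)
pose trunc (k : nat) y s : 'cV[R]_n := if [forall i, `|psi y s i 0| <= k%:R] then psi y s else 0.
have mtrunc k : measurable_vcoeff T (trunc k).
  move=> i; rewrite /measurable_coeff (_ : (fun p => _) = (fun p : E * R =>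
      psi p.1 p.2 i 0 * \prod_(j < n) (if `|psi p.1 p.2 j 0| <= k%:R then 1 else 0))).
    apply: measurable_funM; first exact: mpsi.
    apply: measurable_prod => j _.
    have mb : measurable_fun (setT `*` `[0, T])
        (fun p : E * R => `|psi p.1 p.2 j 0| <= k%:R).
      apply: measurable_fun_ler; last exact: measurable_cst.
      by apply: measurableT_comp => //; exact: mpsi.
    by apply: measurable_fun_if => //; exact: measurableX.
  apply/funext => p; rewrite /trunc; case: ifPn => [/forallP h|].
    by rewrite big1 ?mulr1// => j _; rewrite h.
  rewrite negb_forall => /existsP[j hj].
  by rewrite (bigD1 j)//= (negbTE hj) mul0r mulr0 mxE.
apply: (@approximable_lim
  (fun k x s => if 0 < s then trunc k (eval_path x s) s else 0) _
  (fun x s => 2 * N (psi (eval_path x s) s) (eval_path x s) s)).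
- move=> k.
  suff : forall r : seq 'I_n, approximable (fun x s => \sum_(i <- r)
      (if 0 < s then trunc k (eval_path x s) s i 0 else 0) *: unit_vec i).
    move=> /(_ (index_enum _)); congr approximable.
    apply/funext => x; apply/funext => s.
    case: ifP => _; first by rewrite -sum_unit_vec.
    by rewrite big1// => i _; rewrite scale0r.
  elim=> [|i r IH].
    have := approximable0; congr approximable.
    by apply/funext => x; apply/funext => s; rewrite big_nil.
  have ai := @scalar_approximable i (fun y s => trunc k y s i 0) k%:R (mtrunc k i).
  have tk y s : 0 <= s <= T -> `|trunc k y s i 0| <= k%:R.
    move=> _; rewrite /trunc; case: ifP => [/forallP|_]; first exact.
    by rewrite mxE normr0.
  have := approximableD (ai tk) IH; congr approximable.
  by apply/funext => x; apply/funext => s; rewrite big_cons.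
- exact: mjoint.
- apply: filterS ipsi => x ix.
  by apply: eq_integrable (integrableZl _ 2 ix).
- move=> k x s sT; case: ifP => _; last first.
    by rewrite subrr N0 mulr_ge0.
  rewrite /trunc; case: ifP => _; first by rewrite subrr N0 mulr_ge0.
  rewrite sub0r -scaleN1r; apply: le_trans (NZ _ _ _ _) _.
  by rewrite normrN1 sqrrN expr1n.
- move=> x s sT; apply: cvg_near_cst; case: ifP => _; last first.
    by apply: nearW => k; rewrite subrr N0.
  pose M := \sum_(j < n) `|psi (eval_path x s) s j 0|.
  have M0 : 0 <= M by rewrite sumr_ge0.
  exists (Num.bound M) => // k /= Mk; rewrite /trunc ifT ?subrr ?N0//.
  apply/forallP => j; apply: (@le_trans _ _ M).
    by rewrite /M (bigD1 j)//= lerDl sumr_ge0.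
  apply/ltW/(@lt_le_trans _ _ (Num.bound M)%:R); first exact: archi_boundP.
  by rewrite ler_nat.
Qed.

End density.

(* [x^-1] is the limit of [x / (x ^+ 2 + k.+1%:R^-1)], also at the junk value [0^-1 = 0]. *)
Lemma measurable_inv (R : realType) : measurable_fun setT (fun x : R => x^-1).
Proof.
apply: (@measurable_fun_cvg _ _ _ _
  (fun (k : nat) (x : R) => x / (x ^+ 2 + k.+1%:R^-1))) => [k|x _].
  apply: continuous_measurable_fun => x; apply: cvgM; first exact: cvg_id.
  have xk : x ^+ 2 + k.+1%:R^-1 != 0.
    by rewrite gt_eqF// ltr_wpDl ?sqr_ge0// invr_gt0 ltr0n.
  apply: cvgV => //; apply: cvgD; last exact: cvg_cst.
  by under eq_fun do rewrite expr2; rewrite expr2; apply: cvgM; exact: cvg_id.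
have [->|x0] := eqVneq x 0.
  by under eq_fun do rewrite mul0r; rewrite invr0; exact: cvg_cst.
have x2 : x ^+ 2 != 0 by rewrite sqrf_eq0.
rewrite -[X in _ --> X](_ : x / (x ^+ 2 + 0) = x^-1); last first.
  by rewrite addr0 expr2 invfM mulrA divff// mul1r.
apply: cvgM; first exact: cvg_cst.
apply: cvgV; first by rewrite addr0.
by apply: cvgD; [exact: cvg_cst|exact: cvg_harmonic].
Qed.

Lemma measurable_det d (S : measurableType d) (R : realType) (D : set S) n
    (A : S -> 'M[R]_n) :
  (forall i j, measurable_fun D (fun w => A w i j)) ->
  measurable_fun D (fun w => \det (A w)).
Proof.
move=> mA; rewrite /determinant.
apply: (@measurable_sum _ _ _ D _ _ (fun (s : 'S_n) w =>
  (-1) ^+ s * \prod_i A w i (s i))) => s.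
apply: measurable_funM; first exact: measurable_cst.
by apply: measurable_prod.
Qed.

(** Cramer's rule: where the matrix is invertible, each entry is a cofactor divided by the
    determinant. *)
Lemma measurable_invmx d (S : measurableType d) (R : realType) (D : set S) n
    (A : S -> 'M[R]_n) : (forall w, D w -> A w \in unitmx) ->
  (forall i j, measurable_fun D (fun w => A w i j)) ->
  forall i j, measurable_fun D (fun w => invmx (A w) i j).
Proof.
move=> uA mA i j.
apply: (@eq_measurable_fun _ _ _ _ _ (fun w => (\det (A w))^-1 * cofactor (A w) j i)).
  by move=> w; rewrite inE => /uA uw; rewrite /invmx uw !mxE.
apply: measurable_funM.
  by apply: (measurableT_comp (@measurable_inv R)); exact: measurable_det.
apply: measurable_funM; first exact: measurable_cst.
apply: measurable_det => k l.
rewrite (_ : (fun w => _) = (fun w => A w (lift j k) (lift i l))); first exact: mA.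
by apply/funext => w; rewrite !mxE.
Qed.

(** * Transfer between processes and their laws *)

Lemma small_distribution d (S : measurableType d) (R : realType) (P : probability S R)
    d' (S' : measurableType d') (X : {RV P >-> S'}) e (k : S' -> \bar R) :
  measurable_fun setT k -> small P e (fun w => k (X w)) <-> small (distribution P X) e k.
Proof.
move=> mk; split=> [sk|[A [mA PA kA]]].
  exists [set x | (e%:E < k x)%E]; split.
  - by rewrite -[X in measurable X]setTI; exact: emeasurable_fun_o_infty.
  - rewrite /distribution /pushforward/=; apply: (prob_small _ sk).
    exact: measurableT_comp.
  - by move=> x /= /negP; rewrite -leNgt.
exists (X @^-1` A); split => //; last by move=> w; exact: kA.
by rewrite -[X in measurable X]setTI; exact: measurable_funP.
Qed.

Section transfer.
Context d (S : measurableType d) (R : realType) (P : probability S R).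
Context d' (S' : measurableType d') (X Y : {RV P >-> S'}).

Lemma ae_distribution (A : set S') : measurable A ->
  {ae P, forall w, A (X w)} -> {ae distribution P X, forall x, A x}.
Proof.
move=> mA [B [mB PB BA]]; have mXA : measurable (X @^-1` A).
  by rewrite -[X in measurable X]setTI; exact: measurable_funP.
exists (~` A); split => //; first exact: measurableC.
apply/eqP; rewrite eq_le measure_ge0 andbT -PB.
rewrite /distribution /pushforward/=; apply: le_measure; rewrite ?inE//.
by rewrite preimage_setC; exact: measurableC.
Qed.

Lemma distribution_ae (A : set S') :
  {ae distribution P X, forall x, A x} -> {ae P, forall w, A (X w)}.
Proof.
move=> [B [mB PB BA]]; exists (X @^-1` B); split.
- by rewrite -[X in measurable X]setTI; exact: measurable_funP.
- exact: PB.
- by move=> w /= nA; apply: BA.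
Qed.

Hypothesis YX : distribution P Y `<< distribution P X.

Lemma ae_transfer (A : set S') : measurable A ->
  {ae P, forall w, A (X w)} -> {ae P, forall w, A (Y w)}.
Proof.
move=> mA AX.
have mYA : measurable (Y @^-1` A).
  by rewrite -[X in measurable X]setTI; exact: measurable_funP.
have mXA : measurable (X @^-1` A).
  by rewrite -[X in measurable X]setTI; exact: measurable_funP.
exists (~` (Y @^-1` A)); split => //; first exact: measurableC.
have /null_content_dominatesP dom := YX.
apply: (dom (~` A) (measurableC mA)); change (P (~` (X @^-1` A)) = 0%E).
case: AX => B [mB PB BA]; apply/eqP; rewrite eq_le measure_ge0 andbT -PB.
by apply: le_measure; rewrite ?inE//; exact: measurableC.
Qed.

Lemma ae_lty_transfer (k : S' -> \bar R) : measurable_fun setT k ->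
  {ae P, forall w, (k (X w) < +oo)%E} -> {ae P, forall w, (k (Y w) < +oo)%E}.
Proof.
move=> mk; apply: (ae_transfer (A := [set x | (k x < +oo)%E])).
by rewrite -[X in measurable X]setTI; exact: emeasurable_fun_infty_o.
Qed.

End transfer.

(** * Ito integrals along solutions *)

Section solutions.
Context {R : realType} {n : nat} {dO : measure_display} {Omega : measurableType dO}.
Variables (P : probability Omega R) (W : R -> Omega -> 'cV[R]_n) (T : R).
Hypothesis T0 : 0 < T.
Hypothesis BM : standard_brownian_motion P W T.
Variables (xinit : 'cV[R]_n).
Local Notation C := (path_space T xinit).
Local Notation E := (g_sigma_algebraType (@coordinate_sets R n)).
Local Notation mu := (@lebesgue_measure R).
Local Notation unit_vec i := (delta_mx i 0 : 'cV[R]_n).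
Local Notation past := (past_fun P W).

Lemma dot_unit_vec i (v : 'cV[R]_n) : dot (unit_vec i) v = v i 0.
Proof.
rewrite /dot (bigD1 i)//= big1 ?addr0 => [|j ji]; first by rewrite mxE !eqxx mul1r.
by rewrite mxE (negbTE ji) mul0r.
Qed.

Lemma trmx_mul_unit_vec i (A : 'M[R]_n) : A^T *m unit_vec i = (row i A)^T.
Proof. by rewrite rowE trmx_mul trmx_delta. Qed.

Lemma Rintegral_itv_cut (t : R) (h : R -> R) : 0 <= t -> t <= T ->
  \int[mu]_(s in `[0, T]) (if s <= t then h s else 0) = \int[mu]_(s in `[0, t]) h s.
Proof.
move=> t0 tT; congr fine.
transitivity (\int[mu]_(s in `[0%R, T] `&` `[0%R, t]) (h s)%:E)%E.
  rewrite integral_mkcondr; apply: eq_integral => s.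
  rewrite inE /= in_itv/= => /andP[s0 sT].
  by rewrite /patch mem_setE in_itv/= s0/=; case: ifP.
congr integral; apply/seteqP; split => s /=; rewrite !in_itv/=; first by case.
by move=> /andP[s0 st]; rewrite s0 st (le_trans st tT).
Qed.

Lemma integrable_cut (t : R) (h : R -> R) :
  mu.-integrable `[0, T] (fun s => (h s)%:E) ->
  mu.-integrable `[0, T] (fun s => (if s <= t then h s else 0)%:E).
Proof.
move=> ih.
apply: (@eq_integrable _ _ _ mu `[0, T]%classic _
  ((fun s => (h s)%:E) \_ `]-oo, t]%classic)) => //.
  by move=> s _; rewrite /patch mem_setE in_itv/=; case: ifP.
apply/(integrable_restrict _ _ _ _) => //.
by apply: (integrableS _ _ _ ih) => //; exact: measurableI.
Qed.

Variables (sigma : 'cV[R]_n -> R -> 'M[R]_n) (beta : 'cV[R]_n -> R -> 'cV[R]_n).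
Variable (Y : {RV P >-> C}).
Hypothesis Y_sol : strong_solution W beta sigma Y.

Lemma past_eval a (phi : E -> R) : 0 <= a -> a <= T -> measurable_fun setT phi ->
  past a (fun w => phi (eval_path (Y w) a)).
Proof.
move=> a0 aT mphi; have [adY _ _ _] := Y_sol.
have aY := proj1 (adapted_atP _ _ _ _) (adY a ltac:(by rewrite a0)).
have mE : measurable_fun (setT : set (past_type P W a)) (fun w => eval_path (Y w) a : E).
  by apply: (@measurable_coordinates R n _ (past_type P W a)) => i; exact: aY.
exact (measurableT_comp mphi mE).
Qed.

(** The equation is given separately at the times [a] and [b]. With both integrands cut on [[0, T]],
    the two Ito integrals can be subtracted and leave the integrand on []a, b]]. *)
Lemma solution_increment a b i : 0 <= a -> a <= b -> b <= T -> exists M : Omega -> R,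
  ito_limit P W T (fun s w => if a < s <= b then (row i (sigma (eval_path (Y w) s) s))^T else 0) M /\
  {ae P, forall w, eval_path (Y w) b i 0 - eval_path (Y w) a i 0 =
    \int[mu]_(s in `[0, b]) beta (eval_path (Y w) s) s i 0 -
    \int[mu]_(s in `[0, a]) beta (eval_path (Y w) s) s i 0 + M w}.
Proof.
move=> a0 ab bT; have aT := le_trans ab bT; have b0 := le_trans a0 ab.
have [_ _ itoY eqY] := Y_sol.
pose H s w := (row i (sigma (eval_path (Y w) s) s))^T.
have lim t : 0 <= t -> t <= T ->
    ito_limit P W T (fun s w => if s <= t then H s w else 0) (ito P W t H).
  move=> t0 tT; apply: (is_ito_limit BM t0 tT).
  have /itoY : 0 <= t <= T by rewrite t0.
  by move=> /(_ i)[I HI]; exact: (xgetPex (fun=> 0) (ex_intro _ I HI)).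
exists (fun w => ito P W b H w - ito P W a H w); split.
  apply: eq_ito_limit (ito_limitB (ltW T0) (lim b b0 bT) (lim a a0 aT)) => s w _.
  rewrite ltNge; case: (leP s a) => sa /=; last by rewrite subr0.
  by rewrite (le_trans sa ab) subrr.
have := eqY i b ltac:(by rewrite b0); have := eqY i a ltac:(by rewrite a0).
by apply: filterS2 => w -> ->; rewrite -/H; ring.
Qed.

(** [J] integrates [h] against the whole path. Removing the drift leaves $\int h\cdot\sigma\,dW =
    \int \sigma^\top h\cdot dW$; the coefficient [phi] at time [a] moves inside the Ito integral
    because it is known at the start of its interval. *)
Lemma solution_path_simple (h : C -> R -> 'cV[R]_n) J : path_simple h J ->
  {ae P, forall w, mu.-integrable `[0, T]
    (fun s => (dot (h (Y w) s) (beta (eval_path (Y w) s) s))%:E)} /\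
  ito_limit P W T (fun s w => (sigma (eval_path (Y w) s) s)^T *m h (Y w) s)
    (fun w => J (Y w) - \int[mu]_(s in `[0, T]) dot (h (Y w) s) (beta (eval_path (Y w) s) s)).
Proof.
have [_ ibeta _ _] := Y_sol.
elim=> [|a b i phi {}h {}J a0 ab bT mphi [M bphi] ph [ih lh]].
  split.
    apply: aeW => w; apply: (@eq_integrable _ _ _ mu `[0, T]%classic _ (cst 0%E)) => //; last exact: integrable0.
    by move=> s _; rewrite dot0l.
  have := ito_limit_elementary (elementary0 P W T).
  congr (ito_limit P W T _ _); apply/funext => w.
    by apply/funext => w'; rewrite mulmx0.
  rewrite (_ : \int[mu]_(s in _) _ = 0) ?subr0//.
  rewrite /Rintegral integral0_eq// => s _; by rewrite dot0l.
have aT := le_trans ab bT; have b0 := le_trans a0 ab.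
pose bt s w := beta (eval_path (Y w) s) s i 0.
pose cc w := phi (eval_path (Y w) a).
(* Writing the step as a difference of two cuts matches the two drift integrals of
   [solution_increment]. *)
have dotE w s : dot ((if a < s <= b then cc w else 0) *: unit_vec i + h (Y w) s)
    (beta (eval_path (Y w) s) s) =
    cc w * ((if s <= b then bt s w else 0) - (if s <= a then bt s w else 0)) +
    dot (h (Y w) s) (beta (eval_path (Y w) s) s).
  rewrite dotDl dotZl dot_unit_vec; congr (_ + _).
  rewrite ltNge; case: (leP s a) => sa /=; last by case: ifP; rewrite subr0 ?mulr0 ?mul0r.
  by rewrite (le_trans sa ab) subrr mul0r mulr0.
have ibt : {ae P, forall w, [/\ mu.-integrable `[0, T] (fun s => (if s <= b then bt s w else 0)%:E),
    mu.-integrable `[0, T] (fun s => (if s <= a then bt s w else 0)%:E) &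
    mu.-integrable `[0, T] (fun s => (dot (h (Y w) s) (beta (eval_path (Y w) s) s))%:E)]}.
  apply: filterS2 ibeta ih => w /(_ i) iw ihw; split => //; exact: integrable_cut.
split.
  apply: filterS ibt => w [i1 i2 i3].
  apply: (@eq_integrable _ _ _ mu `[0, T]%classic _ ((fun s => (cc w)%:E *
    ((if s <= b then bt s w else 0)%:E - (if s <= a then bt s w else 0)%:E))%E \+
    (fun s => (dot (h (Y w) s) (beta (eval_path (Y w) s) s))%:E))%E) => //.
    by move=> s _; rewrite dotE.
  apply: integrableD => //; apply: integrableZl => //.
  exact: integrableB.
have [Mart [lM eM]] := solution_increment i a0 ab bT.
have pc : past a cc by exact: past_eval.
have l1 : ito_limit P W T (fun s w => cc w *:
    (if a < s <= b then (row i (sigma (eval_path (Y w) s) s))^T else 0)) (fun w => cc w * Mart w).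
  apply: (ito_limit_mul_after (ltW T0) BM a0 aT pc (M := M) _ _ lM).
    by move=> w; exact: bphi.
  by move=> s w sa; rewrite ltNge sa.
have l2 := ito_limitD l1 lh.
apply: ito_limit_ae; last first.
  apply: (eq_ito_limit _ l2) => s w _.
  rewrite mulmxDr -scalemxAr trmx_mul_unit_vec; congr (_ + _).
  by case: ifP => _; rewrite ?scaler0 ?scale0r.
apply: filterS2 ibt eM => w [i1 i2 i3] eMw /=.
have iB : mu.-integrable `[0, T] (EFin \o (fun s =>
    (if s <= b then bt s w else 0) - (if s <= a then bt s w else 0))).
  exact: (@integrableB _ _ _ mu `[0, T]%classic _ (fun s => (if s <= b then bt s w else 0)%:E)
    (fun s => (if s <= a then bt s w else 0)%:E)).
rewrite -/(cc w) eMw.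
under [X in _ = _ - X]eq_Rintegral do rewrite dotE.
rewrite RintegralD//; last first.
  by have := @integrableZl _ _ _ mu `[0, T]%classic ltac:(by []) (cc w) _ iB; exact.
rewrite RintegralZl// RintegralB//.
rewrite !Rintegral_itv_cut//; rewrite /bt; ring.
Qed.

End solutions.

(** Needed to transfer almost sure integrability from one law to another, which is done for
    measurable sets of paths. *)
Lemma measurable_integrable d (S : measurableType d) (R : realType) (D : set R)
    (F : S * R -> R) : measurable D -> measurable_fun (setT `*` D) F ->
  measurable [set x | lebesgue_measure.-integrable D (fun s => (F (x, s))%:E)].
Proof.
move=> mD mF.
have mN : measurable_fun setT
    (fun x => \int[lebesgue_measure]_(s in D) `|F (x, s)|%:E)%E.
  apply: (@measurable_integral_section _ S R D mD (fun p => `|F p|%:E)) => //.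
  by apply/measurable_EFinP; exact: measurableT_comp.
rewrite (_ : [set x | _] =
    [set x | (\int[lebesgue_measure]_(s in D) `|F (x, s)|%:E < +oo)%E]).
  by rewrite -[X in measurable X]setTI; exact: emeasurable_fun_infty_o.
apply/seteqP; split => x /=; first by move=> /integrableP[].
move=> foo; apply/integrableP; split => //.
by apply/measurable_EFinP; exact: measurable_section.
Qed.

Section energy_integrable.
Context {R : realType} {n : nat} (T : R).
Local Notation mu := (@lebesgue_measure R).
Implicit Types v w : 'cV[R]_n.

Lemma normr_dot_le v w : `|dot v w| <= sqnorm v + sqnorm w.
Proof.
have D := sqnorm_ge0 (v + w); have B := sqnorm_ge0 (v - w).
have := sqnorm_ge0 v; have := sqnorm_ge0 w.
rewrite /sqnorm in D B *.
rewrite dotDl !dotDr (dotC w v) in D.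
rewrite dotBr dotDl dotNl dotDl dotNl (dotC w v) in B.
by move=> *; rewrite ler_norml; apply/andP; split; lra.
Qed.

Lemma energy_integrable (h : R -> 'cV[R]_n) : measurable_path T h ->
  (energy T h < +oo)%E -> mu.-integrable `[0, T] (fun s => (sqnorm (h s))%:E).
Proof.
move=> mh hoo; apply/integrableP; split; first exact: measurable_sqnorm.
rewrite [ltLHS](_ : _ = energy T h)//; apply: eq_integral => s _.
by rewrite gee0_abs// lee_fin sqnorm_ge0.
Qed.

Lemma integrable_dot (h k : R -> 'cV[R]_n) : measurable_path T h -> measurable_path T k ->
  (energy T h < +oo)%E -> (energy T k < +oo)%E ->
  mu.-integrable `[0, T] (fun s => (dot (h s) (k s))%:E).
Proof.
move=> mh mk hoo koo.
have ih := energy_integrable mh hoo; have ik := energy_integrable mk koo.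
apply: (le_integrable _ _ _ (integrableD _ ih ik)) => //.
  by apply/measurable_EFinP; exact: measurable_dot.
move=> s _ /=; rewrite lee_fin (le_trans (normr_dot_le _ _))//.
by rewrite ler_norm.
Qed.

End energy_integrable.

Section ito_energy.
Context {R : realType} {n : nat} {dO : measure_display} {Omega : measurableType dO}.
Variables (P : probability Omega R) (W : R -> Omega -> 'cV[R]_n) (T : R).

Lemma elementary_energy H I w : 0 <= T -> elementary P W T H I ->
  (energy T (H^~ w) < +oo)%E.
Proof.
move=> T0 eH; have [tau [c [N [[ndt tauT _ _] [HE _]]]]] := elementary_steps T0 eH.
rewrite [ltLHS](_ : _ = (\sum_(k < N) (tau k.+1 - tau k) * sqnorm (c k w))%:E) ?ltry//.
rewrite -(@energy_steps R n T tau (fun k => c k w) N)//; apply: eq_energy => s _.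
by rewrite HE.
Qed.

(** An elementary integrand has finite energy on every path, and off a set of small probability [H]
    differs from one by a finite energy. *)
Lemma ito_limit_energy H I : 0 <= T -> ito_limit P W T H I ->
  {ae P, forall w, (energy T (H^~ w) < +oo)%E}.
Proof.
move=> T0 [mH aH].
(* The indicator of infinite energy; [small] accepts it without measurability, and [small_null] then
   makes it vanish almost surely. *)
pose Y w : \bar R := (if energy T (H^~ w) < +oo then 0 else 1)%E.
have sY e : 0 < e -> small P e Y.
  move=> e0; have [He [Ie [eHe [A [mA PA gA]] _]]] := aH e e0.
  exists A; split => // w nA; rewrite /Y; case: ifPn; first by rewrite lee_fin ltW.
  rewrite -leNgt leye_eq => /eqP Hoo; exfalso.
  have mHe : measurable_path T (He^~ w) by exact: (elementary_measurable_path _ eHe).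
  have := energyD_le (measurable_pathZ (-1) (measurable_pathB mHe (mH w))) mHe.
  rewrite energyZ; last exact: measurable_pathB.
  rewrite (_ : (fun s => _) = H^~ w); last first.
    by apply/funext => s; rewrite scaleN1r opprB subrK.
  have Ge := gA w nA; rewrite Hoo leye_eq sqrrN expr1n mul1e => /eqP E.
  have : (2%:E * energy T (fun s => He s w - H s w)%R + 2%:E * energy T (He^~ w) < +oo)%E.
    apply: lte_add_pinfty; apply: lte_mul_pinfty => //; last exact: elementary_energy eHe.
    exact: le_lt_trans Ge (ltry _).
  by rewrite E.
apply: filterS (small_null sY) => w; rewrite /Y; case: ifP => // _.
by rewrite lee_fin ler10.
Qed.

End ito_energy.

Section path_functionals.
Context {R : realType} {n : nat} (T : R) (xinit : 'cV[R]_n) (T0 : 0 < T).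
Local Notation C := (path_space T xinit).
Local Notation E := (g_sigma_algebraType (@coordinate_sets R n)).
Local Notation mu := (@lebesgue_measure R).

Lemma joint_vcoeff (h : 'cV[R]_n -> R -> 'cV[R]_n) : measurable_vcoeff T h ->
  joint_measurable (fun (x : C) s => h (eval_path x s) s).
Proof.
move=> mh i.
exact: (measurable_coeff_along T0 (@measurable_id _ C setT) (mh i)).
Qed.

Lemma joint_mulmx (A : C -> R -> 'M[R]_n) F :
  (forall i j, measurable_fun (setT `*` `[0, T]) (fun p : C * R => A p.1 p.2 i j)) ->
  joint_measurable F -> joint_measurable (fun x s => A x s *m F x s).
Proof.
move=> mA mF i.
rewrite (_ : (fun p => _) = (fun p : C * R => \sum_j A p.1 p.2 i j * F p.1 p.2 j 0)).
  apply: (@measurable_sum _ _ _ _ _ _ (fun j (p : C * R) => A p.1 p.2 i j * F p.1 p.2 j 0)) => j.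
  exact: measurable_funM.
by apply/funext => p; rewrite mxE.
Qed.

Lemma joint_dot (F G : C -> R -> 'cV[R]_n) : joint_measurable F -> joint_measurable G ->
  measurable_fun (setT `*` `[0, T]) (fun p : C * R => dot (F p.1 p.2) (G p.1 p.2)).
Proof. by move=> mF mG; apply: measurable_dot. Qed.

Lemma joint_measurable_path (F : C -> R -> 'cV[R]_n) x : joint_measurable F ->
  measurable_path T (F x).
Proof.
move=> mF i.
exact: (@measurable_section _ _ _ _ _ _ _ (fun p : C * R => F p.1 p.2 i 0)).
Qed.

Lemma path_simple_measurable (h : C -> R -> 'cV[R]_n) J : path_simple h J ->
  measurable_fun setT J.
Proof.
elim=> [|a b i phi {}h {}J a0 ab bT mphi bphi ph IH]; first exact: measurable_cst.
apply: measurable_funD => //; apply: measurable_funM.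
  exact (measurableT_comp mphi (@measurable_eval_pathE R n T xinit T0 a)).
by apply: measurable_funB; exact: measurable_eval_path.
Qed.

Lemma measurable_vcoeff_inv (sigma : 'cV[R]_n -> R -> 'M[R]_n)
    (v : 'cV[R]_n -> R -> 'cV[R]_n) :
  (forall x s, 0 <= s <= T -> sigma x s \in unitmx) ->
  measurable_mcoeff T sigma -> measurable_vcoeff T v ->
  measurable_vcoeff T (fun x s => (invmx (sigma x s))^T *m v x s).
Proof.
move=> us ms mv i.
pose A (p : E * R) := sigma p.1 p.2.
have mI := @measurable_invmx _ (E * R)%type R (setT `*` `[0, T]) n A
  (fun p Dp => us p.1 p.2 (proj2 Dp)) ms.
rewrite /measurable_coeff (_ : (fun p => _) =
    (fun p : E * R => \sum_j invmx (A p) j i * v p.1 p.2 j 0)).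
  apply: (@measurable_sum _ _ _ _ _ _ (fun j (p : E * R) => invmx (A p) j i * v p.1 p.2 j 0)) => j.
  by apply: measurable_funM; [exact: mI|exact: mv].
by apply/funext => p; rewrite mxE; apply: eq_bigr => j _; rewrite mxE.
Qed.

End path_functionals.

(** * Ito integrals along the controlled process *)

Section identification.
Context {R : realType} {n : nat} {dO : measure_display} {Omega : measurableType dO}.
Variables (P : probability Omega R) (W : R -> Omega -> 'cV[R]_n) (T : R).
Hypothesis T0 : 0 < T.
Hypothesis BM : standard_brownian_motion P W T.
Variables (xinit : 'cV[R]_n).
Local Notation C := (path_space T xinit).
Local Notation mu := (@lebesgue_measure R).
Local Notation unit_vec i := (delta_mx i 0 : 'cV[R]_n).
Local Notation "h @@ Y" := (fun s w => h (eval_path (Y w) s) s) (at level 30).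

Variables (b u delta : 'cV[R]_n -> R -> 'cV[R]_n) (sigma : 'cV[R]_n -> R -> 'M[R]_n).
Hypotheses (mb : measurable_vcoeff T b) (ms : measurable_mcoeff T sigma).
Hypotheses (mu_ : measurable_vcoeff T u) (md : measurable_vcoeff T delta).
Hypothesis us : forall x s, 0 <= s <= T -> sigma x s \in unitmx.
Variables (X Y : {RV P >-> C}).
Hypothesis X_sol : strong_solution W b sigma X.
Hypothesis Y_sol : strong_solution W (controlled_drift b sigma u) sigma Y.
Hypothesis YX : distribution P Y `<< distribution P X.

(** Chosen so that [sigma^T psi = delta]: integrating [psi] against the path integrates [delta]
    against [dW], up to drift. *)
Let psi x s := (invmx (sigma x s))^T *m delta x s.

(* Approximating [psi] in this size approximates at once the integrals against
   [dW] of [sigma^T psi] and against [ds] of [psi . b] and [psi . (sigma u)]. *)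
Let N (v y : 'cV[R]_n) (s : R) : R := sqnorm ((sigma y s)^T *m v) +
  `|dot v (b y s)| + `|dot v (sigma y s *m u y s)|.

Let N_ge0 v y s : 0 <= N v y s.
Proof. by rewrite /N !addr_ge0// sqnorm_ge0. Qed.

Let ND v w y s : N (v + w) y s <= 2 * N v y s + 2 * N w y s.
Proof.
rewrite /N mulmxDr !dotDl.
have := sqnormD_le ((sigma y s)^T *m v) ((sigma y s)^T *m w).
have := ler_normD (dot v (b y s)) (dot w (b y s)).
have := ler_normD (dot v (sigma y s *m u y s)) (dot w (sigma y s *m u y s)).
have := normr_ge0 (dot v (b y s)); have := normr_ge0 (dot w (b y s)).
have := normr_ge0 (dot v (sigma y s *m u y s)).
have := normr_ge0 (dot w (sigma y s *m u y s)).
by move=> *; lra.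
Qed.

Let NZ (a : R) v y s : N (a *: v) y s <= (`|a| + a ^+ 2) * N v y s.
Proof.
rewrite /N -scalemxAr sqnormZ !dotZl !normrM.
have a0 := normr_ge0 a; have a2 := sqr_ge0 a.
have n1 := normr_ge0 (dot v (b y s)).
have n2 := normr_ge0 (dot v (sigma y s *m u y s)).
have n3 := sqnorm_ge0 ((sigma y s)^T *m v).
have p1 := mulr_ge0 a2 n1; have p2 := mulr_ge0 a2 n2; have p3 := mulr_ge0 a0 n3.
lra.
Qed.

Let joint_sigma i j :
  measurable_fun (setT `*` `[0, T]) (fun p : C * R => sigma (eval_path p.1 p.2) p.2 i j).
Proof. exact: (measurable_coeff_along T0 (@measurable_id _ C setT) (ms i j)). Qed.

Let joint_sigmaT i j :
  measurable_fun (setT `*` `[0, T]) (fun p : C * R => (sigma (eval_path p.1 p.2) p.2)^T i j).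
Proof.
rewrite (_ : (fun p => _) = (fun p : C * R => sigma (eval_path p.1 p.2) p.2 j i)) //.
by apply/funext => p; rewrite mxE.
Qed.

Let joint_su : joint_measurable
  (fun (x : C) s => sigma (eval_path x s) s *m u (eval_path x s) s).
Proof. by apply: joint_mulmx => //; exact: joint_vcoeff. Qed.

Let joint_b : joint_measurable (fun (x : C) s => b (eval_path x s) s).
Proof. exact: joint_vcoeff. Qed.

Let mpsi : measurable_vcoeff T psi.
Proof. exact: measurable_vcoeff_inv. Qed.

Let joint_N (F : C -> R -> 'cV[R]_n) : joint_measurable F ->
  measurable_fun (setT `*` `[0, T]) (fun p : C * R => N (F p.1 p.2) (eval_path p.1 p.2) p.2).
Proof.
move=> mF; rewrite /N.
have mS : joint_measurable (fun (x : C) s => (sigma (eval_path x s) s)^T *m F x s).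
  by apply: (joint_mulmx (A := fun (x : C) s => (sigma (eval_path x s) s)^T)).
apply: measurable_funD; first apply: measurable_funD.
- by rewrite /sqnorm; exact: (joint_dot mS mS).
- by apply: measurableT_comp => //; exact: (joint_dot mF joint_b).
- by apply: measurableT_comp => //; exact: (joint_dot mF joint_su).
Qed.

Lemma mulmx_sigma_psi x s : 0 <= s <= T -> (sigma x s)^T *m psi x s = delta x s.
Proof. by move=> sT; rewrite /psi mulmxA -trmx_mul mulVmx ?us// trmx1 mul1mx. Qed.

Lemma dot_psi x s v : 0 <= s <= T -> dot (psi x s) (sigma x s *m v) = dot (delta x s) v.
Proof. by move=> sT; rewrite -dot_trmx_mul mulmx_sigma_psi. Qed.

Variable G : C -> R.
Hypothesis mG : measurable_fun setT G.
Hypothesis itoG : ito_limit P W T (delta @@ X) (fun w => G (X w)).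
Hypothesis energy_u : {ae P, forall w, (energy T (fun s => u (eval_path (X w) s) s) < +oo)%E}.
Hypothesis int_psi : {ae P, forall w, mu.-integrable `[0, T]
  (fun s => (dot ((invmx (sigma (eval_path (X w) s) s))^T *m delta (eval_path (X w) s) s)
    (b (eval_path (X w) s) s))%:E)}.

Let ae_int (F : C -> R -> R) :
  measurable_fun (setT `*` `[0, T]) (fun p : C * R => F p.1 p.2) ->
  {ae P, forall w, mu.-integrable `[0, T] (fun s => (F (X w) s)%:E)} ->
  {ae distribution P X, forall x, mu.-integrable `[0, T] (fun s => (F x s)%:E)}.
Proof.
move=> mF; have mI := @measurable_integrable _ C R `[0, T]%classic _ ltac:(by []) mF.
exact: (ae_distribution (X := X) mI).
Qed.

Let transfer_int (F : C -> R -> R) :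
  measurable_fun (setT `*` `[0, T]) (fun p : C * R => F p.1 p.2) ->
  {ae P, forall w, mu.-integrable `[0, T] (fun s => (F (X w) s)%:E)} ->
  {ae P, forall w, mu.-integrable `[0, T] (fun s => (F (Y w) s)%:E)}.
Proof.
move=> mF; have mI := @measurable_integrable _ C R `[0, T]%classic _ ltac:(by []) mF.
exact: (ae_transfer YX mI).
Qed.

Let int_N (F : C -> R -> 'cV[R]_n) x : joint_measurable F ->
  (energy T (fun s => ((sigma (eval_path x s) s)^T *m F x s)%R) < +oo)%E ->
  mu.-integrable `[0, T] (fun s => (dot (F x s) (b (eval_path x s) s))%:E) ->
  mu.-integrable `[0, T]
    (fun s => (dot (F x s) (sigma (eval_path x s) s *m u (eval_path x s) s))%:E) ->
  mu.-integrable `[0, T] (fun s => (N (F x s) (eval_path x s) s)%:E).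
Proof.
move=> mF e1 i2 i3.
have mS : joint_measurable (fun (x : C) s => (sigma (eval_path x s) s)^T *m F x s).
  by apply: (joint_mulmx (A := fun (x : C) s => (sigma (eval_path x s) s)^T)).
have i1 := energy_integrable (joint_measurable_path x mS) e1.
have : mu.-integrable `[0, T] (fun s => (sqnorm ((sigma (eval_path x s) s)^T *m F x s))%:E +
    `|(dot (F x s) (b (eval_path x s) s))%:E| +
    `|(dot (F x s) (sigma (eval_path x s) s *m u (eval_path x s) s))%:E|)%E.
  apply: integrableD => //; last exact: integrable_abse i3.
  by apply: integrableD => //; exact: integrable_abse i2.
by [].
Qed.

Let energy_su : {ae P, forall w i,
  (energy T (fun s => (row i (sigma (eval_path (X w) s) s))^T) < +oo)%E}.
Proof.
have [_ _ itoX _] := X_sol.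
apply: filter_forall => i.
have /(itoX i)[I HI] : 0 <= T <= T by rewrite ltW/=.
apply: filterS (ito_limit_energy (ltW T0) (is_ito_limit BM (ltW T0) (lexx T) HI)) => w.
rewrite [ltLHS](_ : _ = energy T (fun s => (row i (sigma (eval_path (X w) s) s))^T))//.
by apply: eq_energy => s /andP[_ ->].
Qed.

Let N_unit_vec : {ae distribution P X, forall x, forall i, mu.-integrable `[0, T]
  (fun s => (N (unit_vec i) (eval_path x s) s)%:E)}.
Proof.
have [_ ibX _ _] := X_sol.
apply: filter_forall => i.
have mi : joint_measurable (fun (x : C) (s : R) => unit_vec i).
  by move=> j; exact: measurable_cst.
apply: (ae_int (F := fun x s => N (unit_vec i) (eval_path x s) s)); first exact: joint_N mi.
apply: filterS3 energy_su ibX energy_u => w ew ib eu.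
apply: (int_N (F := fun _ _ => unit_vec i) mi).
- rewrite [ltLHS](_ : _ = energy T (fun s => (row i (sigma (eval_path (X w) s) s))^T))//.
  by apply: eq_energy => s _; rewrite trmx_mul_unit_vec.
- apply: (@eq_integrable _ _ _ mu `[0, T]%classic _ (fun s => (b (eval_path (X w) s) s i 0)%:E)) => //.
  by move=> s _; rewrite dot_unit_vec.
- apply: (@eq_integrable _ _ _ mu `[0, T]%classic _
    (fun s => (dot (row i (sigma (eval_path (X w) s) s))^T (u (eval_path (X w) s) s))%:E)) => //.
    move=> s _; rewrite dot_unit_vec mxE; congr EFin; apply: eq_bigr => j _.
    by rewrite !mxE.
  apply: integrable_dot => //.
    have mr : joint_measurable (fun (x : C) s => (row i (sigma (eval_path x s) s))^T).
      move=> j; rewrite (_ : (fun p => _) = (fun p : C * R => sigma (eval_path p.1 p.2) p.2 i j))//.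
      by apply/funext => p; rewrite !mxE.
    exact: (joint_measurable_path (X w) mr).
  exact: (joint_measurable_path (X w) (joint_vcoeff T0 mu_)).
Qed.

Let joint_psi : joint_measurable (fun (x : C) s => psi (eval_path x s) s).
Proof. exact: joint_vcoeff. Qed.

Let energy_delta : {ae P, forall w, (energy T (fun s => delta (eval_path (X w) s) s) < +oo)%E}.
Proof. exact: ito_limit_energy (ltW T0) itoG. Qed.

Let int_du : {ae P, forall w, mu.-integrable `[0, T]
  (fun s => (dot (delta (eval_path (X w) s) s) (u (eval_path (X w) s) s))%:E)}.
Proof.
apply: filterS2 energy_delta energy_u => w ed eu; apply: integrable_dot => //.
  exact: (joint_measurable_path (X w) (joint_vcoeff T0 md)).
exact: (joint_measurable_path (X w) (joint_vcoeff T0 mu_)).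
Qed.

Let N_psi : {ae distribution P X, forall x, mu.-integrable `[0, T]
  (fun s => (N (psi (eval_path x s) s) (eval_path x s) s)%:E)}.
Proof.
apply: (ae_int (F := fun x s => N (psi (eval_path x s) s) (eval_path x s) s)).
  exact: joint_N joint_psi.
apply: filterS3 energy_delta int_psi int_du => w ed ip iu.
apply: (int_N (F := fun x s => psi (eval_path x s) s) joint_psi) => //.
- rewrite [ltLHS](_ : _ = energy T (fun s => delta (eval_path (X w) s) s))//.
  by apply: eq_energy => s sT; rewrite mulmx_sigma_psi.
- apply: (@eq_integrable _ _ _ mu `[0, T]%classic _
    (fun s => (dot (delta (eval_path (X w) s) s) (u (eval_path (X w) s) s))%:E)) => //.
  by move=> s; rewrite inE/= in_itv/= => sT; rewrite dot_psi.
Qed.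

(** Simple path functionals vanish at time 0; changing [psi] at this single time does not affect the
    gap. *)
Let cut (x : C) s := if 0 < s then psi (eval_path x s) s else 0.

Let gapE (h : C -> R -> 'cV[R]_n) x : joint_measurable h -> joint_measurable cut ->
  gap N h cut x = gap N h (fun x s => psi (eval_path x s) s) x.
Proof.
move=> mh mcut; rewrite /gap.
have mN F : joint_measurable F ->
    measurable_fun `]0, T]%classic (fun s => (N (h x s - F x s) (eval_path x s) s)%:E).
  move=> mF; apply/measurable_EFinP.
  apply: (measurable_funS (measurable_itv `[0, T])).
    by apply: subset_itv => //; rewrite bnd_simp.
  apply: (@measurable_section _ _ _ _ _ _ _
    (fun p : C * R => N (h p.1 p.2 - F p.1 p.2) (eval_path p.1 p.2) p.2)) => //.
  by apply: (joint_N (F := fun x s => h x s - F x s)); exact: joint_measurableB.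
rewrite -!integral_itv_obnd_cbnd; [|exact: mN joint_psi|exact: mN mcut].
by apply: eq_integral => s; rewrite inE/= in_itv/= /cut => /andP[-> _].
Qed.

(* The law of [Y] only weighs paths charged by the law of [X], so an Ito integral
   along [X] that is a limit of path functionals is so along [Y] as well. *)
Lemma ito_identification :
  ito_limit P W T (delta @@ Y) (fun w => G (Y w) -
    \int[mu]_(s in `[0, T]) dot (delta (eval_path (Y w) s) s) (u (eval_path (Y w) s) s)).
Proof.
have [mcut apx] := coeff_approximable T0 (m := distribution P X) N_ge0 ND NZ joint_N
  N_unit_vec mpsi N_psi.
have jd := @joint_vcoeff _ _ _ xinit T0 _ md; have ju := @joint_vcoeff _ _ _ xinit T0 _ mu_.
have jp := joint_psi.
apply: ito_limit_closed => [w|e e0].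
  exact: (joint_measurable_path (Y w) jd).
have e3 : 0 < e / 3 by rewrite divr_gt0.
(* The thresholds are chosen backwards: [e1] under the law of [X] guarantees [e / 3] under that of
   [Y], and energy below [m1] guarantees an integral within [e1]. A single [h] serves both laws. *)
have [e1 e10 He1] := null_dominates_small YX e3.
have [m1 m10 Hm] := ito_limit_small (ltW T0) BM e10.
have e20 : 0 < Num.min e1 m1 by rewrite lt_min e10.
have [h [J [hJ sgap]]] := apx _ e20.
have mh := path_simple_joint T0 hJ; have mJ := path_simple_measurable T0 hJ.
have [ihb lX] := solution_path_simple T0 BM X_sol hJ.
have [ihY lY] := solution_path_simple T0 BM Y_sol hJ.
pose hb (x : C) := \int[mu]_(s in `[0, T]) dot (h x s) (b (eval_path x s) s).
(* The error made along [X] by the martingale part of [h], written as a path functional so that it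
   can be evaluated along [Y]. *)
pose k (x : C) : \bar R := `|J x - hb x - G x|%:E.
pose gp := gap N h (fun (x : C) s => psi (eval_path x s) s).
have mhb : measurable_fun setT hb.
  exact: (@measurable_Rintegral_section _ C R `[0, T]%classic ltac:(by []) _
    (joint_dot mh joint_b)).
have mk : measurable_fun setT k.
  apply/measurable_EFinP; apply: measurableT_comp => //.
  by apply: measurable_funB => //; exact: measurable_funB.
have mgp : measurable_fun setT gp by exact: measurable_gap.
have sgp : small (distribution P X) (Num.min e1 m1) gp.
  by apply: small_trans sgap => // x; rewrite gapE.
have sgX : small P (Num.min e1 m1) (fun w => gp (X w)).
  exact: (small_distribution X _ mgp).2.
have le_gp (Z : {RV P >-> C}) w : (energy T (fun s =>
    ((sigma (eval_path (Z w) s) s)^T *m h (Z w) s - delta (eval_path (Z w) s) s)%R) <=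
    gp (Z w))%E.
  apply: ge0_le_integral => //.
  - by move=> s _; rewrite lee_fin sqnorm_ge0.
  - apply: measurable_sqnorm; apply: measurable_pathB.
      apply: (joint_measurable_path (F := fun (x : C) s => (sigma (eval_path x s) s)^T *m h x s)).
      by apply: (joint_mulmx (A := fun (x : C) s => (sigma (eval_path x s) s)^T)).
    exact: (joint_measurable_path (Z w) jd).
  - apply/measurable_EFinP; apply: (@measurable_section _ _ _ _ _ _ _ (fun p : C * R =>
      N (h p.1 p.2 - psi (eval_path p.1 p.2) p.2) (eval_path p.1 p.2) p.2)) => //.
    by apply: (joint_N (F := fun x s => h x s - psi (eval_path x s) s)); exact: joint_measurableB.
  - move=> s; rewrite /= in_itv/= => sT; rewrite lee_fin /N mulmxBr mulmx_sigma_psi//.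
    by rewrite -addrA lerDl addr_ge0.
have sk : small (distribution P X) e1 k.
  apply/(small_distribution X e1 mk).
  apply: (Hm _ _ (ito_limitB (ltW T0) lX itoG)).
  by apply: small_trans sgX => [|w]; [rewrite ge_min lexx orbT|exact: le_gp].
have skY : small P (e / 3) (fun w => k (Y w)).
  by apply/(small_distribution Y _ mk); exact: He1.
have sgY : small P (e / 3) (fun w => gp (Y w)).
  apply/(small_distribution Y _ mgp); apply: He1.
  by apply: small_trans sgp => //; rewrite ge_min lexx.
exists (fun s w => (sigma (eval_path (Y w) s) s)^T *m h (Y w) s); eexists; split; first exact: lY.
  by apply: small_trans sgY => [|w]; [lra|exact: le_gp].
apply: small_trans_ae (smallD skY sgY); first by lra.
have ihbY := transfer_int (F := fun x s => dot (h x s) (b (eval_path x s) s))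
  (joint_dot mh joint_b) ihb.
have iduY := transfer_int (F := fun x s => dot (delta (eval_path x s) s) (u (eval_path x s) s))
  (joint_dot jd ju) int_du.
apply: filterS3 ihY ihbY iduY => w i1 i2 i3.
have i4 : mu.-integrable `[0, T] (EFin \o (fun s =>
    dot (h (Y w) s) (sigma (eval_path (Y w) s) s *m u (eval_path (Y w) s) s))).
  apply: (@eq_integrable _ _ _ mu `[0, T]%classic _ _ _ _ (integrableB _ i1 i2)) => // s _.
  by rewrite /= /controlled_drift dotDr -EFinB addrAC subrr add0r.
rewrite [X in J _ - X](_ : _ = hb (Y w) + \int[mu]_(s in `[0, T])
    dot (h (Y w) s) (sigma (eval_path (Y w) s) s *m u (eval_path (Y w) s) s)); last first.
  rewrite -RintegralD//; apply: eq_Rintegral => s _.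
  by rewrite /controlled_drift dotDr.
(* With the common drift [b] absorbed in [hb], the error along [Y] is that of [k] plus [A - B],
   which the third term of [N] bounds by the gap. *)
set A := \int[mu]_(s in _) dot (delta _ _) _; set B := \int[mu]_(s in _) dot (h _ _) _.
rewrite (_ : _ - (_ - A) = (J (Y w) - hb (Y w) - G (Y w)) + (A - B)); last by ring.
rewrite (le_trans (_ : _ <= k (Y w) + `|A - B|%:E)%E)//.
  by rewrite /k -EFinD lee_fin ler_normD.
rewrite leeD2l//.
rewrite /A /B -RintegralB// EFin_normr_Rintegral//; last first.
  exact: (integrableB _ i3 i4).
have /integrableP[mdiff _] : mu.-integrable `[0, T] (fun s =>
    (dot (delta (eval_path (Y w) s) s) (u (eval_path (Y w) s) s))%:E -
    (dot (h (Y w) s) (sigma (eval_path (Y w) s) s *m u (eval_path (Y w) s) s))%:E)%E.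
  exact: integrableB.
apply: le_trans (le_abse_integral _ _ _) _ => //.
apply: ge0_le_integral => //.
- exact: measurableT_comp.
- apply/measurable_EFinP; apply: (@measurable_section _ _ _ _ _ _ _ (fun p : C * R =>
    N (h p.1 p.2 - psi (eval_path p.1 p.2) p.2) (eval_path p.1 p.2) p.2)) => //.
  by apply: (joint_N (F := fun x s => h x s - psi (eval_path x s) s)); exact: joint_measurableB.
- move=> s; rewrite /= in_itv/= => sT; rewrite lee_fin -dot_psi// distrC -dotNl -dotDl.
  by rewrite /N lerDr addr_ge0// sqnorm_ge0.
Qed.

End identification.

(** * Densities of path laws *)

Section law_density.
Context {R : realType} {n : nat} {dO : measure_display} {Omega : measurableType dO}.
Variables (P : probability Omega R) (T : R) (xinit : 'cV[R]_n).
Local Notation C := (path_space T xinit).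

Section change.
Variables X Y : {RV P >-> C}.
Hypothesis YX : distribution P Y `<< distribution P X.
Local Notation rn := (Radon_Nikodym_SigmaFinite.f (distribution P Y) (distribution P X)).

Lemma measurable_law_density : measurable_fun setT (law_density Y X).
Proof.
apply: (measurableT_comp (fine_measurable measurableT)).
exact: measurable_int (Radon_Nikodym_integrable _).
Qed.

(** [law_density] is built on the derivative of a charge, while the change of variables uses a
    version that is nonnegative and finite everywhere; the two agree almost everywhere. *)
Lemma ae_law_density : {ae distribution P X, forall x, rn x = (law_density Y X x)%:E}.
Proof.
have := ae_eq_Radon_Nikodym_SigmaFinite YX measurableT.
apply: filterS => x /(_ I) E; rewrite /law_density -E fineK//.
exact: Radon_Nikodym_SigmaFinite.f_fin_num.
Qed.

Lemma law_density_change (k : C -> \bar R) : measurable_fun setT k ->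
  (forall x, (0 <= k x)%E) ->
  (\int[P]_w k (Y w) = \int[P]_w (k (X w) * (law_density Y X (X w))%:E))%E.
Proof.
move=> mk k0.
have mrn : measurable_fun setT rn.
  exact: measurable_int (Radon_Nikodym_SigmaFinite.f_integrable _).
transitivity (\int[distribution P Y]_x k x)%E.
  by rewrite ge0_integral_distribution.
rewrite -(Radon_Nikodym_SigmaFinite.change_of_variables YX)//.
rewrite ge0_integral_distribution//=; last 2 first.
- exact: emeasurable_funM.
- by move=> x; rewrite mule_ge0//; exact: Radon_Nikodym_SigmaFinite.f_ge0.
apply: ae_eq_integral => //.
- apply: (@measurableT_comp _ _ _ _ _ _ (fun x => k x * rn x)%E) => //.
  exact: emeasurable_funM.
- apply: (@measurableT_comp _ _ _ _ _ _ (fun x => k x * (law_density Y X x)%:E)%E) => //.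
  by apply: emeasurable_funM => //; apply/measurable_EFinP; exact: measurable_law_density.
by apply: filterS (distribution_ae ae_law_density) => w /= ->.
Qed.

End change.

(** Chain rule: over any event, the product of the two derivatives and the constant 1 have the same
    integral against the law of [X]. *)
Lemma law_densityK (X Y : {RV P >-> C}) : distribution P Y `<< distribution P X ->
  distribution P X `<< distribution P Y ->
  {ae P, forall w, law_density X Y (X w) * law_density Y X (X w) = 1}.
Proof.
move=> YX XY.
pose f := Radon_Nikodym_SigmaFinite.f (distribution P Y) (distribution P X).
pose h := Radon_Nikodym_SigmaFinite.f (distribution P X) (distribution P Y).
have mf : measurable_fun setT f.
  exact: measurable_int (Radon_Nikodym_SigmaFinite.f_integrable _).
have mh : measurable_fun setT h.
  exact: measurable_int (Radon_Nikodym_SigmaFinite.f_integrable _).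
have hf : ae_eq (distribution P X) setT (cst 1%E) (fun x => h x * f x)%E.
  apply: integral_ae_eq => //.
  - exact: finite_measure_integrable_cst.
  - exact: emeasurable_funM.
  move=> A _ mA; rewrite integral_cst// mul1e.
  apply: (etrans (Radon_Nikodym_SigmaFinite.f_integral XY mA)).
  apply/esym/(Radon_Nikodym_SigmaFinite.change_of_variables YX) => //.
  - exact: Radon_Nikodym_SigmaFinite.f_ge0.
  - exact: measurable_funTS.
have hX : {ae distribution P X, forall x, h x = (law_density X Y x)%:E}.
  have [B [mB B0 BA]] := ae_law_density XY; exists B; split => //.
  exact: ((null_content_dominatesP _ _).1 XY).
apply: (distribution_ae (A := [set x | law_density X Y x * law_density Y X x = 1])).
apply: filterS3 hf hX (ae_law_density YX) => x /(_ I).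
rewrite -/(f x) => E hx fx; move: E; rewrite hx fx => E.
by apply: EFin_inj; rewrite EFinM -E.
Qed.

End law_density.

(** * Girsanov densities as path functionals *)

Section girsanov.
Context {R : realType} {n : nat} {dO : measure_display} {Omega : measurableType dO}.
Variables (P : probability Omega R) (W : R -> Omega -> 'cV[R]_n) (T : R).
Hypothesis T0 : 0 < T.
Hypothesis BM : standard_brownian_motion P W T.
Variables (xinit : 'cV[R]_n).
Local Notation C := (path_space T xinit).
Local Notation mu := (@lebesgue_measure R).
Variables (b v : 'cV[R]_n -> R -> 'cV[R]_n) (sigma : 'cV[R]_n -> R -> 'M[R]_n).
Hypothesis us : forall x s, 0 <= s <= T -> sigma x s \in unitmx.
Variables X Xv : {RV P >-> C}.
Hypothesis gir : girsanov_density W b sigma v X Xv.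

Definition cost (x : C) : R := \int[mu]_(s in `[0, T]) sqnorm (v (eval_path x s) s).

(* By Girsanov, the Ito integral of the control along X, as a path functional. *)
Definition control_integral (x : C) : R := ln (law_density Xv X x) + 2^-1 * cost x.

Lemma girsanov_integrable : {ae P, forall w, mu.-integrable `[0, T]
  (fun s => (dot ((invmx (sigma (eval_path (X w) s) s))^T *m v (eval_path (X w) s) s)
    (b (eval_path (X w) s) s))%:E)}.
Proof.
have [[ib _] _] := gir; apply: filterS ib => w.
by apply: eq_integrable => // s _; rewrite /= trmx_mul trmxK.
Qed.

(** The drift part of the integral against [dX] is the very integral that the Girsanov exponent
    subtracts. What remains is the Ito integral of $\sigma^\top\sigma^{-\top} v = v$. *)
Lemma girsanov_ito :
  ito_limit P W T (fun s w => v (eval_path (X w) s) s) (fun w => control_integral (X w)) /\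
  {ae P, forall w, law_density Xv X (X w) = expR (control_integral (X w) - 2^-1 * cost (X w))}.
Proof.
have [[_ [I HI]] dens] := gir.
set H := fun s w => _ in HI.
have {}HI : is_ito P W T H (ito P W T H) by exact: (xgetPex (fun=> 0) (ex_intro _ I HI)).
have lH := is_ito_limit BM (ltW T0) (lexx T) HI.
have E : {ae P, forall w, law_density Xv X (X w) =
    expR (ito P W T H w - 2^-1 * cost (X w))}.
  apply: filterS dens => w; rewrite /ito_process_integral => {lH HI} dw.
  rewrite dw -/(cost (X w)).
  under eq_Rintegral do rewrite trmx_mul trmxK dot_trmx_mul dotC.
  by rewrite [_ + ito _ _ _ _ _ - _]addrAC subrr add0r.
split; last first.
  by apply: filterS E => w Ew; rewrite /control_integral addrK lnK ?Ew ?posrE ?expR_gt0.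
apply: ito_limit_ae.
  apply: filterS E => w Ew; rewrite /control_integral Ew expRK subrK; exact: erefl.
apply: eq_ito_limit lH => s w sT; have /andP[_ ->] := sT.
by rewrite /H trmx_mul trmxK mulmxA -trmx_mul mulVmx ?us// trmx1 mul1mx.
Qed.

Hypothesis mv : measurable_vcoeff T v.
Hypothesis XvX : distribution P Xv `<< distribution P X.

Lemma measurable_cost : measurable_fun setT cost.
Proof.
have mj := @joint_vcoeff _ _ _ xinit T0 _ mv.
exact: (@measurable_Rintegral_section _ C R `[0, T]%classic ltac:(by []) _ (joint_dot mj mj)).
Qed.

Lemma measurable_control_integral : measurable_fun setT control_integral.
Proof.
apply: measurable_funD.
  by apply: measurableT_comp => //; exact: measurable_law_density.
by apply: measurable_funM => //; exact: measurable_cost.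
Qed.

End girsanov.

Lemma Rintegral_sqnormD (R : realType) n (T : R) (h k : R -> 'cV[R]_n) (a : R) :
  measurable_path T h -> measurable_path T k ->
  (energy T h < +oo)%E -> (energy T k < +oo)%E ->
  \int[lebesgue_measure]_(s in `[0, T]) sqnorm (h s + a *: k s) =
  \int[lebesgue_measure]_(s in `[0, T]) sqnorm (h s) +
  2 * a * \int[lebesgue_measure]_(s in `[0, T]) dot (k s) (h s) +
  a ^+ 2 * \int[lebesgue_measure]_(s in `[0, T]) sqnorm (k s).
Proof.
move=> mh mk eh ek.
have ih := energy_integrable mh eh; have ik := energy_integrable mk ek.
have ikh := integrable_dot mk mh ek eh.
have iZ (c : R) (f : R -> R) : lebesgue_measure.-integrable `[0, T] (EFin \o f) ->
    lebesgue_measure.-integrable `[0, T] (EFin \o (fun s => c * f s)).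
  move=> If; have := @integrableZl _ _ _ (@lebesgue_measure R) `[0, T]%classic ltac:(by []) c _ If.
  by apply: eq_integrable.
rewrite -!RintegralZl// -RintegralD//; last exact: iZ.
rewrite -RintegralD//; last 2 first.
- exact: (integrableD _ ih (iZ _ _ ikh)).
- exact: iZ.
apply: eq_Rintegral => s _.
rewrite /sqnorm dotDl !dotDr !dotZl !dotZr (dotC (h s) (k s)); ring.
Qed.

Lemma measurable_expeR (R : realType) : measurable_fun setT (@expeR R).
Proof.
have mE (c : \bar R) : measurable_fun setT (fun x => x == c).
  apply: (measurable_fun_bool true).
  rewrite setTI (_ : _ @^-1` _ = [set c]); first exact: emeasurable_set1.
  by apply/seteqP; split => x /= /eqP.
rewrite (_ : expeR = fun x => if x == +oo%E then +oo%E else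
    if x == -oo%E then 0%E else (expR (fine x))%:E); last first.
  by apply/funext => -[].
apply: measurable_fun_ifT => //; apply: measurable_fun_ifT => //.
apply/measurable_EFinP; apply: measurableT_comp => //.
Qed.

Lemma measurable_eq_set d (S : measurableType d) (R : realType) (f g : S -> R) :
  measurable_fun setT f -> measurable_fun setT g -> measurable [set x | f x = g x].
Proof.
move=> mf mg.
rewrite (_ : [set x | _] = (fun x => f x - g x) @^-1` [set 0]).
  by rewrite -[X in measurable X]setTI; apply: measurable_funB.
by apply/seteqP; split => x /= => [->|/eqP]; rewrite ?subrr// subr_eq0 => /eqP.
Qed.

(** The second moment of [q] may be infinite, so the expansion of the square is carried out in the
    extended reals; only the first moment is used as a finite number. *)
Lemma variance_scaled d (S : measurableType d) (R : realType) (P : probability S R)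
    (xi q : S -> R) (Z : R) : measurable_fun setT xi -> measurable_fun setT q ->
  (forall w, 0 <= q w) -> {ae P, forall w, xi w = Z * q w} ->
  (\int[P]_w (q w)%:E = 1)%E ->
  variance P xi = ((Z ^+ 2)%:E * (\int[P]_w (q w ^+ 2)%:E - 1))%E.
Proof.
move=> mxi mq q0 xiq q1.
have iq : P.-integrable setT (EFin \o q).
  apply/integrableP; split; first exact/measurable_EFinP.
  rewrite [ltLHS](_ : _ = 1%E) ?ltry// -q1; apply: eq_integral => w _.
  by rewrite /= ger0_norm.
have Exi : 'E_P[xi]%E = Z%:E.
  rewrite unlock; transitivity (\int[P]_w (Z%:E * (q w)%:E))%E.
    apply: ae_eq_integral => //.
      by apply/measurable_EFinP; exact: mxi.
      by apply: measurable_funeM; exact/measurable_EFinP.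
    by apply: filterS xiq => w -> _; rewrite EFinM.
  by rewrite integralZl// q1 mule1.
have mq1 : measurable_fun setT (fun w => (q w - 1) ^+ 2).
  by apply: measurable_funX; exact: measurable_funB.
have mq2 : measurable_fun setT (fun w => q w ^+ 2) by exact: measurable_funX.
have -> : variance P xi = ((Z ^+ 2)%:E * \int[P]_w ((q w - 1) ^+ 2)%:E)%E.
  rewrite -ge0_integralZl_EFin ?sqr_ge0//; last 2 first.
  - by move=> w _; rewrite lee_fin sqr_ge0.
  - exact/measurable_EFinP.
  rewrite /variance unlock Exi unlock; apply: ae_eq_integral => //.
  - apply/measurable_EFinP; apply: measurable_funM; exact: measurable_funB.
  - by apply: measurable_funeM; exact/measurable_EFinP.
  - apply: filterS xiq => w xw _; rewrite -EFinM; congr EFin.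
    change ((xi w - Z) * (xi w - Z) = Z ^+ 2 * (q w - 1) ^+ 2); rewrite xw; ring.
congr (_ * _)%E.
(* From $(q - 1)^2 + 2q = q^2 + 1$: all terms are nonnegative, so both sides integrate termwise
   without a subtraction. *)
have : (\int[P]_w ((q w - 1) ^+ 2)%:E + 2%:E = \int[P]_w (q w ^+ 2)%:E + 1)%E.
  have -> : 2%:E = (\int[P]_w (2 * q w)%:E)%E :> \bar R.
    under eq_integral do rewrite EFinM.
    by rewrite integralZl// q1 mule1.
  have -> : 1%E = (\int[P]_w cst 1 w)%E :> \bar R.
    by rewrite integral_cst//= probability_setT mule1.
  rewrite -!ge0_integralD//.
  - by apply: eq_integral => w _; rewrite -!EFinD; congr EFin; rewrite /=; ring.
  - by move=> w _; rewrite lee_fin sqr_ge0.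
  - exact/measurable_EFinP.
  - by move=> w _; rewrite lee_fin sqr_ge0.
  - exact/measurable_EFinP.
  - by move=> w _; rewrite lee_fin mulr_ge0.
  - by apply/measurable_EFinP; exact: measurable_funM.
case: (\int[P]_w ((q w - 1) ^+ 2)%:E)%E => [a||];
  case: (\int[P]_w (q w ^+ 2)%:E)%E => [c||] //= -[ac].
by congr EFin; lra.
Qed.

(** * The relative error as a second moment *)

Section relative_error.
Context {R : realType} {n : nat} {dO : measure_display} {Omega : measurableType dO}.
Variables (P : probability Omega R) (T : R) (xinit : 'cV[R]_n).
Hypothesis T0 : 0 < T.
Local Notation C := (path_space T xinit).
Variables (f : 'cV[R]_n -> R -> R) (g : 'cV[R]_n -> R).
Hypothesis f_meas : measurable_coeff T f.
Hypothesis g_meas : measurable_fun setT (g : g_sigma_algebraType coordinate_sets -> R).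

Lemma measurable_work : measurable_fun setT (work f g : C -> R).
Proof.
apply: measurable_funD.
  exact: (@measurable_Rintegral_section _ C R `[0, T]%classic ltac:(by []) _
    (measurable_coeff_along T0 (@measurable_id _ C setT) f_meas)).
exact (measurableT_comp g_meas (@measurable_eval_pathE R n T xinit T0 T)).
Qed.

Variables X Xu Xs : {RV P >-> C}.
Hypotheses (uX : distribution P Xu `<< distribution P X)
  (Xu_X : distribution P X `<< distribution P Xu)
  (sX : distribution P Xs `<< distribution P X).
Variables eu es : C -> R.
Hypotheses (meu : measurable_fun setT eu) (mes : measurable_fun setT es).
Hypothesis dens_u : {ae P, forall w, law_density Xu X (X w) = expR (eu (X w))}.
Hypothesis dens_s : {ae P, forall w, law_density Xs X (X w) = expR (es (X w))}.
Local Notation Z := (normalizing_constant f g X).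
Hypothesis opt : forall A : set C, measurable A ->
  distribution P Xs A = optimal_measure f g X A.

Let mweight : measurable_fun setT (fun x : C => expR (- work f g x) / Z).
Proof.
apply: measurable_funM => //; apply: measurableT_comp => //.
by apply: measurableT_comp => //; exact: measurable_work.
Qed.

(** If [Z] were 0, the convention for division by 0 would make the optimal measure vanish, although
    it is the law of [Xs] and has mass 1. *)
Lemma normalizing_constant_gt0 : 0 < Z.
Proof.
rewrite lt_neqAle; apply/andP; split; last first.
  by apply: fine_ge0; apply: expectation_ge0 => w; exact: expR_ge0.
apply/eqP => Z0; have := opt measurableT.
rewrite probability_setT /optimal_measure -Z0.
under eq_integral do rewrite invr0 mulr0.
by rewrite integral0 => -[] /eqP; rewrite oner_eq0.
Qed.

Lemma optimal_density : {ae P, forall w,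
  law_density Xs X (X w) = expR (- work f g (X w)) / Z}.
Proof.
pose h := Radon_Nikodym_SigmaFinite.f (distribution P Xs) (distribution P X).
have hE : ae_eq (distribution P X) setT h (fun x => (expR (- work f g x) / Z)%:E).
  apply: integral_ae_eq => //.
  - exact: Radon_Nikodym_SigmaFinite.f_integrable.
  - exact/measurable_EFinP.
  - move=> A _ mA; rewrite -(Radon_Nikodym_SigmaFinite.f_integral sX mA).
    exact: opt.
apply: (distribution_ae (A := [set x | law_density Xs X x = expR (- work f g x) / Z])).
apply: filterS2 hE (ae_law_density sX) => x /(_ I).
by rewrite -/(h x) => -> [].
Qed.

(** [eu] and [es] are logarithmic densities as path functionals, so the weight along [Xu] is [Z]
    times their exponential ratio, and [variance_scaled] applies. The factor [Z] cancels against the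
    normalization of the error. *)
Lemma relative_error_ratio : relative_error f g X Xu =
  sqrte (\int[P]_w (expR (es (Xu w) - eu (Xu w)) ^+ 2)%:E - 1)%E.
Proof.
have Z0 := normalizing_constant_gt0.
have mX : measurable_fun setT (X : Omega -> C) by exact: measurable_funP.
pose q w := expR (es (Xu w) - eu (Xu w)).
have mq' : measurable_fun setT (fun x : C => expR (es x - eu x)).
  by apply: measurableT_comp => //; exact: measurable_funB.
have mq : measurable_fun setT q by exact: (measurableT_comp mq').
(* Moved to [X], the ratio times the density of [Xu] is the density of [Xs], of total mass 1. *)
have q1 : (\int[P]_w (q w)%:E = 1)%E.
  rewrite (law_density_change uX (k := fun x => (expR (es x - eu x))%:E)); first last.
  - by move=> x; rewrite lee_fin expR_ge0.
  - exact/measurable_EFinP.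
  have -> : 1%E = (\int[P]_w cst 1 (Xs w))%E :> \bar R.
    by rewrite integral_cst//= probability_setT mule1.
  rewrite (law_density_change sX (k := cst 1%E))//.
  have m1 : measurable_fun setT (fun x => (expR (es x - eu x))%:E * (law_density Xu X x)%:E)%E.
    by apply: emeasurable_funM; apply/measurable_EFinP => //; exact: measurable_law_density.
  have m2 : measurable_fun setT (fun x => cst 1 x * (law_density Xs X x)%:E)%E.
    by apply: emeasurable_funM => //; apply/measurable_EFinP; exact: measurable_law_density.
  apply: ae_eq_integral => //.
  - exact (measurableT_comp m1 mX).
  - exact (measurableT_comp m2 mX).
  apply: filterS2 dens_u dens_s => w -> -> _.
  by rewrite mul1e -EFinM -expRD subrK.
rewrite /relative_error (variance_scaled (Z := Z) (q := q))//.
- rewrite sqrteM ?lee_fin ?sqr_ge0// muleA [X in (X * _)%E](_ : _ = 1%E) ?mul1e//.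
  by rewrite /= sqrtr_sqr gtr0_norm// -EFinM mulVf// gt_eqF.
- apply: measurable_funM.
    apply: (measurableT_comp (f := fun x : C => expR (- work f g x))) => //.
    by apply: measurableT_comp => //; apply: measurableT_comp => //; exact: measurable_work.
  apply: (measurableT_comp (f := law_density X Xu)) => //.
  exact: measurable_law_density.
- by move=> w; rewrite expR_ge0.
(* The density identities are known along [X]; as equalities between measurable path functionals
   they also hold along [Xu]. *)
have m3 : measurable [set x : C | expR (- work f g x) / Z = expR (es x)].
  by apply: measurable_eq_set => //; exact: measurableT_comp.
have m4 : measurable [set x : C | law_density Xu X x = expR (eu x)].
  by apply: measurable_eq_set; [exact: measurable_law_density|exact: measurableT_comp].
have e3 : {ae P, forall w, expR (- work f g (Xu w)) / Z = expR (es (Xu w))}.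
  apply: (ae_transfer uX m3).
  by apply: filterS2 optimal_density dens_s => w /= <-.
have e4 := ae_transfer uX m4 dens_u.
apply: filterS3 e3 e4 (law_densityK Xu_X uX) => w e3w -> /= e5.
have -> : expR (- work f g (Xu w)) = Z * expR (es (Xu w)).
  by rewrite -e3w mulrCA divff ?mulr1// gt_eqF.
rewrite -mulrA; congr (_ * _); rewrite /q expRD expRN; congr (_ * _).
by rewrite -[RHS]mulr1 -e5 mulKf// gt_eqF ?expR_gt0.
Qed.

End relative_error.

(** * The two formulas for the relative error *)

Lemma measurable_energy (R : realType) n (T : R) (xinit : 'cV[R]_n)
    (F : path_space T xinit -> R -> 'cV[R]_n) : joint_measurable F ->
  measurable_fun setT (fun x => energy T (F x)).
Proof.
move=> mF; apply: (@measurable_integral_section _ (path_space T xinit) R `[0, T]%classic _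
  (fun p => (sqnorm (F p.1 p.2))%:E)) => //.
- by apply/measurable_EFinP; exact: (joint_dot mF mF).
- by move=> p; rewrite lee_fin sqnorm_ge0.
Qed.

Theorem proposition3p3 (R : realType) (d : nat)
  (dO : measure_display) (Omega : measurableType dO) (P : probability Omega R)
  (W : R -> Omega -> 'cV[R]_d) (T : R) (xinit : 'cV[R]_d)
  (b : 'cV[R]_d -> R -> 'cV[R]_d) (sigma : 'cV[R]_d -> R -> 'M[R]_d)
  (f : 'cV[R]_d -> R -> R) (g : 'cV[R]_d -> R)
  (X : {RV P >-> path_space T xinit})
  (u ustar : 'cV[R]_d -> R -> 'cV[R]_d)
  (Xu Xustar Xu2 : {RV P >-> path_space T xinit})
  (* delta, the difference between the optimal and the given control *)
  (delta := fun (x : 'cV[R]_d) (s : R) => ustar x s - u x s)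
  (u2 := fun (x : 'cV[R]_d) (s : R) => u x s + 2 *: delta x s)
  (T_gt0 : 0 < T)
  (W_brownian : standard_brownian_motion P W T)
  (b_meas : measurable_vcoeff T b)
  (sigma_meas : measurable_mcoeff T sigma)
  (sigma_inv : forall x s, 0 <= s <= T -> sigma x s \in unitmx)
  (f_meas : measurable_coeff T f)
  (g_meas : measurable_fun setT (g : g_sigma_algebraType coordinate_sets -> R))
  (well_posed : unique_strong_solution P W T xinit b sigma)
  (X_sol : strong_solution W b sigma X)
  (work_defined : {ae P, forall w, lebesgue_measure.-integrable `[0, T]
     (fun s : R => (f (eval_path (X w) s) s)%:E)})
  (Z_fin : 'E_P[(fun w => expR (- work f g (X w)))]%E \is a fin_num)
  (u_adm : admissible W b sigma X u)
  (Xu_sol : strong_solution W (controlled_drift b sigma u) sigma Xu)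
  (ustar_adm : admissible W b sigma X ustar)
  (Xustar_sol : strong_solution W (controlled_drift b sigma ustar) sigma Xustar)
  (ustar_opt : forall A : set (path_space T xinit), measurable A ->
     distribution P Xustar A = optimal_measure f g X A)
  (u2_adm : admissible W b sigma X u2)
  (Xu2_sol : strong_solution W (controlled_drift b sigma u2) sigma Xu2) :
  relative_error f g X Xu =
    sqrte (\int[P]_w
      expeR (- (\int[lebesgue_measure]_(s in `[0%R, T])
                  (sqnorm (delta (eval_path (Xu w) s) s))%:E)
             + (2 * ito P W T (fun s w => delta (eval_path (Xu w) s) s) w)%:E)
      - 1)%E
  /\
  relative_error f g X Xu =
    sqrte (\int[P]_w
      expeR (\int[lebesgue_measure]_(s in `[0%R, T])
               (sqnorm (delta (eval_path (Xu2 w) s) s))%:E)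
      - 1)%E.
Proof.
have T0 := ltW T_gt0.
have [mu_ _ /(_ _ Xu_sol)[uX Xu_X gu]] := u_adm.
have [ms _ /(_ _ Xustar_sol)[sX _ gs]] := ustar_adm.
have [m2 _ /(_ _ Xu2_sol)[X2_X _ g2]] := u2_adm.
have md : measurable_vcoeff T delta.
  move=> i; rewrite /measurable_coeff /delta.
  rewrite (_ : (fun p => _) = (fun p : g_sigma_algebraType coordinate_sets * R =>
    ustar p.1 p.2 i 0 - u p.1 p.2 i 0)); last by apply/funext => p; rewrite !mxE.
  by apply: measurable_funB; [exact: ms|exact: mu_].
(* The logarithmic density, split into Ito part and cost so that each can be expanded in [delta]. *)
pose e v (Xv : {RV P >-> path_space T xinit}) x := control_integral v X Xv x - 2^-1 * cost v x.
have me v Xv : measurable_vcoeff T v -> distribution P Xv `<< distribution P X ->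
    measurable_fun setT (e v Xv).
  move=> mv XvX; apply: measurable_funB; first exact: measurable_control_integral.
  by apply: measurable_funM => //; exact: measurable_cost.
have [lu du] := girsanov_ito T_gt0 W_brownian sigma_inv gu.
have [ls ds] := girsanov_ito T_gt0 W_brownian sigma_inv gs.
have [l2 d2] := girsanov_ito T_gt0 W_brownian sigma_inv g2.
have ld := ito_limitB T0 ls lu.
have nu := ito_limit_energy T0 lu; have nd := ito_limit_energy T0 ld.
have mju := @joint_vcoeff _ _ _ xinit T_gt0 _ mu_.
have mjd := @joint_vcoeff _ _ _ xinit T_gt0 _ md.
pose B (x : path_space T xinit) := \int[lebesgue_measure]_(s in `[0, T])
  dot (delta (eval_path x s) s) (u (eval_path x s) s).
(* Used with [a = 1] for [ustar] and [a = 2] for [u2]; the finite energies make each term of the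
   expansion integrable. *)
have costD x (a : R) (v : 'cV[R]_d -> R -> 'cV[R]_d) :
    (forall y s, v y s = u y s + a *: delta y s) ->
    (energy T (fun s => u (eval_path x s) s) < +oo)%E ->
    (energy T (fun s => delta (eval_path x s) s) < +oo)%E ->
    cost v x = cost u x + 2 * a * B x + a ^+ 2 * cost delta x.
  move=> vE eu ed; rewrite /cost; under eq_Rintegral do rewrite vE.
  apply: Rintegral_sqnormD => //.
    exact: (joint_measurable_path x mju).
  exact: (joint_measurable_path x mjd).
have ustarE y s : ustar y s = u y s + 1 *: delta y s.
  by apply/matrixP => i j; rewrite !mxE; ring.
(* The formulas integrate in the extended reals, the densities in the reals; the two agree where the
   energy is finite, hence almost surely. *)
have costE (x : path_space T xinit) :
    (energy T (fun s => delta (eval_path x s) s) < +oo)%E ->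
    energy T (fun s => delta (eval_path x s) s) = (cost delta x)%:E.
  move=> ed; have nfin : energy T (fun s => delta (eval_path x s) s) \is a fin_num.
    by rewrite ge0_fin_numE// energy_ge0.
  exact: esym (fineK nfin).
pose q x := expR (e ustar Xustar x - e u Xu x).
have mq : measurable_fun setT q.
  by apply: measurableT_comp => //; apply: measurable_funB; exact: me.
have mq2 : measurable_fun setT (fun x => (q x ^+ 2)%:E).
  by apply/measurable_EFinP; exact: measurable_funX.
have mXu : measurable_fun setT (Xu : Omega -> path_space T xinit) by exact: measurable_funP.
have mX : measurable_fun setT (X : Omega -> path_space T xinit) by exact: measurable_funP.
have mEd := measurable_energy mjd.
rewrite (relative_error_ratio T_gt0 f_meas g_meas uX Xu_X sX (me _ _ mu_ uX)
  (me _ _ ms sX) du ds ustar_opt).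
split; congr (sqrte (_ - 1))%E.
- have ipsi : {ae P, forall w, lebesgue_measure.-integrable `[0, T]
      (fun s => (dot ((invmx (sigma (eval_path (X w) s) s))^T *m delta (eval_path (X w) s) s)
        (b (eval_path (X w) s) s))%:E)}.
    apply: filterS2 (girsanov_integrable gs) (girsanov_integrable gu) => w is_ iu.
    apply: (@eq_integrable _ _ _ (@lebesgue_measure R) `[0, T]%classic _ (fun s =>
      (dot ((invmx (sigma (eval_path (X w) s) s))^T *m ustar (eval_path (X w) s) s)
        (b (eval_path (X w) s) s))%:E -
      (dot ((invmx (sigma (eval_path (X w) s) s))^T *m u (eval_path (X w) s) s)
        (b (eval_path (X w) s) s))%:E)%E) => //; last exact: integrableB.
    by move=> s _; rewrite /delta mulmxBr dotDl dotNl EFinB.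
  pose G (x : path_space T xinit) := control_integral ustar X Xustar x - control_integral u X Xu x.
  have mG : measurable_fun setT G by apply: measurable_funB; exact: measurable_control_integral.
  have lY := ito_identification T_gt0 W_brownian b_meas sigma_meas mu_ md sigma_inv
    X_sol Xu_sol uX mG ld nu ipsi.
  have mI : measurable_fun setT (fun w => G (Xu w) - B (Xu w)).
    apply: (measurableT_comp (f := fun x => G x - B x)) => //.
    apply: measurable_funB => //.
    exact: (@measurable_Rintegral_section _ (path_space T xinit) R `[0, T]%classic
      ltac:(by []) _ (joint_dot mjd mju)).
  have mdY i : measurable_fun (setT `*` `[0, T])
      (fun p : Omega * R => delta (eval_path (Xu p.1) p.2) p.2 i 0).
    exact: (measurable_coeff_along T_gt0 mXu (md i)).
  (* The limit found along [Xu] shows that an Ito integral exists there, so [ito] is an actual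
     integral and not its default value. *)
  have itoY : is_ito P W T (fun s w => delta (eval_path (Xu w) s) s)
      (ito P W T (fun s w => delta (eval_path (Xu w) s) s)).
    apply: (xgetPex (fun=> 0)); exists (fun w => G (Xu w) - B (Xu w)).
    exact: (ito_limit_is_ito T0 W_brownian mdY mI lY).
  have lY' : ito_limit P W T (fun s w => delta (eval_path (Xu w) s) s)
      (ito P W T (fun s w => delta (eval_path (Xu w) s) s)).
    apply: eq_ito_limit (is_ito_limit W_brownian T0 (lexx T) itoY) => s w sT.
    by have /andP[_ ->] := sT.
  have nuY := ae_lty_transfer uX (measurable_energy mju) nu.
  have ndY := ae_lty_transfer uX mEd nd.
  apply: ae_eq_integral => //.
  + exact (measurableT_comp mq2 mXu).
  + apply: measurableT_comp; first exact: measurable_expeR.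
    apply: emeasurable_funD.
      apply: measurableT_comp => //; exact (measurableT_comp mEd mXu).
    apply/measurable_EFinP; apply: measurable_funM => //.
    by have [_ mito _] := itoY.
  + apply: filterS3 nuY ndY (ito_limit_unique T0 W_brownian lY' lY) => w eu ed -> _.
    rewrite -/(energy T (fun s => delta (eval_path (Xu w) s) s)) costE// /=.
    (* Twice the logarithmic ratio is [2 * G - (2 * B + cost delta)]: the cross term of the cost
       supplies the drift, leaving twice the Ito integral [G - B] minus the energy. *)
    rewrite expr2 -expRD; congr (expR _)%:E.
    rewrite /e /G (costD _ _ _ ustarE eu ed) -/(B (Xu w)); lra.
(* Both expectations are moved to [X], along which all the densities are explicit. *)
- rewrite (law_density_change uX mq2); last by move=> x; rewrite lee_fin sqr_ge0.
  have mk : measurable_fun setT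
      (fun x : path_space T xinit => expeR (energy T (fun s => delta (eval_path x s) s))).
    by apply: measurableT_comp => //; exact: measurable_expeR.
  rewrite (law_density_change X2_X mk); last first.
    by move=> x; exact: expeR_ge0.
  (* As $u_2 = 2u^* - u$, linearity and uniqueness of limits express the Ito part of the density of
     [Xu2] through those of [Xustar] and [Xu]. *)
  have lu2 : ito_limit P W T (fun s w => u2 (eval_path (X w) s) s)
      (fun w => 2 * control_integral ustar X Xustar (X w) - control_integral u X Xu (X w)).
    apply: eq_ito_limit (ito_limitB T0 (ito_limitZ T0 2 ls) lu) => s w _.
    by rewrite /u2 /delta; apply/matrixP => i j; rewrite !mxE; ring.
  have m1 : measurable_fun setT (fun x => (q x ^+ 2)%:E * (law_density Xu X x)%:E)%E.
    by apply: emeasurable_funM => //; apply/measurable_EFinP; exact: measurable_law_density.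
  have m2' : measurable_fun setT (fun x : path_space T xinit =>
      expeR (energy T (fun s => delta (eval_path x s) s)) * (law_density Xu2 X x)%:E)%E.
    by apply: emeasurable_funM => //; apply/measurable_EFinP; exact: measurable_law_density.
  apply: ae_eq_integral => //.
  + exact (measurableT_comp m1 mX).
  + exact (measurableT_comp m2' mX).
  + have c2 := ito_limit_unique T0 W_brownian l2 lu2.
    apply: filterS2 (filterI nu nd) (filterI c2 (filterI du d2)) => w [eu ed] [c2w [-> ->]] _.
    rewrite costE//= -EFinM -EFinM; congr EFin.
    rewrite expr2 -!expRD; congr expR.
    rewrite /e (costD _ _ _ ustarE eu ed) (costD _ 2 u2 _ eu ed)// c2w; lra.
Qed.
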